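(* Let $d\ge2$ be an integer and $-1\le\eta<-\frac2d$. Then the secret-key capacity of the Holevo-Werner channel $\mathcal{W}_{\eta,d}$ satisfies $$K(\mathcal{W}_{\eta,d})\le E_R^2(W_{\eta,d})<E_R(W_{\eta,d}),$$ where $E_R^2(W_{\eta,d}):=\frac12E_R(W_{\eta,d}^{\otimes2})$.
   Context: Holevo-Werner channel on $\mathbb{C}^d$, $\eta\in[-1,1]$: $\mathcal{W}_{\eta,d}(\rho)=\frac{(d-\eta)\mathbf{I}+(d\eta-1)\rho^T}{d^2-1}$ for states $\rho$ ($\mathbf{I}$ the identity operator). Its Choi matrix is the Werner state $W_{\eta,d}=\frac{(d-\eta)\mathbb{I}+(d\eta-1)\mathbb{F}}{d^3-d}$ on $\mathbb{C}^d\otimes\mathbb{C}^d$, with $\mathbb{F}=\sum_{i,j}|ij\rangle\langle ji|$. Relative entropy: $S(\rho\|\sigma)=\mathrm{Tr}(\rho\log_2\rho-\rho\log_2\sigma)$. Relative entropy of entanglement: $E_R(\rho)=\inf_{\sigma\ \mathrm{separable}}S(\rho\|\sigma)$; for $W_{\eta,d}^{\otimes2}$ on $A_1B_1A_2B_2$ the bipartition is $A_1A_2|B_1B_2$. Secret-key capacity $K(\mathcal{E})$: consider adaptive protocols in which Alice and Bob start from registers prepared by local operations and two-way classical communication (LOCC); in each of $n$ rounds Alice sends one system through $\mathcal{E}$ to Bob, followed by an arbitrary trace-preserving LOCC on all their registers. The final state $\rho^n$ must be $\varepsilon$-close in trace norm to a private state with $nR_n$ secret bits, i.e. a state $U(|\Phi_k\rangle\langle\Phi_k|_{ab}\otimes\tau_{a'b'})U^\dagger$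 with $k=2^{nR_n}$, $|\Phi_k\rangle=k^{-1/2}\sum_i|ii\rangle$, $\tau$ any state and $U=\sum_{i,j}|ij\rangle\langle ij|_{ab}\otimes U_{ij}$ a controlled (twisting) unitary; Alice holds $aa'$, Bob $bb'$. $K(\mathcal{E})$ is the supremum over protocols of $\lim_{n\to\infty}R_n$, as $\varepsilon\to0$. *)

(* Defs.v *)
From mathcomp Require Import all_boot all_order all_algebra.
From mathcomp Require Import spectral sesquilinear.
From mathcomp Require Import complex mxtens.
From mathcomp Require Import all_classical all_reals all_analysis.

Set Implicit Arguments.
Unset Strict Implicit.
Unset Printing Implicit Defensive.

Import Order.TTheory GRing.Theory Num.Theory.
Import numFieldNormedType.Exports.
Local Open Scope ring_scope.
Local Open Scope complex_scope.
Local Open Scope sesquilinear_scope.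
Local Open Scope classical_set_scope.

(* Operators on C^n are the matrices 'M[R[i]]_n, and tensor products are those
   of mxtens: the basis vector |i> (x) |j> of C^m (x) C^n has index
   mxtens_index (i, j) in 'I_(m * n). *)

Section States.
Variable R : realType.
Local Notation C := R[i].

(* The order of R[i] makes 0 <= z imply that z is real, so A is Hermitian. *)
Definition psdmx n (A : 'M[C]_n) : Prop :=
  forall v : 'cV[C]_n, 0 <= (v ^t* *m A *m v) 0 0.

Definition state n (rho : 'M[C]_n) : Prop := psdmx rho /\ \tr rho = 1.

Definition separable m n (sigma : 'M[C]_(m * n)) : Prop :=
  exists (r : nat) (p : 'I_r -> R) (alpha : 'I_r -> 'M[C]_m)
         (beta : 'I_r -> 'M[C]_n),
    [/\ forall x, 0 <= p x,
        \sum_x p x = 1,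
        forall x, state (alpha x) /\ state (beta x) &
        sigma = \sum_x (p x)%:C *: (alpha x *t beta x)].

Definition log2 (x : R) : R := ln x / ln 2.

(* Since ln 0 = 0, the kernel of a positive semidefinite A contributes 0. *)
Definition mxlog2 n (A : 'M[C]_n) : 'M[C]_n :=
  invmx (spectralmx A)
  *m diag_mx (map_mx (fun z : C => (log2 (complex.Re z))%:C) (spectral_diag A))
  *m spectralmx A.

(* For Hermitian matrices, the inclusion of row spaces rho <= sigma says that
   the support of rho is contained in that of sigma; otherwise
   - Tr (rho log sigma), hence the relative entropy, is +oo. *)
Definition rel_entropy n (rho sigma : 'M[C]_n) : \bar R :=
  if (rho <= sigma)%MS
  then (complex.Re (\tr (rho *m mxlog2 rho - rho *m mxlog2 sigma)))%:E
  else +oo%E.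

Definition rel_entropy_ent m n (rho : 'M[C]_(m * n)) : \bar R :=
  ereal_inf [set rel_entropy rho sigma | sigma in @separable m n].

(* The sum of the singular values of X. *)
Definition trace_norm n (X : 'M[C]_n) : R :=
  \sum_i Num.sqrt (complex.Re (spectral_diag (X ^t* *m X) 0 i)).

Definition mid_swap_index a1 b1 a2 b2 (x : 'I_((a1 * a2) * (b1 * b2))) :
    'I_((a1 * b1) * (a2 * b2)) :=
  let: (i, j) := mxtens_unindex x in
  let: (i1, i2) := mxtens_unindex i in
  let: (j1, j2) := mxtens_unindex j in
  mxtens_index (mxtens_index (i1, j1), mxtens_index (i2, j2)).

(* Reorders the tensor factors A1 B1 A2 B2 into A1 A2 B1 B2. *)
Definition mid_swap a1 b1 a2 b2 (X : 'M[C]_((a1 * b1) * (a2 * b2))) :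
    'M[C]_((a1 * a2) * (b1 * b2)) :=
  mxsub (@mid_swap_index a1 b1 a2 b2) (@mid_swap_index a1 b1 a2 b2) X.

Definition rel_entropy_ent2 m n (rho : 'M[C]_(m * n)) : \bar R :=
  ((2^-1)%:E
   * @rel_entropy_ent (m * m) (n * n) (mid_swap (rho *t rho)))%E.

End States.

Section Protocols.
Variable R : realType.
Local Notation C := R[i].

(* Trace-preserving LOCC maps from A (x) B to A' (x) B', of dimensions a * b
   and a' * b': one party performs a measurement with Kraus operators K_x and
   broadcasts the outcome x, upon which the parties go on with an LOCC map L_x.
   As L_x need not depend on all of x, this includes coarse-grained
   instruments, hence all local channels and partial traces. *)
Inductive LOCC : forall a b a' b' : nat,
    ('M[C]_(a * b) -> 'M[C]_(a' * b')) -> Prop :=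
| LOCC_id a b : @LOCC a b a b id
| LOCC_Alice a b a' b' (r : nat) (c : 'I_r -> nat)
    (K : forall x, 'M[C]_(c x, a))
    (L : forall x, 'M[C]_(c x * b) -> 'M[C]_(a' * b')) :
    \sum_x (K x) ^t* *m K x = 1%:M ->
    (forall x, @LOCC (c x) b a' b' (L x)) ->
    @LOCC a b a' b'
      (fun rho => \sum_x L x ((K x *t 1%:M) *m rho *m (K x *t 1%:M) ^t*))
| LOCC_Bob a b a' b' (r : nat) (c : 'I_r -> nat)
    (K : forall x, 'M[C]_(c x, b))
    (L : forall x, 'M[C]_(a * c x) -> 'M[C]_(a' * b')) :
    \sum_x (K x) ^t* *m K x = 1%:M ->
    (forall x, @LOCC a (c x) a' b' (L x)) ->
    @LOCC a b a' b'
      (fun rho => \sum_x L x ((1%:M *t K x) *m rho *m (1%:M *t K x) ^t*)).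

(* id (x) E (x) id on A (x) C^d (x) B; the last factor of Alice's register
   becomes the first factor of Bob's. *)
Definition transmit d e (E : 'M[C]_d -> 'M[C]_e) a b
    (rho : 'M[C]_((a * d) * b)) : 'M[C]_(a * (e * b)) :=
  \matrix_(x, y)
    let: (i, pj) := mxtens_unindex x in
    let: (p, j) := mxtens_unindex pj in
    let: (i', qj') := mxtens_unindex y in
    let: (q, j') := mxtens_unindex qj' in
    E (\matrix_(s, t) rho (mxtens_index (mxtens_index (i, s), j))
                          (mxtens_index (mxtens_index (i', t), j'))) p q.

(* adaptive_output E n rho: some adaptive protocol with n uses of E outputs
   rho on A (x) B. The initial state is obtained by LOCC from the trivial state
   on C (x) C. *)
Inductive adaptive_output d e (E : 'M[C]_d -> 'M[C]_e) :
    nat -> forall a b : nat, 'M[C]_(a * b) -> Prop :=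
| adaptive_init a b (L : 'M[C]_(1 * 1) -> 'M[C]_(a * b)) :
    @LOCC 1 1 a b L -> @adaptive_output d e E 0 a b (L 1%:M)
| adaptive_round n a b a' b' (rho : 'M[C]_((a * d) * b))
    (L : 'M[C]_(a * (e * b)) -> 'M[C]_(a' * b')) :
    @adaptive_output d e E n (a * d) b rho ->
    @LOCC a (e * b) a' b' L ->
    @adaptive_output d e E n.+1 a' b' (L (transmit E rho)).

Definition max_ent_vec k : 'cV[C]_(k * k) :=
  ((Num.sqrt k%:R)^-1)%:C
  *: \sum_(i < k) delta_mx (mxtens_index (i, i)) 0.

Definition max_ent_state k : 'M[C]_(k * k) :=
  max_ent_vec k *m (max_ent_vec k) ^t*.

Definition twisting k n (V : 'I_k -> 'I_k -> 'M[C]_n) : 'M[C]_((k * k) * n) :=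
  \sum_(i < k) \sum_(j < k)
    delta_mx (mxtens_index (i, j)) (mxtens_index (i, j)) *t V i j.

(* The twisted state lives on a b a' b'; a private state is viewed on
   aa' (x) bb', with shields a', b' of dimensions s, t. *)
Definition private_state k s t (gamma : 'M[C]_((k * s) * (k * t))) : Prop :=
  (0 < k)%N /\
  exists (tau : 'M[C]_(s * t)) (V : 'I_k -> 'I_k -> 'M[C]_(s * t)),
    [/\ state tau, forall i j, V i j \is unitarymx &
        gamma = mid_swap (twisting V *m (max_ent_state k *t tau)
                          *m (twisting V) ^t*)].

Definition distills_key d e (E : 'M[C]_d -> 'M[C]_e) (n : nat) (eps : R)
    (k : nat) : Prop :=
  exists (s t : nat) (rho gamma : 'M[C]_((k * s) * (k * t))),
    [/\ @adaptive_output d e E n (k * s) (k * t) rho,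
        @private_state k s t gamma & trace_norm (rho - gamma) <= eps].

(* The supremum over families of protocols, one for each number n of uses of E,
   of lim R_n, where k n = 2 ^ (n R_n). *)
Definition eps_key_capacity d e (E : 'M[C]_d -> 'M[C]_e) (eps : R) : \bar R :=
  ereal_sup [set l : \bar R | exists k : nat -> nat,
    (forall n, (0 < n)%N -> distills_key E n eps (k n)) /\
    (log2 (k n)%:R / n%:R)%:E @[n --> \oo] --> l].

Definition key_capacity d e (E : 'M[C]_d -> 'M[C]_e) : \bar R :=
  lim (eps_key_capacity E eps @[eps --> 0^'+]).

End Protocols.

Section HolevoWerner.
Variable R : realType.
Local Notation C := R[i].

(* Linear extension to all matrices of the formula for states, for which
   \tr rho = 1; it is needed to let the channel act on part of a state. *)
Definition holevo_werner (eta : R) d (rho : 'M[C]_d) : 'M[C]_d :=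
  ((d%:R ^+ 2 - 1)^-1)%:C
  *: ((d%:R - eta)%:C *: (\tr rho)%:M + (d%:R * eta - 1)%:C *: rho^T).

Definition flip d : 'M[C]_(d * d) :=
  \sum_(i < d) \sum_(j < d)
    delta_mx (mxtens_index (i, j)) (mxtens_index (j, i)).

Definition werner (eta : R) d : 'M[C]_(d * d) :=
  ((d%:R ^+ 3 - d%:R)^-1)%:C
  *: ((d%:R - eta)%:C *: 1%:M + (d%:R * eta - 1)%:C *: flip d).

End HolevoWerner.

(* Main.v *)
Require Import Defs.
From mathcomp Require Import all_boot all_order all_fingroup all_algebra complex.
From mathcomp Require cyclic separable cyclotomic.
From mathcomp Require Import spectral sesquilinear mxtens.
From mathcomp Require Import all_classical all_reals all_analysis.
From mathcomp Require Import ring lra.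

Set Implicit Arguments.
Unset Strict Implicit.
Unset Printing Implicit Defensive.

Import Order.TTheory GRing.Theory Num.Theory.
Import numFieldNormedType.Exports.
Local Open Scope ring_scope.
Local Open Scope sesquilinear_scope.

(** Let J_0, J_1 be the normalised projections onto the symmetric and the
    antisymmetric subspace.  The Holevo-Werner channel is the mixture, with weights p_0
    and p_1, of the two channels with Choi states J_0 and J_1, so an adaptive protocol
    with n uses outputs the mixture of states F_w over the binary words w of length n,
    with the product weights of p.  Let sigma be separable on A1A2|B1B2.  Twirling it by
    U (x) U on A1B1 and V (x) V on A2B2 gives the sum of q_ab J_a (x) J_b, which is again
    separable; post-selected teleportation through it shows that the mixture of the F_w
    in which successive pairs of labels have law q is separable too.  The projector that
    tests for a private state has weight at least 1 - eps in the first mixture and at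
    most 1/k in the second, so that the divergence of the two laws, which is
    (n/2) D(p (x) p || q), is at least (1 - eps) log k - 1.  Finally
    D(p (x) p || q) <= S(W (x) W || sigma) by concavity of the logarithm, because W (x) W
    is a combination of projections.

    For the strict inequality, E_R(W) >= D(p || (1/2, 1/2)) since Tr(F sigma) >= 0 for
    separable sigma.  On the other hand, move from the twirled |00><00| (x) |11><11| to
    the twirled product of maximally entangled states on A1A2 and on B1B2: in units of
    1 / ln 2, the divergence from p (x) p then decreases to first order at the rate
    eta (eta + 2/d), which is positive.

    The twirl is a finite average: monomial matrices whose entries are fourth roots of
    unity, and their products with the Fourier matrix, form a weighted unitary
    2-design. *)

(** * Separable kernels *)

(** Simulating the protocol on n shared Choi states and bounding the key by their relative entropy
    of entanglement would call for monotonicity of the quantum relative entropy. Here both mixtures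
    consist of the same states F_w, so a protocol enters only through the numbers Tr(P F_w) in
    [0, 1], P being the projector of the test, and only classical laws on words remain to be
    compared. Post-selection is what keeps the F_w the same: contracting Alice's input and her half
    of a resource pair with a maximally entangled vector is a local operation, and up to a scalar it
    applies the channel of that label exactly. The threshold -2/d comes from the swaps of A1B1, of
    A2B2 and their product. Their expectations are 0, 0, 0 at |00><00| (x) |11><11|; 1/d, 1/d, 1 at
    the product of maximally entangled states; and eta, eta, eta^2 in W (x) W. The first-order gain
    is the inner product of the last two triples, 2 eta/d + eta^2, which for negative eta is
    positive exactly when eta < -2/d. *)

Section SeparableKernels.
Variable C : numClosedFieldType.

(** The unnormalised separable cone, over arbitrary index types: registers are pairs or [unit]
    rather than products of ordinals, so regrouping them is mere precomposition. With [unit] as one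
    party this is the cone of positive operators. *)
Definition sepk (X Y : Type) (K : X -> Y -> X -> Y -> C) : Prop :=
  exists (r : nat) (v : 'I_r -> X -> C) (w : 'I_r -> Y -> C),
    forall x y x' y', K x y x' y' = \sum_i v i x * w i y * (v i x' * w i y')^*.

Lemma sepk_ext X Y (K K' : X -> Y -> X -> Y -> C) :
  sepk K -> (forall x y x' y', K' x y x' y' = K x y x' y') -> sepk K'.
Proof. by move=> [r [v [w e]]] e'; exists r, v, w => *; rewrite e' e. Qed.

Lemma sepk0 X Y : @sepk X Y (fun _ _ _ _ => 0).
Proof. by exists 0, (fun _ _ => 0), (fun _ _ => 0) => *; rewrite big_ord0. Qed.

Lemma sepk_prod X Y (v : X -> C) (w : Y -> C) :
  sepk (fun x y x' y' => v x * w y * (v x' * w y')^*).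
Proof. by exists 1, (fun _ => v), (fun _ => w) => *; rewrite big_ord1. Qed.

Lemma sepkD X Y (K K' : X -> Y -> X -> Y -> C) : sepk K -> sepk K' ->
  sepk (fun x y x' y' => K x y x' y' + K' x y x' y').
Proof.
move=> [r [v [w e]]] [r' [v' [w' e']]].
exists (r + r')%N, (fun i => match fintype.split i with inl j => v j | inr j => v' j end),
  (fun i => match fintype.split i with inl j => w j | inr j => w' j end) => x y x' y'.
rewrite e e' big_split_ord /=; congr (_ + _); apply: eq_bigr => i _.
- by rewrite (unsplitK (inl i)).
- by rewrite (unsplitK (inr i)).
Qed.

Lemma sepk_sum X Y I (s : seq I) (Pr : pred I) (K : I -> X -> Y -> X -> Y -> C) :
  (forall i, Pr i -> sepk (K i)) ->
  sepk (fun x y x' y' => \sum_(i <- s | Pr i) K i x y x' y').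
Proof.
move=> h; elim: s => [|i s ih].
  by apply: sepk_ext (sepk0 X Y) _ => *; rewrite big_nil.
have [Pi|nPi] := boolP (Pr i).
  by apply: sepk_ext (sepkD (h i Pi) ih) _ => *; rewrite big_cons Pi.
by apply: sepk_ext ih _ => *; rewrite big_cons (negPf nPi).
Qed.

Lemma sepkZ X Y (c : C) (K : X -> Y -> X -> Y -> C) : 0 <= c -> sepk K ->
  sepk (fun x y x' y' => c * K x y x' y').
Proof.
move=> c0 [r [v [w e]]]; exists r, (fun i x => sqrtC c * v i x), w => x y x' y'.
rewrite e mulr_sumr; apply: eq_bigr => i _.
have sc : (sqrtC c)^* = sqrtC c by apply/CrealP; rewrite ger0_real ?sqrtC_ge0.
by rewrite !rmorphM /= sc -{1}(sqrtCK c); ring.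
Qed.

Lemma sepk_comp X Y X1 Y1 (f : X1 -> X) (g : Y1 -> Y) (K : X -> Y -> X -> Y -> C) :
  sepk K -> sepk (fun x y x' y' => K (f x) (g y) (f x') (g y')).
Proof.
by move=> [r [v [w e]]]; exists r, (fun i => v i \o f), (fun i => w i \o g) => *;
  rewrite e.
Qed.

Lemma sepk_swap X Y (K : X -> Y -> X -> Y -> C) :
  sepk K -> sepk (fun y x y' x' => K x y x' y').
Proof.
move=> [r [v [w e]]]; exists r, w, v => *; rewrite e.
by apply: eq_bigr => i _; congr (_ * Num.conj _); exact: mulrC.
Qed.

(** One Kraus operator of Alice, whose row x has the entries [A x s] in the columns [f x s]. If [f]
    repeats s in two registers, the operator contracts them with an unnormalised maximally entangled
    vector. *)
Lemma sepk_mapA X Y X1 (S : finType) (f : X1 -> S -> X) (A : X1 -> S -> C)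
    (K : X -> Y -> X -> Y -> C) : sepk K ->
  sepk (fun x y x' y' =>
    \sum_s \sum_t A x s * (A x' t)^* * K (f x s) y (f x' t) y').
Proof.
move=> [r [v [w e]]].
exists r, (fun i x => \sum_s A x s * v i (f x s)), w => x y x' y'.
transitivity (\sum_s \sum_t \sum_i
    (A x s * v i (f x s) * w i y) * (A x' t * v i (f x' t) * w i y')^*).
  apply: eq_bigr => s _; apply: eq_bigr => t _; rewrite e mulr_sumr.
  by apply: eq_bigr => i _; rewrite !rmorphM; ring.
under eq_bigr do rewrite exchange_big.
rewrite exchange_big; apply: eq_bigr => i _ /=.
rewrite !mulr_suml rmorph_sum; apply: eq_bigr => s _.
by rewrite mulr_sumr.
Qed.

Lemma sepk_mapB X Y Y1 (S : finType) (f : Y1 -> S -> Y) (A : Y1 -> S -> C)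
    (K : X -> Y -> X -> Y -> C) : sepk K ->
  sepk (fun x y x' y' =>
    \sum_s \sum_t A y s * (A y' t)^* * K x (f y s) x' (f y' t)).
Proof. by move=> /sepk_swap /(sepk_mapA f A) /sepk_swap. Qed.

Lemma sepk_tens X Y X2 Y2 (K : X -> Y -> X -> Y -> C)
    (K2 : X2 -> Y2 -> X2 -> Y2 -> C) : sepk K -> sepk K2 ->
  sepk (fun (x : X * X2) (y : Y * Y2) x' y' =>
     K x.1 y.1 x'.1 y'.1 * K2 x.2 y.2 x'.2 y'.2).
Proof.
move=> [r [v [w e]]] [r2 [v2 [w2 e2]]].
have h i : sepk (fun (x : X * X2) (y : Y * Y2) x' y' =>
   \sum_j (v i x.1 * v2 j x.2) * (w i y.1 * w2 j y.2)
    * ((v i x'.1 * v2 j x'.2) * (w i y'.1 * w2 j y'.2))^*).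
  by apply: sepk_sum => j _; exact: (sepk_prod (fun x : X * X2 => v i x.1 * v2 j x.2)
    (fun y : Y * Y2 => w i y.1 * w2 j y.2)).
apply: sepk_ext (sepk_sum (index_enum _) (fun i _ => h i)) _ => x y x' y'.
rewrite e e2 mulr_suml; apply: eq_bigr => i _; rewrite mulr_sumr.
by apply: eq_bigr => j _; rewrite !rmorphM; ring.
Qed.

End SeparableKernels.

(** * A unitary 2-design *)

Section Twirl.
Variable C : numClosedFieldType.
Variable d : nat.
Variables M N : Type.
Local Notation kernel := ('I_d * M -> 'I_d * N -> 'I_d * M -> 'I_d * N -> C).
Implicit Types (K : kernel) (i j a b : 'I_d).

Definition same_pair i j i' j' :=
  (i == i') && (j == j') || (i == j') && (j == i').

(** The average of K over D (x) D with D diagonal and random: the phases at (i, j) and (i', j')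
    cancel exactly when the two multisets agree. *)
Definition diag_part K : kernel := fun x y x' y' =>
  (same_pair x.1 y.1 x'.1 y'.1)%:R * K x y x' y'.

(** Orthogonality of characters of Z/4. Exponents up to 2 suffice, since a basis index occurs at
    most twice in a pair (i, j). *)
Lemma sum_i_powers (n m : nat) : (n <= 2)%N -> (m <= 2)%N ->
  \sum_(z < 4) 'i ^+ (z * n) * ('i ^+ (z * m))^* = (4 * (n == m))%:R :> C.
Proof.
have e2 : ('i : C) * 'i = -1 by rewrite -expr2 sqrCi.
have eu z : 'i ^+ (z * n) * ('i ^+ (z * m))^* = ('i ^+ n * (- 'i) ^+ m) ^+ z :> C.
  by rewrite exprMn -!exprM rmorphXn /= conjCi; congr (_ ^+ _ * _ ^+ _); exact: mulnC.
under eq_bigr do rewrite eu.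
move: n m {eu} => [|[|[|//]]] [|[|[|//]]] _ _; rewrite !big_ord_recr big_ord0 /=;
  ring: e2.
Qed.

Lemma same_pairP i j i' j' :
  [forall a, ((a == i) + (a == j) == (a == i') + (a == j'))%N] = same_pair i j i' j'.
Proof.
apply/forallP/idP => [h|/orP[]/andP[/eqP-> /eqP->] a //]; last by rewrite addnC.
have := h i; have := h j; rewrite /same_pair !eqxx (eq_sym j i).
case: (eqVneq i i') => [<-|_]; rewrite ?(eq_sym j i).
  by case: (j == j'); case: (i == j'); case: (i == j).
case: (eqVneq i j') => [<-|_]; rewrite ?(eq_sym j i).
  by case: (j == i'); case: (i == j).
by case: (i == j).
Qed.

(** The phases of the basis vectors are averaged one at a time. The phase of vector a contributes
    the factor [c a], which compares the multiplicities of a in the two pairs; the product of these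
    factors is the indicator of [same_pair]. *)
Lemma sepk_diag_part K : sepk K -> sepk (diag_part K).
Proof.
move=> sK.
pose c a (i j i' j' : 'I_d) : C :=
  ((a == i) + (a == j) == (a == i') + (a == j'))%N%:R.
suff h (s : seq 'I_d) : sepk (fun x y x' y' : 'I_d * _ =>
    (\prod_(a <- s) c a x.1 y.1 x'.1 y'.1) * K x y x' y').
  apply: sepk_ext (h (index_enum _)) _ => x y x' y'.
  rewrite /diag_part -same_pairP; congr (_ * _).
  case: forallP => [H|H].
    by rewrite big1 // => a _; rewrite /c H.
  have /existsP[a /negPf Ha] : [exists a, ~~ (((a == x.1) + (a == y.1)
      == (a == x'.1) + (a == y'.1))%N)].
    by rewrite -negb_forall; apply/forallP.
  by rewrite (bigD1 a) //= /c Ha mul0r.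
elim: s => [|a s ih].
  by apply: sepk_ext sK _ => *; rewrite big_nil mul1r.
pose ph (z : 'I_4) (i : 'I_d) : C := 'i ^+ (z * (a == i)).
have st z : sepk (fun x y x' y' : 'I_d * _ => ph z x.1 * (ph z x'.1)^* *
   (ph z y.1 * (ph z y'.1)^*  *
    ((\prod_(a <- s) c a x.1 y.1 x'.1 y'.1) * K x y x' y'))).
  apply: sepk_ext (sepk_mapA (S := unit) (fun x _ => x) (fun x _ => ph z x.1)
    (sepk_mapB (S := unit) (fun x _ => x) (fun x _ => ph z x.1) ih)) _ => x y x' y'.
  by rewrite !(big_const, card_unit) /= !addr0.
have q0 : 0 <= (4%:R : C)^-1 by rewrite invr_ge0 ler0n.
apply: sepk_ext (sepkZ q0 (sepk_sum (index_enum _) (fun z _ => st z))) _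
  => x y x' y'.
rewrite big_cons -mulrA; set Z := _ * K _ _ _ _.
have -> : c a x.1 y.1 x'.1 y'.1 = 4%:R^-1 * (\sum_(z < 4)
   'i ^+ (z * ((a == x.1) + (a == y.1))) * ('i ^+ (z * ((a == x'.1) + (a == y'.1))))^*).
  rewrite sum_i_powers ?natrM ?mulrA ?mulVf ?mul1r ?pnatr_eq0 //.
  - by do 2!case: eqP.
  - by do 2!case: eqP.
rewrite -mulrA; congr (_ * _); rewrite mulr_suml; apply: eq_bigr => z _.
by rewrite /ph !mulnDr !exprD rmorphM /=; ring.
Qed.

Definition perm_sum K : kernel := fun x y x' y' =>
  \sum_(s : 'S_d) K (s x.1, x.2) (s y.1, y.2) (s x'.1, x'.2) (s y'.1, y'.2).

Lemma sepk_perm_sum K : sepk K -> sepk (perm_sum K).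
Proof.
move=> sK; apply: sepk_sum => s _.
exact: (sepk_comp (fun x : 'I_d * M => (s x.1, x.2))
  (fun y : 'I_d * N => (s y.1, y.2)) sK).
Qed.

Lemma sum_perm_point (G : 'I_d -> C) i :
  \sum_(s : 'S_d) G (s i) = #|'S_d|%:R * (d%:R^-1 * \sum_a G a).
Proof.
have inv j : \sum_(s : 'S_d) G (s j) = \sum_(s : 'S_d) G (s i).
  rewrite (reindex_inj (mulgI (tperm i j))) /=; apply: eq_bigr => s _.
  by rewrite permM tpermR.
have d0 : (d%:R : C) != 0 by rewrite pnatr_eq0 -lt0n (leq_ltn_trans _ (ltn_ord i)).
apply: (mulfI d0); rewrite mulrCA (mulrA d%:R) mulfV // mul1r.
transitivity (\sum_(j : 'I_d) \sum_(s : 'S_d) G (s j)).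
  by rewrite (eq_bigr _ (fun j _ => inv j)) sumr_const card_ord mulr_natl.
rewrite exchange_big /= mulr_natl -sumr_const; apply: eq_bigr => s _.
by rewrite [RHS](reindex_inj (@perm_inj _ s)).
Qed.

(** The symmetric group is transitive on the d (d - 1) ordered pairs of distinct points. *)
Lemma sum_perm_pair (G : 'I_d -> 'I_d -> C) i j : i != j ->
  \sum_(s : 'S_d) G (s i) (s j)
  = #|'S_d|%:R * ((d%:R * (d%:R - 1))^-1 * \sum_a \sum_(b | b != a) G a b).
Proof.
move=> nij.
have inv k l : l != k -> \sum_(s : 'S_d) G (s k) (s l) = \sum_(s : 'S_d) G (s i) (s j).
  (* The second transposition moves the image of j under the first one to l and fixes k, so t takes
     (i, j) to (k, l). *)
  move=> nlk; pose t := (tperm i k * tperm (tperm i k j) l)%g.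
  have ti : t i = k.
    rewrite permM tpermL tpermD // -(inj_eq (@perm_inj _ (tperm i k))) tpermK ?tpermR //.
    by rewrite eq_sym.
  have tj : t j = l by rewrite permM tpermL.
  rewrite [RHS](reindex_inj (mulgI t)) /=.
  by apply: eq_bigr => s _; rewrite (permM t s i) (permM t s j) ti tj.
have lt1d : (1 < d)%N.
  by case: (d) i j nij {inv G} => [[]//|[|//]] i j; rewrite (ord1 i) (ord1 j).
have d0 : (d%:R * (d%:R - 1) : C) != 0.
  rewrite mulf_neq0 ?pnatr_eq0 -?lt0n ?(ltn_trans _ lt1d) //.
  by rewrite subr_eq0 pnatr_eq1; case: (d) lt1d => [|[]].
apply: (mulfI d0); rewrite mulrCA mulVKf //.
transitivity (\sum_(k : 'I_d) \sum_(l | l != k) \sum_(s : 'S_d) G (s k) (s l)).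
  rewrite (eq_bigr (fun k : 'I_d => (\sum_(s : 'S_d) G (s i) (s j)) *+ d.-1)); last first.
    by move=> k _; rewrite (eq_bigr _ (inv k)) sumr_const cardC1 card_ord.
  rewrite sumr_const card_ord -mulrnA -[d%:R - 1](natrB _ (ltnW lt1d)).
  by rewrite -natrM mulr_natl mulnC subn1.
under eq_bigr do rewrite exchange_big.
rewrite exchange_big /= mulr_natl -sumr_const; apply: eq_bigr => s _.
rewrite [RHS](reindex_inj (@perm_inj _ s)); apply: eq_bigr => a _.
rewrite [RHS](reindex_inj (@perm_inj _ s)); apply: eq_bigl => b.
by rewrite (inj_eq (@perm_inj _ s)).
Qed.

(** Partial traces over the twirled pair against 1, the swap and the sum of the |aa><aa|. The
    monomial twirl depends on K through these three only; conjugation by U (x) U preserves the first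
    two, so only the third has to be adjusted. *)
Definition trI K m n m' n' : C := \sum_a \sum_b K (a, m) (b, n) (a, m') (b, n').
Definition trF K m n m' n' : C := \sum_a \sum_b K (a, m) (b, n) (b, m') (a, n').
Definition trD K m n m' n' : C := \sum_a K (a, m) (a, n) (a, m') (a, n').

Lemma same_pair_perm (s : 'S_d) i j i' j' :
  same_pair (s i) (s j) (s i') (s j') = same_pair i j i' j'.
Proof. by rewrite /same_pair !(inj_eq (@perm_inj _ s)). Qed.

Lemma sum_offdiag (G : 'I_d -> 'I_d -> C) :
  \sum_a \sum_(b | b != a) G a b = \sum_a \sum_b G a b - \sum_a G a a.
Proof.
rewrite -sumrB; apply: eq_bigr => a _.
by rewrite [in RHS](bigD1 a) //= [RHS]addrC addKr.
Qed.

(** Permutations have three orbits on the entries left by [diag_part]: i = j, the identity pattern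
    with i != j, and the swapped pattern with i != j. On each the result is the mean of K. *)
Lemma perm_sum_diag_part K i j i' j' m n m' n' :
  perm_sum (diag_part K) (i, m) (j, n) (i', m') (j', n') =
  #|'S_d|%:R *
  (if i == j then ((i == i') && (i == j'))%:R * (d%:R^-1 * trD K m n m' n')
   else ((i == i') && (j == j'))%:R *
          ((d%:R * (d%:R - 1))^-1 * (trI K m n m' n' - trD K m n m' n'))
      + ((i == j') && (j == i'))%:R *
          ((d%:R * (d%:R - 1))^-1 * (trF K m n m' n' - trD K m n m' n'))).
Proof.
rewrite /perm_sum /diag_part /=; under eq_bigr do rewrite same_pair_perm.
rewrite -mulr_sumr /same_pair; have [->|nij] := eqVneq i j.
  have [<-|] := eqVneq j i'; have [<-|] := eqVneq j j'; rewrite /= ?mul0r ?mulr0 //.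
  rewrite !mul1r; exact: (sum_perm_point (fun a => K (a, m) (a, n) (a, m') (a, n')) j).
have [e1|_] := boolP ((i == i') && (j == j')).
  case/andP: e1 => /eqP<- /eqP<-; rewrite (negPf nij) /= mul0r addr0 !mul1r.
  rewrite (sum_perm_pair (fun a b => K (a, m) (b, n) (a, m') (b, n'))) //.
  by rewrite (sum_offdiag (fun a b => K (a, m) (b, n) (a, m') (b, n'))).
have [e1|_] := boolP ((i == j') && (j == i')); last by rewrite /= !mul0r addr0 mulr0.
case/andP: e1 => /eqP<- /eqP<-; rewrite /= mul0r add0r !mul1r.
rewrite (sum_perm_pair (fun a b => K (a, m) (b, n) (b, m') (a, n'))) //.
by rewrite (sum_offdiag (fun a b => K (a, m) (b, n) (b, m') (a, n'))).
Qed.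

Variable U : 'I_d -> 'I_d -> C.
Hypothesis U_unitary : forall k l, \sum_i U i k * (U i l)^* = (k == l)%:R.
Hypothesis U_flat : forall i k, U i k * (U i k)^* = d%:R^-1.

Definition conjk K : kernel := fun x y x' y' =>
  \sum_s \sum_t U x.1 s * (U x'.1 t)^* *
    \sum_p \sum_q U y.1 p * (U y'.1 q)^* * K (s, x.2) (p, y.2) (t, x'.2) (q, y'.2).

Lemma sepk_conjk K : sepk K -> sepk (conjk K).
Proof.
move=> sK; exact: (sepk_mapA (fun (x : 'I_d * M) s => (s, x.2)) (fun x s => U x.1 s)
  (sepk_mapB (fun (x : 'I_d * N) s => (s, x.2)) (fun x s => U x.1 s) sK)).
Qed.

Lemma sum_unitary (G : 'I_d -> 'I_d -> C) :
  \sum_a \sum_s \sum_t U a s * (U a t)^* * G s t = \sum_s G s s.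
Proof.
rewrite exchange_big; apply: eq_bigr => s _; rewrite exchange_big /=.
rewrite (bigD1 s) //= [X in _ + X]big1 => [|t nts].
  by rewrite -mulr_suml U_unitary eqxx mul1r addr0.
by rewrite -mulr_suml U_unitary eq_sym (negPf nts) mul0r.
Qed.

Lemma trI_conjk K m n m' n' : trI (conjk K) m n m' n' = trI K m n m' n'.
Proof.
rewrite /trI /conjk /=.
transitivity (\sum_a \sum_s \sum_t U a s * (U a t)^* *
   (\sum_b \sum_p \sum_q U b p * (U b q)^* * K (s, m) (p, n) (t, m') (q, n'))).
  apply: eq_bigr => a _; rewrite exchange_big; apply: eq_bigr => s _.
  rewrite exchange_big; apply: eq_bigr => t _; by rewrite mulr_sumr.
rewrite (sum_unitary (fun s t => \sum_b \sum_p \sum_q U b p * (U b q)^* *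
    K (s, m) (p, n) (t, m') (q, n'))); apply: eq_bigr => s _.
by rewrite (sum_unitary (fun p q => K (s, m) (p, n) (s, m') (q, n'))).
Qed.

Lemma trF_conjk K m n m' n' : trF (conjk K) m n m' n' = trF K m n m' n'.
Proof.
rewrite /trF /conjk /=.
transitivity (\sum_a \sum_s \sum_q U a s * (U a q)^* *
   (\sum_b \sum_p \sum_t U b p * (U b t)^* * K (s, m) (p, n) (t, m') (q, n'))).
  apply: eq_bigr => a _; rewrite exchange_big; apply: eq_bigr => s _ /=.
  transitivity (\sum_b \sum_q \sum_p \sum_t U a s * (U a q)^* *
      (U b p * (U b t)^* * K (s, m) (p, n) (t, m') (q, n'))).
    apply: eq_bigr => b _.
    under eq_bigr => t _ do (rewrite mulr_sumr; under eq_bigr do rewrite mulr_sumr).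
    rewrite exchange_big; under eq_bigr do rewrite exchange_big.
    rewrite exchange_big; apply: eq_bigr => q _; apply: eq_bigr => p _.
    by apply: eq_bigr => t _; ring.
  rewrite exchange_big; apply: eq_bigr => q _; rewrite mulr_sumr.
  apply: eq_bigr => b _; rewrite mulr_sumr; apply: eq_bigr => p _.
  by rewrite mulr_sumr.
rewrite (sum_unitary (fun s q => \sum_b \sum_p \sum_t U b p * (U b t)^* *
    K (s, m) (p, n) (t, m') (q, n'))); apply: eq_bigr => s _.
by rewrite (sum_unitary (fun p t => K (s, m) (p, n) (t, m') (s, n'))).
Qed.

Lemma sum_delta (G : 'I_d -> C) (k : 'I_d) : \sum_i (k == i)%:R * G i = G k.
Proof.
rewrite (bigD1 k) //= big1 ?eqxx ?mul1r ?addr0 // => i ni.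
by rewrite eq_sym (negPf ni) mul0r.
Qed.

(** Inclusion-exclusion: the two matchings of the pairs coincide only when all four indices are
    equal. *)
Lemma same_pair_natr i j i' j' : (same_pair i j i' j')%:R =
  (i == i')%:R * (j == j')%:R + (j == i')%:R * (i == j')%:R
  - (i == j)%:R * ((i == i')%:R * (i == j')%:R) :> C.
Proof.
rewrite /same_pair; case: (eqVneq i j) => [<-|nij].
  by case: (i == i'); case: (i == j') => /=; ring.
case: (eqVneq i i') => [<-|_]; last by case: (j == i'); case: (i == j') => /=; ring.
by rewrite (eq_sym j i) (negPf nij); case: (j == j'); case: (i == j') => /=; ring.
Qed.

(** After [diag_part] the entries of U occur as two products of an entry with its own conjugate.
    Flatness turns them into d^-2, so every surviving entry of K gets the same weight. *)
Lemma trD_conjk K m n m' n' : (0 < d)%N ->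
  trD (conjk (diag_part K)) m n m' n'
  = d%:R^-1 * (trI K m n m' n' + trF K m n m' n' - trD K m n m' n').
Proof.
move=> d0; have dn0 : (d%:R : C) != 0 by rewrite pnatr_eq0 -lt0n.
pose k s p t q := K (s, m) (p, n) (t, m') (q, n').
rewrite /trD /conjk /diag_part /=.
transitivity (\sum_(a < d) d%:R^-2 * \sum_s \sum_p \sum_t \sum_q
    (same_pair s p t q)%:R * k s p t q).
  apply: eq_bigr => a _; rewrite mulr_sumr; apply: eq_bigr => s _ /=.
  under eq_bigr do rewrite mulr_sumr; rewrite exchange_big mulr_sumr.
  apply: eq_bigr => p _; rewrite mulr_sumr; apply: eq_bigr => t _.
  rewrite !mulr_sumr; apply: eq_bigr => q _; rewrite -/(k s p t q) /same_pair.
  have f2 u v : U a u * (U a u)^* * (U a v * (U a v)^*) = d%:R^-2.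
    by rewrite !U_flat expr2 invfM.
  have [/orP[]/andP[/eqP<- /eqP<-]|_] := boolP (_ || _); last by rewrite !mul0r !mulr0.
  - by rewrite mulrA f2.
  - by rewrite -(f2 s p); ring.
rewrite sumr_const card_ord -[LHS]mulr_natl mulrA.
have -> : d%:R * (d%:R ^- 2) = d%:R^-1 :> C by field.
congr (_ * _).
transitivity (\sum_s \sum_p ((k s p s p) + k s p p s - (s == p)%:R * k s s s s)).
  apply: eq_bigr => s _; apply: eq_bigr => p _.
  transitivity (\sum_t \sum_q ((s == t)%:R * ((p == q)%:R * k s p t q)
     + (p == t)%:R * ((s == q)%:R * k s p t q)
     - (s == p)%:R * ((s == t)%:R * ((s == q)%:R * k s p t q)))).
    by apply: eq_bigr => t _; apply: eq_bigr => q _; rewrite same_pair_natr; ring.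
  transitivity (\sum_t ((s == t)%:R * k s p t p + (p == t)%:R * k s p t s
     - (s == p)%:R * ((s == t)%:R * k s p t s))).
    apply: eq_bigr => t _; rewrite sumrB big_split /= -!mulr_sumr.
    by rewrite (sum_delta (k s p t)) (sum_delta (k s p t)).
  rewrite sumrB big_split /= -mulr_sumr !(sum_delta (fun t => k s p t _)).
  by congr (_ - _); case: eqVneq => [<-|_]; rewrite ?mul0r.
rewrite (eq_bigr (fun s => \sum_p k s p s p + \sum_p k s p p s - k s s s s)).
  by rewrite sumrB big_split.
by move=> s _; rewrite sumrB big_split /= (sum_delta (fun _ => k s s s s)).
Qed.

(* The weights 1/(d+1) and d/(d+1) of the monomial and of the flat unitaries
   make the diagonal moments agree with those of the Haar measure. *)
Lemma sepk_unitary_twirl K : (1 < d)%N -> sepk K ->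
  sepk (fun (x : 'I_d * M) (y : 'I_d * N) (x' : 'I_d * M) (y' : 'I_d * N) =>
  let I := trI K x.2 y.2 x'.2 y'.2 in
  let F := trF K x.2 y.2 x'.2 y'.2 in
  (d%:R * (d%:R ^+ 2 - 1))^-1 *
  (((x.1 == x'.1) && (y.1 == y'.1))%:R * (d%:R * I - F)
   + ((x.1 == y'.1) && (y.1 == x'.1))%:R * (d%:R * F - I))).
Proof.
move=> lt1d sK.
have d0 : (d%:R : C) != 0 by rewrite pnatr_eq0 -lt0n ltnW.
have d1 : (d%:R - 1 : C) != 0 by rewrite subr_eq0 pnatr_eq1; case: (d) lt1d => [|[]].
have d2 : (d%:R + 1 : C) != 0 by rewrite natr1 pnatr_eq0.
have d3 : (d%:R ^+ 2 - 1 : C) != 0 by rewrite subr_sqr_1 mulf_neq0.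
have Sn0 : (#|'S_d|%:R : C) != 0.
  by rewrite pnatr_eq0 -lt0n; apply/card_gt0P; exists 1%g.
have s1 := sepk_perm_sum (sepk_diag_part sK).
have s2 := sepk_perm_sum (sepk_diag_part (sepk_conjk (sepk_diag_part sK))).
have p1 : 0 <= (#|'S_d|%:R * (d%:R + 1) : C)^-1.
  by rewrite invr_ge0 mulr_ge0 ?addr_ge0 ?ler0n.
have p2 : 0 <= (#|'S_d|%:R * (d%:R + 1) / d%:R : C)^-1.
  by rewrite invr_ge0 !mulr_ge0 ?addr_ge0 ?invr_ge0 ?ler0n.
apply: sepk_ext (sepkD (sepkZ p1 s1) (sepkZ p2 s2)) _.
move=> [i m] [j n] [i' m'] [j' n'] /=.
have trI_dp : trI (diag_part K) m n m' n' = trI K m n m' n'.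
  apply: eq_bigr => a _; apply: eq_bigr => b _.
  by rewrite /diag_part /same_pair !eqxx mul1r.
have trF_dp : trF (diag_part K) m n m' n' = trF K m n m' n'.
  apply: eq_bigr => a _; apply: eq_bigr => b _.
  by rewrite /diag_part /same_pair !eqxx orbT mul1r.
rewrite !perm_sum_diag_part trI_conjk trF_conjk trD_conjk ?(ltnW lt1d) // trI_dp trF_dp.
set I := trI _ _ _ _ _; set F := trF _ _ _ _ _; set D := trD _ _ _ _ _.
case: (eqVneq i j) => [<-|nij].
  by rewrite (andbC (i == j')); case: (_ && _) => /=; field; rewrite ?d0 ?d1 ?d2 ?d3 ?Sn0.
by case: (_ && _); case: (_ && _) => /=; field; rewrite ?d0 ?d1 ?d2 ?d3 ?Sn0.
Qed.
End Twirl.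

(** * The Fourier matrix *)

(** X^n - 1 splits and is separable, so it has n distinct roots, and a finite group of roots of
    unity is cyclic. *)
Lemma prim_root_exists (C : numClosedFieldType) n :
  (0 < n)%N -> exists z : C, n.-primitive_root z.
Proof.
pose p : {poly C} := 'X^n - 1; have [r Dp] := closed_field_poly_normal p.
move=> n_gt0; rewrite (monicP _) ?monicXnsubC // scale1r in Dp.
have rn1 : all n.-unity_root r by apply/allP => z; rewrite -root_prod_XsubC -Dp.
have sz_r : (n < (size r).+1)%N.
  by rewrite -(size_prod_XsubC r id) -Dp size_XnsubC.
have [|z] := hasP (cyclic.has_prim_root n_gt0 rn1 _ sz_r); last by exists z.
by rewrite -separable.separable_prod_XsubC -Dp cyclotomic.separable_Xn_sub_1 // pnatr_eq0 -lt0n.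
Qed.

Lemma flat_unitary_exists (C : numClosedFieldType) d : (0 < d)%N ->
  exists U : 'I_d -> 'I_d -> C,
    (forall k l, \sum_i U i k * (U i l)^* = (k == l)%:R) /\
    (forall i k, U i k * (U i k)^* = d%:R^-1).
Proof.
move=> d0; have [z pz] := prim_root_exists C d0.
have dn0 : (d%:R : C) != 0 by rewrite pnatr_eq0 -lt0n.
have zd : z ^+ d = 1 by apply: prim_expr_order pz.
have nz : `|z| = 1.
  by apply/eqP; rewrite -(@pexpr_eq1 _ _ d) ?normr_ge0 // -normrX zd normr1.
have zz : z * z^* = 1 by rewrite -normCK nz expr1n.
have q0 : 0 <= (d%:R : C)^-1 by rewrite invr_ge0 ler0n.
pose q : C := sqrtC d%:R^-1.
have qq : q * q^* = d%:R^-1.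
  by rewrite -normCK ger0_norm ?sqrtC_ge0 // sqrtCK.
exists (fun i k => q * z ^+ (i * k)); split=> [k l|i k]; last first.
  rewrite !(rmorphM, rmorphXn) /= -[RHS]qq mulrACA -exprMn zz expr1n mulr1 //.
pose w := z ^+ k * (z^* ) ^+ l.
transitivity (d%:R^-1 * \sum_(i < d) w ^+ i).
  rewrite mulr_sumr; apply: eq_bigr => i _.
  rewrite !(rmorphM, rmorphXn) /= -qq mulrACA /w exprMn -!exprM.
  by rewrite (mulnC k) (mulnC l).
have [kl|nkl] := eqVneq k l.
  (* For k = l all terms are 1; otherwise [w] is a d-th root of unity other than 1 and the geometric
     sum vanishes. *)
  rewrite (eq_bigr (fun _ => 1)) ?sumr_const ?card_ord ?mulVf // => i _.
  by rewrite /w kl -exprMn zz !expr1n.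
apply/eqP; rewrite mulf_eq0 invr_eq0 (negPf dn0) /=.
have : (w - 1) * (\sum_(i < d) w ^+ i) == 0.
  rewrite -subrX1 /w exprMn -!exprM (mulnC k) (mulnC l) !exprM zd -rmorphXn /= zd.
  by rewrite rmorph1 !expr1n mulr1 subrr.
rewrite mulf_eq0 => /orP[|//]; rewrite subr_eq0 => /eqP w1.
have /eqP : z ^+ k = z ^+ l.
  by rewrite -[LHS]mulr1 -(expr1n C l) -zz exprMn mulrCA -/w w1 mulr1.
rewrite (eq_prim_root_expr pz) !modn_small ?ltn_ord // => kl.
by case/negP: nkl.
Qed.

(** * Spectral decompositions *)

Section Sesquilinear.
Variable C : numClosedFieldType.

Lemma mulmxtC m n p (A : 'M[C]_(m, n)) (B : 'M[C]_(n, p)) :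
  (A *m B) ^t* = B ^t* *m A ^t*.
Proof. by rewrite trmx_mul map_mxM. Qed.

Lemma sesqui_delta n (B : 'M[C]_n) (j k : 'I_n) (c : C) :
  let v : 'cV[C]_n := delta_mx j 0 + c *: delta_mx k 0 in
  (v ^t* *m B *m v) 0 0
  = B j j + c * B j k + Num.conj c * B k j + Num.conj c * c * B k k.
Proof.
have e a b : ((delta_mx 0 a : 'rV[C]_n) *m B *m (delta_mx b 0 : 'cV[C]_n)) 0 0 = B a b.
  by rewrite -rowE -colE !mxE.
move=> v.
have -> : v ^t* = delta_mx 0 j + Num.conj c *: delta_mx 0 k.
  by rewrite /v linearD linearZ /= map_mxD map_mxZ /= !trmx_delta !map_delta_mx.
have D (X Y : 'M[C]_1) : (X + Y) 0 0 = X 0 0 + Y 0 0 by rewrite mxE.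
have Z b (X : 'M[C]_1) : (b *: X) 0 0 = b * X 0 0 by rewrite mxE.
rewrite /v !mulmxDl !mulmxDr -!scalemxAl -!scalemxAr !(D, Z) !e; ring.
Qed.

(** Polarisation: the form of A is real, so that of A minus its adjoint vanishes on all vectors e_j
    + c e_k. *)
Lemma psd_form_herm n (A : 'M[C]_n) :
  (forall v : 'cV[C]_n, 0 <= (v ^t* *m A *m v) 0 0) -> A ^t* = A.
Proof.
move=> hA; apply/eqP; rewrite eq_sym -subr_eq0; apply/eqP/matrixP => j k.
set B := A - A ^t*.
have B0 (v : 'cV[C]_n) : (v ^t* *m B *m v) 0 0 = 0.
  have vr : Num.conj ((v ^t* *m A *m v) 0 0) = (v ^t* *m A *m v) 0 0.
    by apply/CrealP; rewrite ger0_real.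
  have e : (v ^t* *m A ^t* *m v) 0 0 = Num.conj ((v ^t* *m A *m v) 0 0).
    transitivity (((v ^t* *m A *m v) ^t*) 0 0); last by rewrite !mxE.
    by rewrite !mulmxtC trmxCK mulmxA.
  by rewrite /B mulmxBr mulmxBl mxE [X in _ + X]mxE e vr subrr.
rewrite [RHS]mxE.
have h c := etrans (esym (sesqui_delta B j k c)) (B0 (delta_mx j 0 + c *: delta_mx k 0)).
have ii : ('i : C) * 'i = -1 by rewrite -expr2 sqrCi.
have n4 : (4 : C) * 'i != 0 by rewrite mulf_neq0 ?pnatr_eq0 ?neq0Ci.
apply: (mulfI n4); rewrite mulr0.
have := h 'i; have := h (-1); have := h 1; rewrite rmorphN /= !rmorph1 conjCi.
set x := B j j; set y := B j k; set z := B k j; set w := B k k => h1 h2 h3.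
transitivity ('i * (x + 1 * y + 1 * z + 1 * 1 * w)
  - 'i * (x + -1 * y + -1 * z + -1 * -1 * w) + 2 * (x + 'i * y + - 'i * z + - 'i * 'i * w)
  - (x + 1 * y + 1 * z + 1 * 1 * w) - (x + -1 * y + -1 * z + -1 * -1 * w)).
  by ring: ii.
by rewrite h1 h2 h3 !mulr0 !subr0 addr0.
Qed.

Lemma spectral_row n (A : 'M[C]_n) : A ^t* = A ->
  spectralmx A *m A = diag_mx (spectral_diag A) *m spectralmx A.
Proof.
move=> hA; have /orthomx_spectralP {2}-> : A \is normalmx by apply/normalmxP; rewrite hA.
by rewrite !mulmxA mulmxV ?mul1mx ?spectral_unit.
Qed.

(** The eigenbasis behind [spectralmx] is not adapted to the P i, and the l i may coincide. But u A
    = D u gives l i * (u P_i) k j = s k * (u P_i) k j, so wherever an entry of u P_i is non-zero the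
    eigenvalues l i and s k agree, and so do their images under f. *)
Lemma spectral_map_proj n (I : finType) (P : I -> 'M[C]_n) (l : I -> C) (f : C -> C)
    (A := \sum_i l i *: P i) :
  (forall i j, P i *m P j = (i == j)%:R *: P i) -> \sum_i P i = 1%:M ->
  (forall i, (P i) ^t* = P i) -> (forall i, (l i)^* = l i) ->
  invmx (spectralmx A) *m diag_mx (map_mx f (spectral_diag A)) *m spectralmx A
  = \sum_i f (l i) *: P i.
Proof.
move=> PP P1 Ph lr.
have hA : A ^t* = A.
  rewrite /A !linear_sum /= map_mx_sum; apply: eq_bigr => i _.
  by rewrite linearZ /= map_mxZ /= lr Ph.
set u := spectralmx A; set s := spectral_diag A.
have uA : u *m A = diag_mx s *m u := spectral_row hA.
have AP i : A *m P i = l i *: P i.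
  rewrite /A mulmx_suml (bigD1 i) //= big1 ?addr0 => [|j nji].
    by rewrite -scalemxAl PP eqxx scale1r.
  by rewrite -scalemxAl PP (negPf nji) scale0r scaler0.
have e k i j : l i * (u *m P i) k j = s 0 k * (u *m P i) k j.
  have -> : s 0 k * (u *m P i) k j = (u *m A *m P i) k j.
    by rewrite uA -mulmxA mul_diag_mx [RHS]mxE.
  by rewrite -mulmxA AP -scalemxAr [RHS]mxE.
rewrite -mulmxA; set D := diag_mx _.
suff -> : D *m u = u *m \sum_i f (l i) *: P i.
  by rewrite mulmxA mulVmx ?mul1mx ?spectral_unit.
rewrite -[in LHS](mulmx1 u) -P1 !mulmx_sumr; apply: eq_bigr => i _.
rewrite -scalemxAr; apply/matrixP => k j; rewrite mul_diag_mx.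
transitivity (f (s 0 k) * (u *m P i) k j); first by rewrite !mxE.
transitivity (f (l i) * (u *m P i) k j); last by rewrite [RHS]mxE.
have := e k i j; case: (eqVneq ((u *m P i) k j) 0) => [->|nz]; first by rewrite !mulr0.
by move=> /(mulIf nz) <-.
Qed.

Lemma scalemxE m n (c : C) (A : 'M[C]_(m, n)) i j : (c *: A) i j = c * A i j.
Proof. by rewrite mxE. Qed.

Lemma scale_addACA (V : lmodType C) (a a' b b' : C) (A B : V) :
  a *: A + b *: B + (a' *: A + b' *: B) = (a + a') *: A + (b + b') *: B.
Proof. by rewrite !scalerDl addrACA. Qed.

(** The number <e_k| P |e_k> for the k-th eigenvector of A. Traces of P against functions of A
    become weighted scalar sums, to which Jensen's inequality applies. *)
Definition spectral_weight n (A P : 'M[C]_n) (k : 'I_n) : C :=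
  (spectralmx A *m P *m (spectralmx A) ^t*) k k.

Lemma tr_spectral_map n (A P : 'M[C]_n) (f : C -> C) :
  \tr (P *m (invmx (spectralmx A) *m diag_mx (map_mx f (spectral_diag A))
             *m spectralmx A))
  = \sum_k spectral_weight A P k * f (spectral_diag A 0 k).
Proof.
rewrite invmx_unitary ?spectral_unitarymx // mulmxA mxtrace_mulC !mulmxA.
by apply: eq_bigr => k _; rewrite mul_mx_diag [LHS]mxE; congr (_ * _); rewrite mxE.
Qed.

Lemma tr_spectral_self n (A P : 'M[C]_n) : A ^t* = A ->
  \tr (P *m A) = \sum_k spectral_weight A P k * spectral_diag A 0 k.
Proof.
move=> hA; rewrite -(tr_spectral_map A P id) map_mx_id //.
by congr (\tr (P *m _)); apply/orthomx_spectralP/normalmxP; rewrite hA.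
Qed.

Lemma sum_spectral_weight n (A P : 'M[C]_n) : \sum_k spectral_weight A P k = \tr P.
Proof.
have U := spectral_unitarymx A.
rewrite -[in RHS](mulmx1 P) -(mulVmx (spectral_unit A)) invmx_unitary //.
by rewrite mulmxA mxtrace_mulC mulmxA.
Qed.

Lemma mulmxtC_diag_ge0 m n (A : 'M[C]_(m, n)) k : 0 <= (A *m A ^t*) k k.
Proof. by rewrite mxE sumr_ge0 // => i _; rewrite !mxE mul_conjC_ge0. Qed.

Lemma spectral_weight_ge0 n (A P : 'M[C]_n) k :
  P ^t* = P -> P *m P = P -> 0 <= spectral_weight A P k.
Proof.
move=> hP PP; rewrite /spectral_weight -PP -{2}hP mulmxA -mulmxA -mulmxtC.
exact: mulmxtC_diag_ge0.
Qed.

Lemma spectral_diag_ge0 n (A : 'M[C]_n) k : A ^t* = A ->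
  (forall v : 'cV[C]_n, 0 <= (v ^t* *m A *m v) 0 0) -> 0 <= spectral_diag A 0 k.
Proof.
move=> hA pA; have := pA ((row k (spectralmx A)) ^t*).
rewrite trmxCK -row_mul spectral_row // row_mul -mulmxA.
have U : spectralmx A *m (spectralmx A) ^t* = 1%:M.
  by apply/unitarymxP/spectral_unitarymx.
have -> : spectralmx A *m (row k (spectralmx A)) ^t* = delta_mx k 0.
  rewrite rowE mulmxtC mulmxA U mul1mx trmx_delta map_delta_mx //.
by rewrite -colE !mxE eqxx.
Qed.

Lemma psd_factor n (A : 'M[C]_n) :
  (forall v : 'cV[C]_n, 0 <= (v ^t* *m A *m v) 0 0) ->
  exists v : 'I_n -> 'I_n -> C, forall x x', A x x' = \sum_k v k x * (v k x')^*.
Proof.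
move=> pA; have hA := psd_form_herm pA.
pose u := spectralmx A; pose s := spectral_diag A.
have eA : A = u ^t* *m diag_mx s *m u.
  rewrite -invmx_unitary ?spectral_unitarymx //.
  by apply/orthomx_spectralP/normalmxP; rewrite hA.
exists (fun k x => sqrtC (s 0 k) * (u k x)^*) => x x'.
rewrite {1}eA mxE; apply: eq_bigr => k _; rewrite mul_mx_diag [X in X * _]mxE !mxE.
have s0 := spectral_diag_ge0 k hA pA.
have sc : (sqrtC (s 0 k))^* = sqrtC (s 0 k).
  by apply/CrealP; rewrite ger0_real ?sqrtC_ge0.
by rewrite rmorphM /= conjCK sc -{1}(sqrtCK (s 0 k)); ring.
Qed.

Lemma spectral_weight_supp n (A P : 'M[C]_n) k : A ^t* = A ->
  (forall v : 'rV[C]_n, v *m A = 0 -> v *m P = 0) ->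
  spectral_diag A 0 k = 0 -> spectral_weight A P k = 0.
Proof.
move=> hA sP s0.
have r0 : row k (spectralmx A) *m A = 0.
  rewrite -row_mul spectral_row // row_mul row_diag_mx s0 scale0r mul0mx //.
have := congr1 (fun v : 'rV_n => (v *m (spectralmx A) ^t*) 0 k) (sP _ r0).
by rewrite mul0mx -!row_mul [LHS]mxE [RHS]mxE.
Qed.

Lemma supp_sub n (A B : 'M[C]_n) (v : 'rV[C]_n) : A ^t* = A -> B ^t* = B ->
  (B <= A)%MS -> v *m A = 0 -> v *m B = 0.
Proof.
move=> hA hB /submxP[X eB] vA; rewrite -hB eB mulmxtC hA mulmxA vA mul0mx //.
Qed.

Lemma proj_comb_mul n (I : finType) (P : I -> 'M[C]_n) (c e : I -> C) :
  (forall i j, P i *m P j = (i == j)%:R *: P i) ->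
  (\sum_i c i *: P i) *m (\sum_i e i *: P i) = \sum_i (c i * e i) *: P i.
Proof.
move=> PP; rewrite mulmx_suml; apply: eq_bigr => i _.
rewrite mulmx_sumr (bigD1 i) //= big1 ?addr0 => [|j nji].
  by rewrite -scalemxAl -scalemxAr PP eqxx scale1r scalerA.
by rewrite -scalemxAl -scalemxAr PP eq_sym (negPf nji) scale0r !scaler0.
Qed.

Lemma proj_comb_herm n (I : finType) (P : I -> 'M[C]_n) (l : I -> C) :
  (forall i, (P i) ^t* = P i) -> (forall i, (l i)^* = l i) ->
  (\sum_i l i *: P i) ^t* = \sum_i l i *: P i.
Proof.
move=> Ph lr; rewrite !linear_sum /= map_mx_sum; apply: eq_bigr => i _.
by rewrite linearZ /= map_mxZ /= lr Ph.
Qed.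

Lemma tr_proj_comb n (I : finType) (P : I -> 'M[C]_n) (c : I -> C) (X : 'M[C]_n) :
  \tr ((\sum_i c i *: P i) *m X) = \sum_i c i * \tr (P i *m X).
Proof.
by rewrite mulmx_suml linear_sum; apply: eq_bigr => i _; rewrite -scalemxAl linearZ.
Qed.

End Sesquilinear.

(** * Twirling two pairs *)

Section PairTwirl.
Variable C : numClosedFieldType.
Variable d : nat.
Hypothesis lt1d : (1 < d)%N.

(* The kernel of (1 + F) / (d (d + 1)) for [a = false] and of
   (1 - F) / (d (d - 1)) for [a = true]: the two extreme Werner states. *)
Definition choi (a : bool) (i j i' j' : 'I_d) : C :=
  (((i == i') && (j == j'))%:R + (-1) ^+ a * ((i == j') && (j == i'))%:R)
  / (d%:R * (d%:R + (-1) ^+ a)).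

(** The partial trace over the first pair against (1 + F)/2 or (1 - F)/2. *)
Definition trP M N (a : bool) (K : 'I_d * M -> 'I_d * N -> 'I_d * M -> 'I_d * N -> C)
  m n m' n' : C := (trI K m n m' n' + (-1) ^+ a * trF K m n m' n') / 2.

Lemma sepk_choi_twirl M N (K : 'I_d * M -> 'I_d * N -> 'I_d * M -> 'I_d * N -> C) :
  sepk K -> sepk (fun (x : 'I_d * M) (y : 'I_d * N) (x' : 'I_d * M) (y' : 'I_d * N) =>
  \sum_a choi a x.1 y.1 x'.1 y'.1 * trP a K x.2 y.2 x'.2 y'.2).
Proof.
have d0 : (d%:R : C) != 0 by rewrite pnatr_eq0 -lt0n ltnW.
have d1 : (d%:R - 1 : C) != 0 by rewrite subr_eq0 pnatr_eq1; case: (d) lt1d => [|[]].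
have d2 : (d%:R + 1 : C) != 0 by rewrite natr1 pnatr_eq0.
have d3 : (d%:R ^+ 2 - 1 : C) != 0 by rewrite subr_sqr_1 mulf_neq0.
move=> sK; have [U [U1 U2]] := flat_unitary_exists C (ltnW lt1d).
apply: sepk_ext (sepk_unitary_twirl U1 U2 lt1d sK) _ => x y x' y'.
rewrite big_bool /trP /choi /= expr0 expr1.
by field; rewrite ?d0 ?d1 ?d2 ?d3.
Qed.

Local Notation kernel2 := ('I_d * 'I_d -> 'I_d * 'I_d -> 'I_d * 'I_d -> 'I_d * 'I_d -> C).

(** The trace of K against the projection labelled a on the first pair times the one labelled b on
    the second, as [tr_pairmx] shows. *)
Definition pair_weight (K : kernel2) (a b : bool) : C :=
  (\sum_m \sum_n trP a K m n m n + (-1) ^+ b * \sum_m \sum_n trP a K m n n m) / 2.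

(** The twirl of one pair treats the other as a spectator; the pairs are exchanged between two such
    twirls and exchanged back at the end. *)
Lemma sepk_pair_twirl (K : kernel2) : sepk K ->
  sepk (fun x y x' y' : 'I_d * 'I_d => \sum_a \sum_b pair_weight K a b
    * (choi a x.1 y.1 x'.1 y'.1 * choi b x.2 y.2 x'.2 y'.2)).
Proof.
move=> sK; pose sw (x : 'I_d * 'I_d) := (x.2, x.1).
have s2 := sepk_choi_twirl (sepk_comp sw sw (sepk_choi_twirl sK)).
apply: sepk_ext (sepk_comp sw sw s2) _ => [[i m] [j n] [i' m'] [j' n']] /=.
rewrite exchange_big; apply: eq_bigr => b _ /=.
have pull (c : bool -> C) (h : bool -> 'I_d -> 'I_d -> C) :
    \sum_k \sum_l \sum_a c a * h a k l = \sum_a c a * \sum_k \sum_l h a k l.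
  under eq_bigr do rewrite exchange_big.
  rewrite exchange_big; apply: eq_bigr => a _; rewrite mulr_sumr.
  by apply: eq_bigr => k _; rewrite mulr_sumr.
rewrite [trP]lock /= -lock {1}/trP /trI /trF /=.
rewrite (pull (fun a => choi a i j i' j') (fun a k l => trP a K k l k l)).
rewrite (pull (fun a => choi a i j i' j') (fun a k l => trP a K k l l k)).
by rewrite !big_bool /pair_weight /=; ring.
Qed.

Lemma pair_weight_eq (K : kernel2) a b (h : 'I_d -> 'I_d -> 'I_d -> 'I_d -> C) :
  (forall m n m' n', trP a K m n m' n' = h m n m' n') ->
  pair_weight K a b
  = (\sum_m \sum_n h m n m n + (-1) ^+ b * \sum_m \sum_n h m n n m) / 2.
Proof.
move=> eh; congr ((_ + _ * _) / _); apply: eq_bigr => m _; apply: eq_bigr => n _;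
  exact: eh.
Qed.

Lemma pair_weight_lin (c c' : C) (K K' : kernel2) a b :
  pair_weight (fun x y x' y' => c * K x y x' y' + c' * K' x y x' y') a b
  = c * pair_weight K a b + c' * pair_weight K' a b.
Proof.
have lin (f g : 'I_d -> 'I_d -> C) : \sum_i \sum_j (c * f i j + c' * g i j)
    = c * \sum_i \sum_j f i j + c' * \sum_i \sum_j g i j.
  rewrite !mulr_sumr -big_split; apply: eq_bigr => i _.
  by rewrite !mulr_sumr -big_split.
have tP m n m' n' :
    trP a (fun x y x' y' => c * K x y x' y' + c' * K' x y x' y') m n m' n'
    = c * trP a K m n m' n' + c' * trP a K' m n m' n'.
  by rewrite /trP /trI /trF !lin; ring.
rewrite (pair_weight_eq b tP) (lin (fun m n => trP a K m n m n) (fun m n => trP a K' m n m n)).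
by rewrite (lin (fun m n => trP a K m n n m) (fun m n => trP a K' m n n m)) /pair_weight; ring.
Qed.

(** Either swap, and their product, sends |ee> (x) |ff> to an orthogonal vector, so only the
    identity part of each projection contributes. *)
Lemma pair_weight_orthogonal (e f : 'I_d) a b : e != f ->
  pair_weight (fun x y x' y' => (x == (e, e))%:R * (y == (f, f))%:R
     * ((x' == (e, e))%:R * (y' == (f, f))%:R)^*) a b = 4^-1.
Proof.
move=> nef; set K := fun x : 'I_d * 'I_d => _.
have tP m n m' n' : trP a K m n m' n'
    = (e == m)%:R * ((f == n)%:R * ((e == m')%:R * (f == n')%:R)) / 2.
  have -> : trP a K m n m' n' = (\sum_i \sum_j (e == i)%:R * ((f == j)%:R *
      ((e == m)%:R * ((f == n)%:R * ((e == m')%:R * (f == n')%:R))))) / 2.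
    rewrite /trP [trF _ _ _ _ _]big1 ?mulr0 ?addr0 => [|i _]; last first.
      apply: big1 => j _; rewrite /K /= !xpair_eqE.
      case: (eqVneq i e) => [->|_]; last by rewrite !mul0r.
      by rewrite (negPf nef) /= mulr0 rmorph0 mulr0.
    congr (_ / _); apply: eq_bigr => i _; apply: eq_bigr => j _.
    rewrite /K /= !xpair_eqE !rmorphM /= !rmorph_nat !(eq_sym _ e) !(eq_sym _ f).
    by case: (e == i); case: (f == j); rewrite /= ?(mul0r, mulr0) ?mul1r // -?mulrA.
  under eq_bigr do rewrite -mulr_sumr; rewrite sum_delta.
  by rewrite sum_delta.
rewrite (pair_weight_eq b tP).
rewrite [X in _ + _ * X]big1 => [|m _]; last first.
  apply: big1 => n _; case: (eqVneq e m) => [<-|_]; last by rewrite !mul0r.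
  by rewrite (eq_sym f e) (negPf nef) /= !mulr0 mul0r.
rewrite mulr0 addr0 (bigD1 e) //= (bigD1 f) //= !eqxx !big1 => [|m nm|n nn].
- by rewrite /=; field.
- by apply: big1 => n _; rewrite eq_sym (negPf nm) !mul0r.
- by rewrite (eq_sym f) (negPf nn) mul0r mulr0 mul0r.
Qed.

(** The vectors are unnormalised: the traces against 1, either swap and the product of both swaps
    are d^2, d and d^2. *)
Lemma pair_weight_max_ent a b :
  pair_weight (fun x y x' y' => (x.1 == x.2)%:R * (y.1 == y.2)%:R
     * ((x'.1 == x'.2)%:R * (y'.1 == y'.2)%:R)^*) a b
  = (d%:R ^+ 2 + ((-1) ^+ a + (-1) ^+ b) * d%:R + (-1) ^+ a * (-1) ^+ b * d%:R ^+ 2) / 4.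
Proof.
set K := fun x : 'I_d * 'I_d => _.
have tP m n m' n' : trP a K m n m' n'
    = ((m == m')%:R * (n == n')%:R + (-1) ^+ a * ((m == n')%:R * (n == m')%:R)) / 2.
  rewrite /trP; congr ((_ + _ * _) / _).
    transitivity (\sum_i \sum_j (m == i)%:R * ((n == j)%:R *
       ((i == m')%:R * (j == n')%:R)) : C).
      apply: eq_bigr => i _; apply: eq_bigr => j _.
      by rewrite /K /= !rmorphM /= !rmorph_nat (eq_sym i m) (eq_sym j n) -mulrA.
    by under eq_bigr do rewrite -mulr_sumr sum_delta; rewrite sum_delta.
  transitivity (\sum_i \sum_j (m == i)%:R * ((n == j)%:R *
     ((i == n')%:R * (j == m')%:R)) : C).
    apply: eq_bigr => i _; apply: eq_bigr => j _.
    rewrite /K /= !rmorphM /= !rmorph_nat (eq_sym i m) (eq_sym j n) -mulrA.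
    by congr (_ * (_ * _)); exact: mulrC.
  by under eq_bigr do rewrite -mulr_sumr sum_delta; rewrite sum_delta.
have sd : \sum_(m < d) \sum_(n < d) ((m == n)%:R * (n == m)%:R : C) = d%:R.
  rewrite -[d in RHS]card_ord -sumr_const; apply: eq_bigr => m _.
  by rewrite (sum_delta (fun n => (n == m)%:R)) eqxx.
have s1 : \sum_(m < d) \sum_(n < d) (1 : C) = d%:R ^+ 2.
  by under eq_bigr do rewrite sumr_const card_ord;
    rewrite sumr_const card_ord -mulrnA -natrX.
rewrite (pair_weight_eq b tP).
have lin (g : 'I_d -> 'I_d -> C) (c c' : C) : \sum_m \sum_n (c * 1 + c' * g m n) / 2
    = (c * d%:R ^+ 2 + c' * \sum_m \sum_n g m n) / 2.
  rewrite -s1 !mulr_sumr -big_split mulr_suml; apply: eq_bigr => m _ /=.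
  by rewrite !mulr_sumr -big_split mulr_suml; apply: eq_bigr.
transitivity ((\sum_(m < d) \sum_(n < d)
    (1 * 1 + (-1) ^+ a * ((m == n)%:R * (n == m)%:R)) / 2
  + (-1) ^+ b * \sum_(m < d) \sum_(n < d)
    ((-1) ^+ a * 1 + 1 * ((m == n)%:R * (n == m)%:R)) / 2) / 2 : C).
  congr ((_ + _ * _) / _); apply: eq_bigr => m _; apply: eq_bigr => n _.
    by rewrite !eqxx !mulr1.
  by rewrite !eqxx !mulr1 mul1r addrC.
rewrite (lin (fun m n => (m == n)%:R * (n == m)%:R)).
rewrite (lin (fun m n => (m == n)%:R * (n == m)%:R)) sd.
by field.
Qed.

(** The channel with Choi state [choi a]; the factor d undoes the normalisation of that state. *)
Definition choi_channel (a : bool) (X : 'M[C]_d) : 'M[C]_d :=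
  \matrix_(p, q) (d%:R * \sum_s \sum_t X s t * choi a s p t q).

Lemma choi_channelE a (X : 'M[C]_d) :
  choi_channel a X = (d%:R + (-1) ^+ a)^-1 *: ((\tr X)%:M + (-1) ^+ a *: X^T).
Proof.
have d0 : (d%:R : C) != 0 by rewrite pnatr_eq0 -lt0n ltnW.
apply/matrixP => p q; rewrite mxE.
have -> : \sum_s \sum_t X s t * choi a s p t q
   = \sum_s \sum_t ((s == t)%:R * ((p == q)%:R * X s t)
     + (p == t)%:R * ((q == s)%:R * ((-1) ^+ a * X s t))) / (d%:R * (d%:R + (-1) ^+ a)).
  apply: eq_bigr => s _; apply: eq_bigr => t _; rewrite /choi -!mulnb !natrM (eq_sym q).
  by rewrite !mulrA; congr (_ / _); ring.
transitivity (d%:R * ((\tr X) * (p == q)%:R + (-1) ^+ a * X q p)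
   / (d%:R * (d%:R + (-1) ^+ a))); last first.
  rewrite !mxE invfM [d%:R * _]mulrC -!mulrA (mulrA d%:R) mulfV // mul1r mulrC.
  by rewrite mulr_natr.
rewrite -[RHS]mulrA; congr (_ * _).
transitivity (\sum_s ((p == q)%:R * X s s + (q == s)%:R * ((-1) ^+ a * X s p))
    / (d%:R * (d%:R + (-1) ^+ a))).
  apply: eq_bigr => s _; rewrite -mulr_suml; congr (_ / _); rewrite big_split /=.
  rewrite (sum_delta (fun t => (p == q)%:R * X s t)).
  by rewrite (sum_delta (fun t => (q == s)%:R * ((-1) ^+ a * X s t))).
rewrite -mulr_suml; congr (_ / _); rewrite big_split /= -mulr_sumr mulrC.
by rewrite (sum_delta (fun s => (-1) ^+ a * X s p)).
Qed.

Lemma choi_channel_tr a (X : 'M[C]_d) : \tr (choi_channel a X) = \tr X.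
Proof.
have dn : (d%:R + (-1) ^+ a : C) != 0.
  case: a => /=; rewrite ?expr0 ?expr1 ?natr1 ?pnatr_eq0 //.
  by rewrite subr_eq0 pnatr_eq1; case: (d) lt1d => [|[]].
rewrite choi_channelE linearZ /= linearD /= linearZ /= mxtrace_tr mxtrace_scalar.
by rewrite -[\tr X *+ d]mulr_natl -mulrDl mulKf.
Qed.
End PairTwirl.

(** * Index bijections, tensor products and the pair projections *)

Lemma sum_mxtens (V : nmodType) a b (F : 'I_(a * b) -> V) :
  \sum_z F z = \sum_x \sum_y F (mxtens_index (x, y)).
Proof.
rewrite pair_big /= (reindex (@mxtens_index a b)); last first.
  by exists (@mxtens_unindex a b) => z _; rewrite ?mxtens_indexK ?mxtens_unindexK.
by apply: eq_bigr => -[x y].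
Qed.

Lemma mxtens_index_eq a b (x x' : 'I_a) (y y' : 'I_b) :
  (mxtens_index (x, y) == mxtens_index (x', y')) = (x == x') && (y == y').
Proof. by rewrite (can_eq (@mxtens_indexK a b)) xpair_eqE. Qed.

Lemma mid_swap_indexE a1 b1 a2 b2 (i1 : 'I_a1) (i2 : 'I_a2) (j1 : 'I_b1) (j2 : 'I_b2) :
  mid_swap_index (mxtens_index (mxtens_index (i1, i2), mxtens_index (j1, j2)))
  = mxtens_index (mxtens_index (i1, j1), mxtens_index (i2, j2)).
Proof. by rewrite /mid_swap_index !mxtens_indexK. Qed.

Lemma mid_swap_index_bij a1 b1 a2 b2 : bijective (@mid_swap_index a1 b1 a2 b2).
Proof.
exists (@mid_swap_index a1 a2 b1 b2) => z; case: (mxtens_indexP z) => x y;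
  case: (mxtens_indexP x) => i1 i2; case: (mxtens_indexP y) => j1 j2;
  by rewrite !mid_swap_indexE.
Qed.

Section Permuted.
Variable C : numClosedFieldType.

Lemma mxsub_bij_mul m n (f : 'I_m -> 'I_n) (X Y : 'M[C]_n) : bijective f ->
  mxsub f f X *m mxsub f f Y = mxsub f f (X *m Y).
Proof.
move=> bf; apply/matrixP => i j; rewrite [LHS]mxE [RHS]mxE [RHS]mxE.
rewrite [RHS](reindex f); last exact: onW_bij.
by apply: eq_bigr => k _; rewrite !mxE.
Qed.

Lemma mxsub_herm m n (f : 'I_m -> 'I_n) (X : 'M[C]_n) :
  (mxsub f f X) ^t* = mxsub f f (X ^t*).
Proof. by apply/matrixP => i j; rewrite !mxE. Qed.

Lemma mxsub_tr m n (f : 'I_m -> 'I_n) (X : 'M[C]_n) : bijective f ->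
  \tr (mxsub f f X) = \tr X.
Proof.
move=> bf; rewrite /mxtrace [RHS](reindex f); last exact: onW_bij.
by apply: eq_bigr => k _; rewrite !mxE.
Qed.

Lemma mxsub_1 m n (f : 'I_m -> 'I_n) : bijective f -> mxsub f f (1%:M : 'M[C]_n) = 1%:M.
Proof.
by move=> bf; apply/matrixP => i j; rewrite !mxE (inj_eq (bij_inj bf)).
Qed.

Lemma tensmx_herm m n p q (A : 'M[C]_(m, n)) (B : 'M[C]_(p, q)) :
  (A *t B) ^t* = A ^t* *t B ^t*.
Proof. by apply/matrixP => i j; rewrite !mxE rmorphM. Qed.

Lemma tensmx_tr m n (A : 'M[C]_m) (B : 'M[C]_n) : \tr (A *t B) = \tr A * \tr B.
Proof.
rewrite /mxtrace sum_mxtens mulr_suml; apply: eq_bigr => i _; rewrite mulr_sumr.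
by apply: eq_bigr => j _; rewrite tensmxE.
Qed.

Lemma tensmx_1 m n : (1%:M : 'M[C]_m) *t (1%:M : 'M[C]_n) = 1%:M.
Proof.
apply/matrixP => z z'; case: (mxtens_indexP z) => i j; case: (mxtens_indexP z') => k l.
by rewrite tensmxE !mxE mxtens_index_eq -natrM mulnb.
Qed.

Lemma tensmxDl m n p q (A A' : 'M[C]_(m, n)) (B : 'M[C]_(p, q)) :
  (A + A') *t B = A *t B + A' *t B.
Proof. by apply/matrixP => i j; rewrite !mxE mulrDl. Qed.

Lemma tensmx_suml m n p q (I : finType) (A : I -> 'M[C]_(m, n)) (B : 'M[C]_(p, q)) :
  (\sum_i A i) *t B = \sum_i A i *t B.
Proof.
by apply: (big_morph (fun X => X *t B)) => [X Y|]; rewrite ?tensmxDl ?tens0mx.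
Qed.

Lemma tensmx_sumr m n p q (I : finType) (A : 'M[C]_(m, n)) (B : I -> 'M[C]_(p, q)) :
  A *t (\sum_i B i) = \sum_i A *t B i.
Proof.
apply: (big_morph (fun X => A *t X)) => [X Y|]; last by rewrite tensmx0.
by apply/matrixP => i j; rewrite !mxE mulrDr.
Qed.

Lemma tensmxZ m n p q (x y : C) (A : 'M[C]_(m, n)) (B : 'M[C]_(p, q)) :
  (x *: A) *t (y *: B) = (x * y) *: (A *t B).
Proof. by apply/matrixP => i j; rewrite !mxE; ring. Qed.

Variable d : nat.

Definition swapmx : 'M[C]_(d * d) :=
  \matrix_(x, y) (let: (i, j) := mxtens_unindex x in
                  let: (i', j') := mxtens_unindex y in
                  ((i == j') && (j == i'))%:R).

Lemma swapmxE i j i' j' :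
  swapmx (mxtens_index (i, j)) (mxtens_index (i', j')) = ((i == j') && (j == i'))%:R.
Proof. by rewrite mxE !mxtens_indexK. Qed.

Lemma swapmx_mul : swapmx *m swapmx = 1%:M.
Proof.
apply/matrixP => z z'; case: (mxtens_indexP z) => i j; case: (mxtens_indexP z') => k l.
rewrite [LHS]mxE [RHS]mxE sum_mxtens (bigD1 j) //= (bigD1 i) //= big1 => [|p npi]; last first.
  by rewrite swapmxE eq_sym (negPf npi) mul0r.
rewrite big1 => [|p npj]; last first.
  by apply: big1 => q _; rewrite swapmxE andbC eq_sym (negPf npj) mul0r.
by rewrite !swapmxE !eqxx mul1r !addr0 mxtens_index_eq andbC.
Qed.

Lemma swapmx_herm : swapmx ^t* = swapmx.
Proof.
apply/matrixP => z z'; case: (mxtens_indexP z) => i j; case: (mxtens_indexP z') => k l.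
by rewrite !mxE !mxtens_indexK rmorph_nat /= andbC !(eq_sym k) !(eq_sym l).
Qed.

Lemma swapmx_tr : \tr swapmx = d%:R.
Proof.
rewrite /mxtrace sum_mxtens -[d in RHS]card_ord -sumr_const; apply: eq_bigr => i _.
rewrite (bigD1 i) //= swapmxE eqxx big1 ?addr0 // => j nji.
by rewrite swapmxE (negPf nji) andbF.
Qed.

Definition projmx (a : bool) : 'M[C]_(d * d) := 2^-1 *: (1%:M + (-1) ^+ a *: swapmx).

Lemma projmxE a i j i' j' : projmx a (mxtens_index (i, j)) (mxtens_index (i', j'))
  = (((i == i') && (j == j'))%:R + (-1) ^+ a * ((i == j') && (j == i'))%:R) / 2.
Proof.
rewrite [LHS]mxE mulrC; congr (_ / _); rewrite [LHS]mxE [X in X + _]mxE [X in _ + X]mxE.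
by rewrite swapmxE mxtens_index_eq.
Qed.

Lemma projmx_mul a b : projmx a *m projmx b = (a == b)%:R *: projmx a.
Proof.
rewrite /projmx -scalemxAl -scalemxAr !mulmxDl !mulmxDr -!scalemxAl -!scalemxAr.
rewrite swapmx_mul !mul1mx mulmx1; apply/matrixP => i j.
set F := swapmx; set Id := (1%:M : 'M[C]_(d * d)).
rewrite !(mxE _ _ i j); move: (F i j) (Id i j) => f e.
by case: a b => [] [] /=; field.
Qed.

Lemma projmx_sum : \sum_a projmx a = 1%:M.
Proof.
apply/matrixP => i j; rewrite big_bool /projmx.
set F := swapmx; set Id := (1%:M : 'M[C]_(d * d)).
by rewrite !(mxE _ _ i j); move: (F i j) (Id i j) => f e /=; field.
Qed.

Lemma projmx_herm a : (projmx a) ^t* = projmx a.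
Proof.
rewrite /projmx linearZ /= map_mxZ /= linearD /= map_mxD linearZ /= map_mxZ /=.
rewrite swapmx_herm trmx1 map_mx1 rmorph_sign; congr (_ *: _).
by rewrite fmorphV rmorph_nat.
Qed.

Lemma projmx_tr a : \tr (projmx a) = d%:R * (d%:R + (-1) ^+ a) / 2.
Proof.
by rewrite /projmx linearZ /= linearD /= linearZ /= mxtrace1 swapmx_tr natrM; field.
Qed.

Definition pairmx (s : bool * bool) : 'M[C]_((d * d) * (d * d)) :=
  mxsub (@mid_swap_index d d d d) (@mid_swap_index d d d d) (projmx s.1 *t projmx s.2).

Lemma pairmx_mul s s' : pairmx s *m pairmx s' = (s == s')%:R *: pairmx s.
Proof.
rewrite /pairmx mxsub_bij_mul; last exact: mid_swap_index_bij.
rewrite tensmx_mul !projmx_mul tensmxZ -natrM mulnb -xpair_eqE -!surjective_pairing.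
by apply/matrixP => i j; rewrite !mxE.
Qed.

Lemma pairmx_sum : \sum_s pairmx s = 1%:M.
Proof.
rewrite -[RHS](mxsub_1 (mid_swap_index_bij d d d d)) -tensmx_1 -projmx_sum.
rewrite tensmx_suml; under [in RHS]eq_bigr do rewrite tensmx_sumr.
rewrite pair_big /= linear_sum /=; apply: eq_bigr => s _ //.
Qed.

Lemma pairmx_herm s : (pairmx s) ^t* = pairmx s.
Proof. by rewrite /pairmx mxsub_herm tensmx_herm !projmx_herm. Qed.

Lemma pairmx_tr s : \tr (pairmx s)
  = (d%:R * (d%:R + (-1) ^+ s.1) / 2) * (d%:R * (d%:R + (-1) ^+ s.2) / 2).
Proof.
by rewrite /pairmx mxsub_tr ?tensmx_tr ?projmx_tr //; exact: mid_swap_index_bij.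
Qed.

Lemma pairmxE s (i m j n i' m' j' n' : 'I_d) :
  pairmx s (mxtens_index (mxtens_index (i, m), mxtens_index (j, n)))
           (mxtens_index (mxtens_index (i', m'), mxtens_index (j', n')))
  = projmx s.1 (mxtens_index (i, j)) (mxtens_index (i', j'))
    * projmx s.2 (mxtens_index (m, n)) (mxtens_index (m', n')).
Proof. by rewrite mxE !mid_swap_indexE tensmxE. Qed.

Definition pair_kernel (X : 'M[C]_((d * d) * (d * d))) (x y x' y' : 'I_d * 'I_d) : C :=
  X (mxtens_index (mxtens_index x, mxtens_index y))
    (mxtens_index (mxtens_index x', mxtens_index y')).

Lemma sum_projmx a i j (g : 'I_d -> 'I_d -> C) :
  \sum_i' \sum_j' projmx a (mxtens_index (i, j)) (mxtens_index (i', j')) * g i' j'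
  = (g i j + (-1) ^+ a * g j i) / 2.
Proof.
transitivity (\sum_i' \sum_j' ((i == i')%:R * ((j == j')%:R * (g i' j' / 2))
    + (j == i')%:R * ((i == j')%:R * ((-1) ^+ a * g i' j' / 2)))).
  apply: eq_bigr => i' _; apply: eq_bigr => j' _; rewrite projmxE -!mulnb !natrM.
  by ring.
transitivity (\sum_i' ((i == i')%:R * (g i' j / 2)
    + (j == i')%:R * ((-1) ^+ a * g i' i / 2))).
  apply: eq_bigr => i' _; rewrite big_split /= -!mulr_sumr.
  by rewrite (sum_delta (fun j' => g i' j' / 2))
     (sum_delta (fun j' => (-1) ^+ a * g i' j' / 2)).
rewrite big_split /= (sum_delta (fun i' => g i' j / 2)).
by rewrite (sum_delta (fun i' => (-1) ^+ a * g i' i / 2)) mulrDl.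
Qed.

(** Identifies the weights left by the twirl with the outcome probabilities of the pair projections,
    which are what the entropy bound is about. *)
Lemma tr_pairmx (X : 'M[C]_((d * d) * (d * d))) s :
  \tr (pairmx s *m X) = pair_weight (pair_kernel X) s.1 s.2.
Proof.
pose K := pair_kernel X.
transitivity (\sum_i \sum_m \sum_j \sum_n
  (K (i, m) (j, n) (i, m) (j, n) + (-1) ^+ s.1 * K (j, m) (i, n) (i, m) (j, n)
   + (-1) ^+ s.2 * (K (i, n) (j, m) (i, m) (j, n)
                    + (-1) ^+ s.1 * K (j, n) (i, m) (i, m) (j, n))) / 4).
  rewrite /mxtrace sum_mxtens sum_mxtens; apply: eq_bigr => i _; apply: eq_bigr => m _.
  rewrite sum_mxtens; apply: eq_bigr => j _; apply: eq_bigr => n _.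
  rewrite mxE sum_mxtens sum_mxtens.
  transitivity (\sum_i' \sum_j'
      projmx s.1 (mxtens_index (i, j)) (mxtens_index (i', j')) *
    \sum_m' \sum_n' projmx s.2 (mxtens_index (m, n)) (mxtens_index (m', n'))
      * K (i', m') (j', n') (i, m) (j, n)).
    apply: eq_bigr => i' _.
    transitivity (\sum_m' \sum_j' \sum_n'
        projmx s.1 (mxtens_index (i, j)) (mxtens_index (i', j')) *
        (projmx s.2 (mxtens_index (m, n)) (mxtens_index (m', n'))
          * K (i', m') (j', n') (i, m) (j, n))).
      apply: eq_bigr => m' _; rewrite sum_mxtens; apply: eq_bigr => j' _.
      by apply: eq_bigr => n' _; rewrite pairmxE mulrA.
    rewrite exchange_big; apply: eq_bigr => j' _; rewrite mulr_sumr.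
    by apply: eq_bigr => m' _; rewrite mulr_sumr.
  rewrite (sum_projmx s.1 i j (fun i' j' => \sum_m' \sum_n' _)).
  rewrite (sum_projmx s.2 m n (fun m' n' => K (i, m') (j, n') (i, m) (j, n))).
  rewrite (sum_projmx s.2 m n (fun m' n' => K (j, m') (i, n') (i, m) (j, n))).
  by field.
rewrite -/K /pair_weight /trP /trI /trF.
transitivity (\sum_m \sum_n \sum_i \sum_j
  (K (i, m) (j, n) (i, m) (j, n) + (-1) ^+ s.1 * K (j, m) (i, n) (i, m) (j, n)
   + (-1) ^+ s.2 * (K (i, n) (j, m) (i, m) (j, n)
                    + (-1) ^+ s.1 * K (j, n) (i, m) (i, m) (j, n))) / 4).
  rewrite exchange_big; apply: eq_bigr => m _ /=.
  by under eq_bigr do rewrite exchange_big; rewrite exchange_big.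
transitivity (\sum_m \sum_n (\sum_i \sum_j K (i, m) (j, n) (i, m) (j, n)
   + (-1) ^+ s.1 * \sum_i \sum_j K (i, m) (j, n) (j, m) (i, n)
   + (-1) ^+ s.2 * (\sum_i \sum_j K (i, n) (j, m) (i, m) (j, n)
   + (-1) ^+ s.1 * \sum_i \sum_j K (i, n) (j, m) (j, m) (i, n))) / 4).
  apply: eq_bigr => m _; apply: eq_bigr => n _.
  rewrite [X in _ + _ * X + _]exchange_big [X in _ * (_ + _ * X)]exchange_big /=.
  rewrite !mulr_sumr -!big_split /= mulr_sumr -big_split mulr_suml.
  apply: eq_bigr => i _; rewrite !mulr_sumr -!big_split /= mulr_sumr -big_split mulr_suml.
  by apply: eq_bigr.
rewrite [X in (_ + _ * X) / _]exchange_big mulr_sumr -big_split mulr_suml.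
apply: eq_bigr => m _; rewrite mulr_sumr -big_split mulr_suml.
by apply: eq_bigr => n _ /=; field.
Qed.

End Permuted.

(** * Local operations in the presence of memories *)

Section Blocks.
Variable C : numClosedFieldType.

(* The kernel of an operator on (I x A) (x) (J x B) given by its blocks on A (x) B:
   I and J are memories that Alice and Bob leave untouched. *)
Definition block_kernel (I J : Type) a b (X : I -> J -> I -> J -> 'M[C]_(a * b))
  (x : I * 'I_a) (y : J * 'I_b) (x' : I * 'I_a) (y' : J * 'I_b) : C :=
  X x.1 y.1 x'.1 y'.1 (mxtens_index (x.2, y.2)) (mxtens_index (x'.2, y'.2)).

Definition mx_kernel a b (X : 'M[C]_(a * b)) (x : 'I_a) (y : 'I_b) (x' : 'I_a) (y' : 'I_b) :=
  X (mxtens_index (x, y)) (mxtens_index (x', y')).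

Definition psdk n (X : 'M[C]_n) := sepk (fun z (_ : unit) z' (_ : unit) => X z z').

Lemma adjE m n (M : 'M[C]_(m, n)) i j : (M ^t*) i j = (M j i)^*.
Proof. by rewrite !mxE. Qed.

Lemma scalar1E n (i j : 'I_n) : (1%:M : 'M[C]_n) i j = (i == j)%:R.
Proof. by rewrite mxE. Qed.

Lemma kraus_leftE a b c (K : 'M[C]_(c, a)) (X : 'M[C]_(a * b)) x y x' y' :
  ((K *t 1%:M) *m X *m (K *t 1%:M) ^t*) (mxtens_index (x, y)) (mxtens_index (x', y'))
  = \sum_s \sum_t K x s * (K x' t)^* * X (mxtens_index (s, y)) (mxtens_index (t, y')).
Proof.
have e z : ((K *t 1%:M) *m X) (mxtens_index (x, y)) z
    = \sum_s K x s * X (mxtens_index (s, y)) z.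
  rewrite mxE sum_mxtens; apply: eq_bigr => s _.
  rewrite (bigD1 y) //= big1 ?addr0 => [|q nq]; first by rewrite tensmxE scalar1E eqxx mulr1.
  by rewrite tensmxE scalar1E eq_sym (negPf nq) mulr0 mul0r.
rewrite mxE sum_mxtens exchange_big (bigD1 y') //= [X in _ + X]big1 => [|q nq]; last first.
  apply: big1 => t _; rewrite adjE tensmxE scalar1E eq_sym (negPf nq).
  by rewrite mulr0 rmorph0 mulr0.
rewrite addr0 [RHS]exchange_big; apply: eq_bigr => t _.
rewrite e adjE tensmxE scalar1E eqxx mulr1 mulr_suml; apply: eq_bigr => s _.
by rewrite mulrAC.
Qed.

Lemma kraus_rightE a b c (K : 'M[C]_(c, b)) (X : 'M[C]_(a * b)) x y x' y' :
  ((1%:M *t K) *m X *m (1%:M *t K) ^t*) (mxtens_index (x, y)) (mxtens_index (x', y'))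
  = \sum_s \sum_t K y s * (K y' t)^* * X (mxtens_index (x, s)) (mxtens_index (x', t)).
Proof.
have e z : ((1%:M *t K) *m X) (mxtens_index (x, y)) z
    = \sum_s K y s * X (mxtens_index (x, s)) z.
  rewrite mxE sum_mxtens (bigD1 x) //= [X in _ + X]big1 => [|q nq]; last first.
    by apply: big1 => s _; rewrite tensmxE scalar1E eq_sym (negPf nq) !mul0r.
  by rewrite addr0; apply: eq_bigr => s _; rewrite tensmxE scalar1E eqxx mul1r.
rewrite mxE sum_mxtens (bigD1 x') //= [X in _ + X]big1 => [|q nq]; last first.
  apply: big1 => t _; rewrite adjE tensmxE scalar1E eq_sym (negPf nq).
  by rewrite mul0r rmorph0 mulr0.
rewrite addr0 [RHS]exchange_big; apply: eq_bigr => t _.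
rewrite e adjE tensmxE scalar1E eqxx mul1r mulr_suml; apply: eq_bigr => s _.
by rewrite mulrAC.
Qed.

Lemma psdk_conj m n (M : 'M[C]_(m, n)) (X : 'M[C]_n) :
  psdk X -> psdk (M *m X *m M ^t*).
Proof.
move=> pX; apply: sepk_ext (sepk_mapA (fun _ s => s) M pX) _ => z _ z' _.
rewrite exchange_big mxE; apply: eq_bigr => t _; rewrite [X in X * _]mxE mulr_suml.
by apply: eq_bigr => s _; rewrite !mxE mulrAC.
Qed.

Lemma psdk_sum n (I : Type) (s : seq I) (X : I -> 'M[C]_n) :
  (forall i, psdk (X i)) -> psdk (\sum_(i <- s) X i).
Proof.
move=> pX; apply: sepk_ext (sepk_sum s (fun i (_ : xpredT i) => pX i)) _ => z _ z' _.
by rewrite summxE.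
Qed.

Lemma tr_kraus n r (c : 'I_r -> nat) (K : forall x, 'M[C]_(c x, n)) (X : 'M[C]_n) :
  \sum_x (K x) ^t* *m K x = 1%:M ->
  \sum_x \tr (K x *m X *m (K x) ^t*) = \tr X.
Proof.
move=> K1; rewrite -[X in RHS]mul1mx -K1 mulmx_suml linear_sum; apply: eq_bigr => x _.
by rewrite [LHS]mxtrace_mulC mulmxA.
Qed.

Lemma kraus_left_complete a b r (c : 'I_r -> nat) (K : forall x, 'M[C]_(c x, a)) :
  \sum_x (K x) ^t* *m K x = 1%:M ->
  \sum_x (K x *t (1%:M : 'M[C]_b)) ^t* *m (K x *t (1%:M : 'M[C]_b)) = 1%:M.
Proof.
move=> K1; rewrite -tensmx_1 -K1 tensmx_suml; apply: eq_bigr => x _.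
by rewrite tensmx_herm tensmx_mul trmx1 map_mx1 mulmx1.
Qed.

Lemma kraus_right_complete a b r (c : 'I_r -> nat) (K : forall x, 'M[C]_(c x, b)) :
  \sum_x (K x) ^t* *m K x = 1%:M ->
  \sum_x ((1%:M : 'M[C]_a) *t K x) ^t* *m ((1%:M : 'M[C]_a) *t K x) = 1%:M.
Proof.
move=> K1; rewrite -tensmx_1 -K1 tensmx_sumr; apply: eq_bigr => x _.
by rewrite tensmx_herm tensmx_mul trmx1 map_mx1 mulmx1.
Qed.

End Blocks.

Section ChoiPsd.
Variable C : numClosedFieldType.

(** A positive multiple of a projection, which is the sum of the rank-one operators given by its own
    columns. *)
Lemma sepk_choi d (a : bool) : (1 < d)%N ->
  sepk (fun (x : 'I_d * 'I_d) (_ : unit) (x' : 'I_d * 'I_d) (_ : unit) =>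
    choi C a x.1 x.2 x'.1 x'.2).
Proof.
move=> d1; have d0 : (d%:R : C) != 0 by rewrite pnatr_eq0 -lt0n ltnW.
have dn : (d%:R + (-1) ^+ a : C) != 0.
  case: a => /=; rewrite ?expr0 ?expr1 ?natr1 ?pnatr_eq0 //.
  by rewrite subr_eq0 pnatr_eq1; case: (d) d1 => [|[]].
have c0 : 0 <= (2 / (d%:R * (d%:R + (-1) ^+ a)) : C).
  rewrite divr_ge0 ?ler0n // mulr_ge0 ?ler0n //.
  case: a {dn} => /=; last by rewrite expr0 addr_ge0 ?ler0n.
  by rewrite expr1 subr_ge0 (ler_nat _ 1) ltnW.
apply: sepk_ext (sepkZ c0 (sepk_sum (index_enum 'I_(d * d)) (fun k _ =>
  sepk_prod (fun x : 'I_d * 'I_d => projmx C d a (mxtens_index x) k)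
    (fun _ : unit => 1)))) _ => -[s p] _ [t q] _ /=.
have := congr1 (fun M : 'M[C]_(d * d) => M (mxtens_index (s, p)) (mxtens_index (t, q)))
  (projmx_mul C d a a).
rewrite eqxx scale1r -{2}(projmx_herm C d a) mxE projmxE => e.
have -> : choi C a s p t q
    = 2 / (d%:R * (d%:R + (-1) ^+ a)) * ((((s == t) && (p == q))%:R
      + (-1) ^+ a * ((s == q) && (p == t))%:R) / 2).
  by rewrite /choi; field; rewrite d0 dn.
by rewrite -e; congr (_ * _); apply: eq_bigr => k _; rewrite adjE !mulr1.
Qed.

Lemma sum2_mxE m n (I J : Type) (r : seq I) (r' : seq J) (c : I -> J -> C)
    (M : I -> J -> 'M[C]_(m, n)) z z' :
  (\sum_(i <- r) \sum_(j <- r') c i j *: M i j) z z'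
  = \sum_(i <- r) \sum_(j <- r') c i j * M i j z z'.
Proof.
rewrite summxE; apply: eq_bigr => i _; rewrite summxE; apply: eq_bigr => j _.
by rewrite mxE.
Qed.

Lemma sum2_scale_exchange (S : finType) (I J : Type) (r : seq I) (r' : seq J)
    (D : C) (c : I -> J -> C) (X : I -> J -> S -> S -> C) :
  \sum_(i <- r) \sum_(j <- r') c i j * (D * \sum_s \sum_t X i j s t)
  = D * \sum_s \sum_t \sum_(i <- r) \sum_(j <- r') c i j * X i j s t.
Proof.
transitivity (\sum_(i <- r) \sum_s \sum_t \sum_(j <- r') D * (c i j * X i j s t)).
  apply: eq_bigr => i _.
  transitivity (\sum_(j <- r') \sum_s \sum_t D * (c i j * X i j s t)).
    apply: eq_bigr => j _; rewrite mulrCA mulr_sumr mulr_sumr; apply: eq_bigr => s _.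
    by rewrite mulr_sumr mulr_sumr.
  by rewrite exchange_big; apply: eq_bigr => s _; rewrite exchange_big.
rewrite exchange_big mulr_sumr; apply: eq_bigr => s _ /=.
rewrite exchange_big mulr_sumr; apply: eq_bigr => t _ /=.
by rewrite mulr_sumr; apply: eq_bigr => i _; rewrite mulr_sumr.
Qed.
End ChoiPsd.

(** * Private states *)

Section Projections.
Variable C : numClosedFieldType.

Lemma psdk_tr_ge0 n (X : 'M[C]_n) : psdk X -> 0 <= \tr X.
Proof.
move=> [r [v [w e]]]; apply: sumr_ge0 => z _; rewrite (e z tt z tt).
by apply: sumr_ge0 => i _; rewrite mul_conjC_ge0.
Qed.

Lemma psdk_tr_proj n (P X : 'M[C]_n) : P ^t* = P -> P *m P = P -> psdk X ->
  0 <= \tr (P *m X).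
Proof.
move=> hP PP pX; have := psdk_tr_ge0 (psdk_conj P pX).
by rewrite mxtrace_mulC mulmxA hP PP.
Qed.

Lemma cauchy_schwarz n (u v : 'rV[C]_n) :
  `|(u *m v ^t*) 0 0| ^+ 2 <= (u *m u ^t*) 0 0 * (v *m v ^t*) 0 0.
Proof. by have [h _] := CauchySchwarz (@dotmx C n) u v; rewrite -!dotmxE. Qed.

Lemma cauchy_schwarz_sum n (a b : 'I_n -> C) :
  (\sum_i a i * b i) * (\sum_i a i * b i)^*
  <= (\sum_i a i * (a i)^*) * (\sum_i b i * (b i)^*).
Proof.
have := cauchy_schwarz (\row_i a i) (\row_i (b i)^*).
rewrite normCK !mxE.
under eq_bigr do rewrite !mxE conjCK.
under [X in _ <= X * _]eq_bigr do rewrite !mxE.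
by under [X in _ <= _ * X]eq_bigr do rewrite !mxE conjCK mulrC.
Qed.

(** The complementary projection has non-negative diagonal entries in the same basis. *)
Lemma proj_diag_le1 n (U P : 'M[C]_n) k : U \is unitarymx -> P ^t* = P -> P *m P = P ->
  (U *m P *m (U *m P) ^t*) k k <= 1.
Proof.
move=> uU hP PP; rewrite -subr_ge0.
have -> : 1 - (U *m P *m (U *m P) ^t*) k k
   = (U *m (1%:M - P) *m (U *m (1%:M - P)) ^t*) k k.
  have hQ : (1%:M - P) ^t* = 1%:M - P.
    by rewrite linearB /= map_mxB trmx1 map_mx1 hP.
  rewrite !mulmxtC hQ hP.
  have UU : U *m U ^t* = 1%:M by apply/unitarymxP.
  have QQ : (1%:M - P) *m (1%:M - P) = 1%:M - P.
    by rewrite mulmxBl mul1mx mulmxBr mulmx1 PP subrr subr0.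
  rewrite !mulmxA -(mulmxA U P P) PP -(mulmxA U (1%:M - P)) QQ.
  rewrite mulmxBr mulmx1 mulmxBl UU.
  by rewrite [in RHS]mxE [(1%:M : 'M[C]_n) k k]mxE eqxx [X in _ = _ + X]mxE.
exact: mulmxtC_diag_ge0.
Qed.

(** The trace is expanded in an eigenbasis of the adjoint of X times X. Cauchy-Schwarz bounds each
    term by a singular value of X, as P does not increase norms; [k i] is the square of that
    singular value. *)
Lemma tr_proj_spectral n (P X : 'M[C]_n) (k := fun i => spectral_diag (X ^t* *m X) 0 i)
    (u := spectralmx (X ^t* *m X)) : P ^t* = P -> P *m P = P ->
  \tr (P *m X) = \sum_i (row i (u *m P) *m (row i (u *m X ^t*)) ^t*) 0 0 /\
  forall i, `|(row i (u *m P) *m (row i (u *m X ^t*)) ^t*) 0 0| ^+ 2 <= k i.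
Proof.
move=> hP PP; have uU : u \is unitarymx by exact: spectral_unitarymx.
have rr (A B : 'M[C]_n) i : (row i A *m (row i B) ^t*) 0 0 = (A *m B ^t*) i i.
  by rewrite !mxE; apply: eq_bigr => j _; rewrite !mxE.
split=> [|i].
  rewrite -[X in P *m X]mulmx1 -(mulVmx (unitarymx_unit uU)) invmx_unitary //.
  rewrite mulmxA mulmxA mxtrace_mulC; apply: eq_bigr => i _.
  by rewrite rr mulmxtC trmxCK !mulmxA.
apply: le_trans (cauchy_schwarz _ _) _; rewrite !rr.
have h : (X ^t* *m X) ^t* = X ^t* *m X by rewrite mulmxtC trmxCK.
have -> : (u *m X ^t* *m (u *m X ^t*) ^t*) i i = k i.
  have UU : u *m u ^t* = 1%:M by apply/unitarymxP.
  rewrite mulmxtC trmxCK !mulmxA -(mulmxA u) spectral_row // -mulmxA UU mulmx1.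
  by rewrite mxE eqxx.
rewrite ler_piMl ?proj_diag_le1 //; apply: spectral_diag_ge0 => // v.
rewrite mulmxA -[X in 0 <= fun_of_matrix X _ _]mulmxA.
have -> : v ^t* *m X ^t* = (X *m v) ^t* by rewrite mulmxtC.
by rewrite -{2}[X *m v]trmxCK mulmxtC_diag_ge0.
Qed.

End Projections.

(** * The test for a private state *)

Section Twist.
Variable C : numClosedFieldType.

Definition twistmx k n (V : 'I_k -> 'I_k -> 'M[C]_n) : 'M[C]_((k * k) * n) :=
  \sum_(i < k) \sum_(j < k)
    delta_mx (mxtens_index (i, j)) (mxtens_index (i, j)) *t V i j.

Lemma twistmxE k n (V : 'I_k -> 'I_k -> 'M[C]_n) i j z i' j' z' :
  twistmx V (mxtens_index (mxtens_index (i, j), z))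
    (mxtens_index (mxtens_index (i', j'), z'))
  = ((i == i') && (j == j'))%:R * V i j z z'.
Proof.
rewrite /twistmx summxE (bigD1 i) //= [X in _ + X]big1 => [|p np]; last first.
  rewrite summxE big1 // => q _; rewrite tensmxE mxE !mxtens_index_eq eq_sym.
  by rewrite (negPf np) mul0r.
rewrite addr0 summxE (bigD1 j) //= [X in _ + X]big1 => [|q nq]; last first.
  by rewrite tensmxE mxE !mxtens_index_eq (eq_sym j) (negPf nq) !andbF mul0r.
rewrite addr0 tensmxE mxE !mxtens_index_eq !eqxx /= (eq_sym i') (eq_sym j') //.
Qed.

Lemma twistmx_unitary k n (V : 'I_k -> 'I_k -> 'M[C]_n) :
  (forall i j, V i j \is unitarymx) -> twistmx V *m (twistmx V) ^t* = 1%:M.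
Proof.
move=> uV; apply/matrixP => a b.
case: (mxtens_indexP a) => a1 z; case: (mxtens_indexP a1) => i j.
case: (mxtens_indexP b) => b1 z'; case: (mxtens_indexP b1) => i' j'.
rewrite mxE sum_mxtens sum_mxtens (bigD1 i) //= [X in _ + X]big1 => [|p np]; last first.
  apply: big1 => q _; apply: big1 => c _; rewrite twistmxE eq_sym (negPf np) mul0r //.
  by rewrite mul0r.
rewrite addr0 (bigD1 j) //= [X in _ + X]big1 => [|q nq]; last first.
  by apply: big1 => c _; rewrite twistmxE (eq_sym j) (negPf nq) andbF !mul0r.
rewrite addr0 scalar1E !mxtens_index_eq.
transitivity (((i == i') && (j == j'))%:R * (V i j *m (V i j) ^t*) z z').
  rewrite mxE mulr_sumr; apply: eq_bigr => c _; rewrite twistmxE !eqxx mul1r !adjE.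
  rewrite twistmxE rmorphM rmorph_nat /= (eq_sym i') (eq_sym j').
  by case: eqVneq => [<-|_]; case: eqVneq => [<-|_]; rewrite /= ?mul0r ?mulr0 ?mul1r.
by rewrite (unitarymxP (uV i j)) scalar1E -natrM mulnb.
Qed.

Variables (k s t : nat) (c0 : C) (phi : 'cV[C]_(k * k)).
Hypothesis c0_sq : c0 * c0^* = k%:R^-1.
Hypothesis k_gt0 : (0 < k)%N.
Hypothesis phiE : forall i j, phi (mxtens_index (i, j)) 0 = c0 * (i == j)%:R.
Variable V : 'I_k -> 'I_k -> 'M[C]_(s * t).
Hypothesis V_unitary : forall i j, V i j \is unitarymx.

Let U := twistmx V.

Lemma phi_norm : phi ^t* *m phi = 1%:M.
Proof.
apply/matrixP => i j; rewrite !ord1 mxE sum_mxtens scalar1E eqxx.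
transitivity (\sum_(i < k) (k%:R^-1 : C)).
  apply: eq_bigr => x _; rewrite (bigD1 x) //= [X in _ + X]big1 => [|y ny]; last first.
    by rewrite adjE phiE eq_sym (negPf ny) mulr0 rmorph0 mul0r.
  by rewrite addr0 adjE phiE eqxx mulr1 mulrC c0_sq.
by rewrite sumr_const card_ord -[LHS]mulr_natl mulfV // pnatr_eq0 -lt0n.
Qed.

(** The untwisted test is Phi (x) 1, with the full shield space in place of [tau]; hence a private
    state with this twisting passes with certainty whatever its shield. *)
Definition key_proj : 'M[C]_((k * s) * (k * t)) :=
  mxsub (@mid_swap_index k k s t) (@mid_swap_index k k s t)
    (U *m ((phi *m phi ^t*) *t 1%:M) *m U ^t*).

Lemma UtU : U ^t* *m U = 1%:M.
Proof. by apply: mulmx1C; exact: twistmx_unitary. Qed.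

Lemma key_proj_mul (tau : 'M[C]_(s * t)) :
  key_proj *m mxsub (@mid_swap_index k k s t) (@mid_swap_index k k s t)
    (U *m ((phi *m phi ^t*) *t tau) *m U ^t*)
  = mxsub (@mid_swap_index k k s t) (@mid_swap_index k k s t)
    (U *m ((phi *m phi ^t*) *t tau) *m U ^t*).
Proof.
rewrite /key_proj mxsub_bij_mul; last exact: mid_swap_index_bij.
congr mxsub; rewrite !mulmxA -(mulmxA (U *m _) (U ^t*) U) UtU mulmx1 -(mulmxA U).
rewrite tensmx_mul mul1mx !mulmxA -(mulmxA phi (phi ^t*) phi) phi_norm mulmx1 //.
Qed.

Lemma key_proj_idem : key_proj *m key_proj = key_proj.
Proof. exact: key_proj_mul. Qed.

Lemma key_proj_herm : key_proj ^t* = key_proj.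
Proof.
rewrite /key_proj mxsub_herm !mulmxtC trmxCK tensmx_herm mulmxtC trmxCK trmx1 map_mx1.
by rewrite mulmxA.
Qed.

Lemma key_proj_private (tau : 'M[C]_(s * t)) : \tr tau = 1 ->
  \tr (key_proj *m mxsub (@mid_swap_index k k s t) (@mid_swap_index k k s t)
    (U *m ((phi *m phi ^t*) *t tau) *m U ^t*)) = 1.
Proof.
move=> t1; rewrite key_proj_mul mxsub_tr; last exact: mid_swap_index_bij.
rewrite mxtrace_mulC mulmxA UtU mul1mx tensmx_tr t1 mulr1 mxtrace_mulC phi_norm.
by rewrite mxtrace1.
Qed.

(** Phi is supported on i = j, so only the diagonal blocks V i i enter. The factor H turns the
    weight of the test on a vector x into the squared norm of the adjoint of H applied to x. *)
Lemma key_proj_factor : exists H : 'M[C]_((k * s) * (k * t), s * t),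
  key_proj = H *m H ^t* /\ forall i a j b c,
    H (mxtens_index (mxtens_index (i, a), mxtens_index (j, b))) c
    = c0 * ((i == j)%:R * V i i (mxtens_index (a, b)) c).
Proof.
pose G : 'M[C]_((k * k) * (s * t), 1 * (s * t)) := U *m (phi *t 1%:M).
have GE p q z o c : G (mxtens_index (mxtens_index (p, q), z)) (mxtens_index (o, c))
    = c0 * ((p == q)%:R * V p p z c).
  rewrite mxE sum_mxtens sum_mxtens (bigD1 p) //= [X in _ + X]big1 => [|x nx]; last first.
    apply: big1 => y _; apply: big1 => w _; rewrite twistmxE eq_sym (negPf nx).
    by rewrite !mul0r.
  rewrite addr0 (bigD1 q) //= [X in _ + X]big1 => [|y ny]; last first.
    by apply: big1 => w _; rewrite twistmxE (eq_sym q) (negPf ny) andbF !mul0r.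
  rewrite addr0 (bigD1 c) //= big1 => [|w nw]; last first.
    by rewrite tensmxE scalar1E (negPf nw) !mulr0.
  rewrite twistmxE tensmxE scalar1E !eqxx ord1 phiE addr0.
  by case: eqVneq => [<-|_] /=; ring.
have GG : U *m ((phi *m phi ^t*) *t 1%:M) *m U ^t* = G *m G ^t*.
  rewrite /G mulmxtC tensmx_herm trmx1 map_mx1 !mulmxA; congr (_ *m _).
  by rewrite -[RHS]mulmxA tensmx_mul mulmx1.
exists (\matrix_(z, c) G (@mid_swap_index k k s t z) (mxtens_index (0, c))); split.
  apply/matrixP => z z'; rewrite /key_proj GG mxE mxE sum_mxtens big_ord1 mxE.
  by apply: eq_bigr => c _; rewrite !adjE !mxE.
by move=> i a j b c; rewrite mxE mid_swap_indexE GE.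
Qed.

Lemma unitary_col_norm n (W : 'M[C]_n) (xi : 'cV[C]_n) : W \is unitarymx ->
  \sum_c (W *m xi) c 0 * ((W *m xi) c 0)^* = \sum_z xi z 0 * (xi z 0)^*.
Proof.
move=> uW.
have e (x : 'cV[C]_n) : \sum_z x z 0 * (x z 0)^* = (x ^t* *m x) 0 0.
  by rewrite mxE; apply: eq_bigr => z _; rewrite adjE mulrC.
rewrite !e mulmxtC -mulmxA (mulmxA (W ^t*)).
by rewrite (mulmx1C (unitarymxP uW)) mul1mx.
Qed.

(** The zero vector gets u = 0, hence the bound 1 instead of equality. *)
Lemma normalized_vector n (v : 'I_n -> C) : exists m u,
  [/\ m * m^* = \sum_a v a * (v a)^*, forall a, v a = m * u a
    & \sum_a u a * (u a)^* <= 1].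
Proof.
pose N := \sum_a v a * (v a)^*.
have N0 : 0 <= N by rewrite sumr_ge0 // => a _; rewrite mul_conjC_ge0.
have [N00|Nn0] := eqVneq N 0.
  exists 0, (fun _ => 0); split; first by rewrite -/N N00 mul0r.
    move=> a; rewrite mulr0; move/eqP: N00; rewrite psumr_eq0 => [/allP h|b _].
      by have := h a (mem_index_enum _); rewrite mul_conjC_eq0 => /eqP.
    exact: mul_conjC_ge0.
  by rewrite big1 ?ler01 // => a _; rewrite mul0r.
have m0 : sqrtC N != 0 by rewrite sqrtC_eq0.
have mm : sqrtC N * (sqrtC N)^* = N.
  by rewrite -normCK ger0_norm ?sqrtC_ge0 // sqrtCK.
exists (sqrtC N), (fun a => (sqrtC N)^-1 * v a); split=> //.
  by move=> a; rewrite mulVKf.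
rewrite (eq_bigr (fun a => N^-1 * (v a * (v a)^*))) => [|a _]; last first.
  by rewrite rmorphM fmorphV mulrACA -invfM mm.
by rewrite -mulr_sumr mulVf.
Qed.

(** Up to the conjugate of [c0], the entry c of the adjoint of the factor H in [key_proj_factor]
    applied to v (x) w. *)
Definition shield_amplitude (v : 'I_(k * s) -> C) (w : 'I_(k * t) -> C) c : C :=
  \sum_i \sum_a \sum_b (V i i (mxtens_index (a, b)) c)^*
    * (v (mxtens_index (i, a)) * w (mxtens_index (i, b))).

(* Cauchy-Schwarz over the key index i, each block of Alice's vector having been
   normalised, followed by the unitarity of V i i. *)
Lemma shield_amplitude_le v w :
  \sum_c shield_amplitude v w c * (shield_amplitude v w c)^*
  <= (\sum_x v x * (v x)^*) * (\sum_y w y * (w y)^*).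
Proof.
have [m hm] := fin_all_exists (fun i => normalized_vector (fun a => v (mxtens_index (i, a)))).
have [u {}hm] := fin_all_exists hm.
pose xi i : 'cV[C]_(s * t) :=
  \col_z (u i (mxtens_unindex z).1 * w (mxtens_index (i, (mxtens_unindex z).2))).
pose y i := (V i i) ^t* *m xi i.
have ampE c : shield_amplitude v w c = \sum_i m i * y i c 0.
  apply: eq_bigr => i _; have [_ vE _] := hm i.
  rewrite /y mxE sum_mxtens mulr_sumr; apply: eq_bigr => a _; rewrite mulr_sumr.
  apply: eq_bigr => b _; rewrite adjE /xi mxE !mxtens_indexK /= vE; ring.
have nv : \sum_x v x * (v x)^* = \sum_i m i * (m i)^*.
  by rewrite sum_mxtens; apply: eq_bigr => i _; have [-> _ _] := hm i.
have cs c : shield_amplitude v w c * (shield_amplitude v w c)^*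
   <= (\sum_i m i * (m i)^*) * (\sum_i y i c 0 * (y i c 0)^*).
  by rewrite ampE cauchy_schwarz_sum.
apply: le_trans (ler_sum _ (fun c _ => cs c)) _; rewrite -mulr_sumr nv.
have M0 : 0 <= \sum_i m i * (m i)^* by rewrite sumr_ge0 // => i _; rewrite mul_conjC_ge0.
apply: ler_wpM2l => //; rewrite exchange_big [X in _ <= X]sum_mxtens.
apply: ler_sum => i _; have [_ _ u1] := hm i.
rewrite unitary_col_norm ?trmxC_unitary // sum_mxtens.
have -> : \sum_a \sum_b xi i (mxtens_index (a, b)) 0 * (xi i (mxtens_index (a, b)) 0)^*
   = (\sum_a u i a * (u i a)^*) * \sum_b w (mxtens_index (i, b)) * (w (mxtens_index (i, b)))^*.
  rewrite mulr_suml; apply: eq_bigr => a _; rewrite mulr_sumr; apply: eq_bigr => b _.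
  by rewrite /xi !mxE !mxtens_indexK rmorphM mulrACA.
apply: ler_piMl u1; rewrite sumr_ge0 // => b _; exact: mul_conjC_ge0.
Qed.

(** By linearity sigma may be taken to be a product vector. The factor 1/k is |c0|^2, and the
    remaining amplitudes have total weight at most the norm of that vector. *)
Lemma tr_key_proj_le (sigma : 'M[C]_((k * s) * (k * t))) : sepk (mx_kernel sigma) ->
  \tr (key_proj *m sigma) <= k%:R^-1 * \tr sigma.
Proof.
move=> [r [v [w e]]].
have trE : \tr sigma = \sum_n (\sum_x v n x * (v n x)^*) * (\sum_y w n y * (w n y)^*).
  rewrite /mxtrace sum_mxtens.
  transitivity (\sum_x \sum_y \sum_n v n x * w n y * (v n x * w n y)^*).
    by apply: eq_bigr => x _; apply: eq_bigr => y _; rewrite -e.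
  under eq_bigr do rewrite exchange_big; rewrite exchange_big; apply: eq_bigr => n _ /=.
  rewrite mulr_suml; apply: eq_bigr => x _; rewrite mulr_sumr; apply: eq_bigr => y _.
  by rewrite rmorphM mulrACA.
have [H [-> HE]] := key_proj_factor.
pose x n : 'cV[C]_((k * s) * (k * t)) :=
  \col_z (v n (mxtens_unindex z).1 * w n (mxtens_unindex z).2).
have sE : sigma = \sum_n x n *m (x n) ^t*.
  apply/matrixP => z z'; case: (mxtens_indexP z) => p q; case: (mxtens_indexP z') => p' q'.
  rewrite -[LHS]/(mx_kernel sigma p q p' q') e summxE; apply: eq_bigr => n _.
  by rewrite [RHS]mxE big_ord1 adjE /x !mxE !mxtens_indexK.
have Hx n c : (H ^t* *m x n) c 0 = c0^* * shield_amplitude (v n) (w n) c.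
  rewrite mxE sum_mxtens sum_mxtens /shield_amplitude mulr_sumr.
  apply: eq_bigr => i _; rewrite mulr_sumr; apply: eq_bigr => a _.
  rewrite sum_mxtens (bigD1 i) //= [X in _ + X]big1 => [|j nj]; last first.
    by apply: big1 => b _; rewrite adjE HE eq_sym (negPf nj) mul0r mulr0 rmorph0 mul0r.
  rewrite addr0 mulr_sumr; apply: eq_bigr => b _.
  by rewrite adjE HE eqxx mul1r rmorphM /x [X in _ * X]mxE !mxtens_indexK /= -mulrA.
rewrite {1}sE mulmx_sumr linear_sum trE mulr_sumr; apply: ler_sum => n _ /=.
rewrite mulmxA mxtrace_mulC -(mulmxA H) (mulmxA ((x n) ^t*)) /=.
have -> : \tr ((x n) ^t* *m H *m (H ^t* *m x n))
    = k%:R^-1 * \sum_c shield_amplitude (v n) (w n) c * (shield_amplitude (v n) (w n) c)^*.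
  have -> : (x n) ^t* *m H = (H ^t* *m x n) ^t* by rewrite mulmxtC trmxCK.
  rewrite /mxtrace big_ord1 mxE mulr_sumr; apply: eq_bigr => c _.
  by rewrite adjE Hx rmorphM /= conjCK mulrACA c0_sq [X in _ * X]mulrC.
by rewrite ler_wpM2l ?invr_ge0 ?ler0n // shield_amplitude_le.
Qed.
End Twist.

Local Open Scope complex_scope.
Local Open Scope classical_set_scope.

(** * Relative entropy of mixtures of projections *)

Section Entropy.
Variable R : realType.
Local Notation C := R[i].

Lemma conj_real (x : R) : Num.conj x%:C = x%:C.
Proof. by apply/CrealP; rewrite complex_real. Qed.

Lemma Re_sum I (s : seq I) (P : pred I) (F : I -> C) :
  complex.Re (\sum_(i <- s | P i) F i) = \sum_(i <- s | P i) complex.Re (F i).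
Proof. by apply: (big_morph (@complex.Re R)) => // [[a b] [c e]]. Qed.

Lemma mxtraceB n (A B : 'M[C]_n) : \tr (A - B) = \tr A - \tr B.
Proof. exact: linearB. Qed.

Lemma ReB (x y : C) : complex.Re (x - y) = complex.Re x - complex.Re y.
Proof. by case: x y => a b [c e]. Qed.

Lemma Re_tr_mulB n (A B D E : 'M[C]_n) :
  complex.Re (\tr (A *m B - D *m E))
  = complex.Re (\tr (A *m B)) - complex.Re (\tr (D *m E)).
Proof. by rewrite mxtraceB ReB. Qed.

Lemma Re_realM (x : R) (z : C) : complex.Re (x%:C * z) = x * complex.Re z.
Proof. by case: z => a b /=; rewrite mul0r subr0. Qed.

Lemma mxlog2_proj n (I : finType) (P : I -> 'M[C]_n) (l : I -> R) :
  (forall i j, P i *m P j = (i == j)%:R *: P i) -> \sum_i P i = 1%:M ->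
  (forall i, (P i) ^t* = P i) ->
  mxlog2 (\sum_i (l i)%:C *: P i) = \sum_i (log2 (l i))%:C *: P i.
Proof.
move=> PP P1 Ph.
exact: (spectral_map_proj (fun z : C => (log2 (complex.Re z))%:C) PP P1 Ph
  (fun i => conj_real (l i))).
Qed.

Lemma ln_le_subr1 (x : R) : 0 < x -> ln x <= x - 1.
Proof.
by move=> x0; rewrite -{2}(lnK x0) lerBrDl expR_ge1Dx.
Qed.

Lemma ln2_gt0 : 0 < ln 2 :> R.
Proof. by rewrite ln_gt0 // ltr1n. Qed.

(** Jensen's inequality for the weights m/t, obtained by summing ln y <= y - 1 at y = s k * t / q.
    The terms with s k = 0, where ln takes its default value, have weight 0. *)
Lemma weighted_log2_le (I : finType) (m s : I -> R) (t q : R) :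
  (forall k, 0 <= m k) -> (forall k, 0 <= s k) -> (forall k, s k = 0 -> m k = 0) ->
  \sum_k m k = t -> \sum_k m k * s k = q -> 0 < t ->
  0 < q /\ \sum_k m k * log2 (s k) <= t * (log2 q - log2 t).
Proof.
move=> m0 s0 sm mt mq t0.
have q0 : 0 < q.
  rewrite lt_neqAle -mq sumr_ge0 ?andbT => [|k _]; last by rewrite mulr_ge0.
  apply/negP => /eqP/esym/eqP; rewrite psumr_eq0 => [/allP h|k _]; last by rewrite mulr_ge0.
  move: t0; rewrite -mt big1 ?ltxx // => k _.
  have := h k (mem_index_enum _); rewrite mulf_eq0 => /orP[/eqP//|/eqP].
  exact: sm.
split=> //; rewrite /log2 -mulrBl mulrA ler_pdivlMr ?ln2_gt0 // mulr_suml.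
apply: (@le_trans _ _ (\sum_k (m k * (ln q - ln t - 1) + m k * s k * (t / q)))).
  apply: ler_sum => k _; rewrite mulrA mulfVK ?gt_eqF ?ln2_gt0 //.
  have [z|nz] := eqVneq (s k) 0; first by rewrite (sm _ z) !mul0r addr0.
  have sk : 0 < s k by rewrite lt_neqAle eq_sym nz s0.
  rewrite -mulrA -mulrDr ler_wpM2l //.
  have /ln_le_subr1 : 0 < s k * (t / q) by rewrite mulr_gt0 ?divr_gt0.
  rewrite lnM ?posrE ?divr_gt0 // ln_div ?posrE //; lra.
rewrite big_split /= -!mulr_suml mt mq mulrCA divff ?gt_eqF // mulr1; lra.
Qed.

(** Jensen's inequality for the weights <e_k| P |e_k> in an eigenbasis of sigma. The kernel
    condition puts no weight on eigenvalue 0, so the convention ln 0 = 0 does no harm. *)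
Lemma tr_mxlog2_le n (sigma P : 'M[C]_n) (t : R) :
  psdmx sigma -> P ^t* = P -> P *m P = P -> \tr P = t%:C -> 0 < t ->
  (forall v : 'rV[C]_n, v *m sigma = 0 -> v *m P = 0) ->
  let q := complex.Re (\tr (P *m sigma)) in
  0 < q /\ complex.Re (\tr (P *m mxlog2 sigma)) <= t * (log2 q - log2 t).
Proof.
move=> ps hP PP tP t0 sP; have hs := psd_form_herm ps.
pose m k := complex.Re (spectral_weight sigma P k).
pose s k := complex.Re (spectral_diag sigma 0 k).
have mE k : spectral_weight sigma P k = (m k)%:C.
  by rewrite RRe_real // ger0_real // spectral_weight_ge0.
have sE k : spectral_diag sigma 0 k = (s k)%:C.
  by rewrite RRe_real // ger0_real // spectral_diag_ge0.
rewrite (tr_spectral_self P hs) /mxlog2 tr_spectral_map !Re_sum.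
under [X in _ /\ X <= _]eq_bigr do rewrite mE Re_realM /=.
apply: weighted_log2_le => //.
- by move=> k; rewrite -ler0c -mE spectral_weight_ge0.
- by move=> k; rewrite -ler0c -sE spectral_diag_ge0.
- move=> k sk0; apply: (@complexI R); rewrite -mE.
  by apply: spectral_weight_supp => //; rewrite sE /s sk0.
- by rewrite /m -Re_sum sum_spectral_weight tP.
- by apply: eq_bigr => k _; rewrite mE sE -rmorphM.
Qed.

Section ProjectiveMixtures.
Variables (n : nat) (I : finType) (P : I -> 'M[C]_n) (t : I -> R).
Hypothesis P_mul : forall i j, P i *m P j = (i == j)%:R *: P i.
Hypothesis P_sum : \sum_i P i = 1%:M.
Hypothesis P_herm : forall i, (P i) ^t* = P i.
Hypothesis P_tr : forall i, \tr (P i) = (t i)%:C.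
Hypothesis t_gt0 : forall i, 0 < t i.

(** Dividing by the trace [t i] makes [p i] the weight of the normalised projection. *)
Definition mixture (p : I -> R) : 'M[C]_n := \sum_i (p i / t i)%:C *: P i.

Definition rel_ent (p q : I -> R) : R := \sum_i p i * (log2 (p i) - log2 (q i)).

Lemma mixture_herm p : (mixture p) ^t* = mixture p.
Proof. exact: (proj_comb_herm P_herm (fun i => conj_real _)). Qed.

Lemma log2_div (x y : R) : 0 < x -> 0 < y -> log2 (x / y) = log2 x - log2 y.
Proof. by move=> x0 y0; rewrite /log2 ln_div ?posrE // mulrBl. Qed.

Lemma Re_tr_mixture p (X : 'M[C]_n) :
  complex.Re (\tr (mixture p *m X)) = \sum_i p i / t i * complex.Re (\tr (P i *m X)).
Proof.
by rewrite (tr_proj_comb P) Re_sum; apply: eq_bigr => i _; rewrite Re_realM.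
Qed.

Lemma tr_mixture_log2 p q : (forall i, 0 <= p i) -> (forall i, 0 < p i -> 0 < q i) ->
  complex.Re (\tr (mixture p *m mxlog2 (mixture q)))
  = \sum_i p i * (log2 (q i) - log2 (t i)).
Proof.
move=> p0 pq; rewrite Re_tr_mixture; apply: eq_bigr => i _.
rewrite (mxlog2_proj _ P_mul P_sum P_herm) mulmx_sumr (bigD1 i) //= big1 => [|j nji].
  rewrite addr0 -scalemxAr P_mul eqxx scale1r linearZ /= P_tr Re_realM /=.
  have [->|nz] := eqVneq (p i) 0; first by rewrite !mul0r.
  have pi0 : 0 < p i by rewrite lt_neqAle eq_sym nz p0.
  by rewrite log2_div ?pq // mulrCA mulfVK ?gt_eqF // mulrC.
by rewrite -scalemxAr P_mul eq_sym (negPf nji) scale0r scaler0.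
Qed.

Lemma rel_entropy_mixture p q : (forall i, 0 <= p i) -> (forall i, 0 < q i) ->
  rel_entropy (mixture p) (mixture q) = (rel_ent p q)%:E.
Proof.
move=> p0 q0; rewrite /rel_entropy submx_full; last first.
  have : mixture q *m (\sum_i (q i / t i)^-1%:C *: P i) = 1%:M.
    rewrite (proj_comb_mul _ _ P_mul) -P_sum; apply: eq_bigr => i _.
    by rewrite -rmorphM /= divff ?scale1r // gt_eqF ?divr_gt0.
  by move=> /mulmx1_unit[]; rewrite row_full_unit.
rewrite Re_tr_mulB [X in X - _](tr_mixture_log2 p0 (fun _ => id)).
rewrite [X in _ - X](tr_mixture_log2 p0 (fun i _ => q0 i)) -sumrB; congr (_%:E).
by apply: eq_bigr => i _; rewrite -mulrBr; congr (_ * _); lra.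
Qed.

(** The measurement by the P i leaves the first state unchanged, so the bound needs only Jensen's
    inequality on each block. Positivity of q where p is positive is returned separately: with ln 0
    = 0, [rel_ent] does not record it. *)
Lemma rel_entropy_mixture_ge p (sigma : 'M[C]_n) :
  (forall i, 0 <= p i) -> psdmx sigma ->
  let q i := complex.Re (\tr (P i *m sigma)) in
  rel_entropy (mixture p) sigma = +oo%E \/
  (forall i, 0 < p i -> 0 < q i) /\
  ((rel_ent p q)%:E <= rel_entropy (mixture p) sigma)%E.
Proof.
move=> p0 ps q; rewrite /rel_entropy; case: ifP => [sub|_]; [right|by left].
have hs := psd_form_herm ps.
(* The kernel of sigma lies in that of the mixture; multiplying the mixture by P i isolates a
   non-zero multiple of P i. *)
have supp i (v : 'rV[C]_n) : 0 < p i -> v *m sigma = 0 -> v *m P i = 0.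
  move=> pi0 /(supp_sub hs (mixture_herm p) sub) vp0.
  have ci0 : (p i / t i)%:C != 0.
    by rewrite (inj_eq (@complexI R)) gt_eqF ?divr_gt0.
  apply: (scalerI ci0); rewrite scaler0 -(mul0mx _ (P i)) -vp0 -mulmxA scalemxAr.
  congr (_ *m _); rewrite mulmx_suml (bigD1 i) //= big1 ?addr0 => [|j nji].
    by rewrite -scalemxAl P_mul eqxx scale1r.
  by rewrite -scalemxAl P_mul (negPf nji) scale0r scaler0.
have PPi i : P i *m P i = P i by rewrite P_mul eqxx scale1r.
have J i : 0 < p i -> 0 < q i /\
   complex.Re (\tr (P i *m mxlog2 sigma)) <= t i * (log2 (q i) - log2 (t i)).
  by move=> pi0; apply: tr_mxlog2_le => // v; apply: supp.
split=> [i /J[]//|]; rewrite lee_fin [X in _ <= X]Re_tr_mulB.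
rewrite [X in _ <= X - _](tr_mixture_log2 p0 (fun _ => id)).
rewrite [X in _ <= _ - X](Re_tr_mixture p (mxlog2 sigma)).
rewrite -sumrB; apply: ler_sum => i _.
have [->|nz] := eqVneq (p i) 0; first by rewrite !mul0r subr0.
have pi0 : 0 < p i by rewrite lt_neqAle eq_sym nz p0.
have [_ h] := J i pi0.
have := ler_wpM2l (ltW (divr_gt0 pi0 (t_gt0 i))) h.
rewrite (mulrA (p i / t i) (t i)) mulfVK ?gt_eqF // => h2; lra.
Qed.

End ProjectiveMixtures.
End Entropy.

(** * Werner states *)

Section Werner.
Variable R : realType.
Local Notation C := R[i].

Lemma flip_swapmx d : flip R d = swapmx C d.
Proof.
apply/matrixP => z z'; case: (mxtens_indexP z) => k l; case: (mxtens_indexP z') => k' l'.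
rewrite swapmxE /flip summxE; under eq_bigr do rewrite summxE.
rewrite (bigD1 k) //= (bigD1 l) //= [X in _ + X + _]big1 => [|j njl]; last first.
  by rewrite !mxE !mxtens_index_eq (eq_sym l) (negPf njl) andbF.
rewrite [X in _ + X]big1 => [|i nik]; last first.
  by rewrite big1 // => j _; rewrite !mxE !mxtens_index_eq (eq_sym k) (negPf nik).
by rewrite !mxE !mxtens_index_eq !eqxx /= (eq_sym k') (eq_sym l') andbC !addr0.
Qed.

Definition proj_dim d (a : bool) : R := d%:R * (d%:R + (-1) ^+ a) / 2.
Definition pair_dim d (s : bool * bool) : R := proj_dim d s.1 * proj_dim d s.2.
(** Here eta is the expectation of the swap in the Werner state. *)
Definition werner_prob (eta : R) (a : bool) : R := (1 + (-1) ^+ a * eta) / 2.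
Definition pair_prob (eta : R) (s : bool * bool) : R :=
  werner_prob eta s.1 * werner_prob eta s.2.

Lemma proj_dim_gt0 d a : (1 < d)%N -> 0 < proj_dim d a.
Proof.
move=> d1; have : 1 < d%:R :> R by rewrite ltr1n.
by rewrite /proj_dim; case: a => /= h; rewrite ?expr0 ?expr1; nra.
Qed.

Lemma pair_dim_gt0 d s : (1 < d)%N -> 0 < pair_dim d s.
Proof. by move=> d1; rewrite mulr_gt0 ?proj_dim_gt0. Qed.

Lemma projmx_trC d a : \tr (projmx C d a) = (proj_dim d a)%:C.
Proof.
by rewrite projmx_tr /proj_dim !(rmorphM, rmorphD) /= fmorphV !rmorph_nat rmorph_sign.
Qed.

Lemma pairmx_trC d s : \tr (pairmx C d s) = (pair_dim d s)%:C.
Proof.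
rewrite pairmx_tr /pair_dim /proj_dim !(rmorphM, rmorphD) /= fmorphV.
by rewrite !rmorph_nat !rmorph_sign.
Qed.

Lemma werner_prob_ge0 eta a : -1 <= eta -> eta <= 0 -> 0 <= werner_prob eta a.
Proof. by rewrite /werner_prob; case: a; rewrite ?expr0 ?expr1; lra. Qed.

Lemma werner_mixture eta d : (1 < d)%N ->
  werner eta d = mixture (projmx C d) (proj_dim d) (werner_prob eta).
Proof.
move=> d1; have h1 : 1 < d%:R :> R by rewrite ltr1n.
have n1 : d%:R - 1 != 0 :> R by rewrite gt_eqF // subr_gt0.
have n2 : d%:R + 1 != 0 :> R by rewrite gt_eqF //; lra.
have n0 : d%:R != 0 :> R by rewrite gt_eqF //; lra.
have n3 : d%:R ^+ 3 - d%:R != 0 :> R.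
  have -> : d%:R ^+ 3 - d%:R = d%:R * ((d%:R - 1) * (d%:R + 1)) :> R by ring.
  by rewrite !mulf_neq0.
pose lin (x y : R) : 'M[C]_(d * d) := x%:C *: 1%:M + y%:C *: swapmx C d.
have linZ c x y : c%:C *: lin x y = lin (c * x) (c * y).
  by rewrite /lin scalerDr !scalerA -!rmorphM.
have linD x y x' y' : lin x y + lin x' y' = lin (x + x') (y + y').
  by rewrite /lin scale_addACA -!(rmorphD (real_complex R)).
have pl a : projmx C d a = lin 2^-1 (2^-1 * (-1) ^+ a).
  rewrite /projmx /lin scalerDr scalerA rmorphM /= fmorphV rmorph_nat rmorph_sign //.
rewrite /werner flip_swapmx -/(lin _ _) linZ /mixture big_bool /= !pl !linZ linD.
by congr lin; rewrite /werner_prob /proj_dim /= expr0 expr1; field;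
  rewrite ?n0 ?n1 ?n2 ?n3.
Qed.

Lemma werner_pair_mixture eta d : (1 < d)%N ->
  mid_swap (werner eta d *t werner eta d)
  = mixture (pairmx C d) (pair_dim d) (pair_prob eta).
Proof.
move=> d1; rewrite werner_mixture // /mixture tensmx_suml.
under eq_bigr do rewrite tensmx_sumr.
rewrite pair_big /= /mid_swap linear_sum /=; apply: eq_bigr => s _.
rewrite tensmxZ linearZ /= /pairmx -rmorphM; congr ((_ %:C) *: _).
by rewrite mulrACA -invfM.
Qed.

Lemma separable_sepk m n (sigma : 'M[C]_(m * n)) : @separable R m n sigma ->
  sepk (fun x y x' y' => sigma (mxtens_index (x, y)) (mxtens_index (x', y'))).
Proof.
move=> [r [p [al [be [p0 _ st ->]]]]].
have h k : sepk (fun x y x' y' => (p k)%:C * (al k x x' * be k y y')).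
  have [[pa _] [pb _]] := st k.
  have [v va] := psd_factor pa; have [w wb] := psd_factor pb.
  apply: sepkZ; first by rewrite ler0c.
  apply: sepk_ext (sepk_sum (index_enum 'I_m) (fun i _ =>
    sepk_sum (index_enum 'I_n) (fun j _ => sepk_prod (v i) (w j)))) _ => x y x' y'.
  rewrite va wb mulr_suml; apply: eq_bigr => i _; rewrite mulr_sumr.
  by apply: eq_bigr => j _; rewrite rmorphM mulrACA.
apply: sepk_ext (sepk_sum (index_enum _) (fun k _ => h k)) _ => x y x' y'.
by rewrite summxE; apply: eq_bigr => k _; rewrite mxE tensmxE.
Qed.

Lemma separable_psd m n (sigma : 'M[C]_(m * n)) : @separable R m n sigma -> psdmx sigma.
Proof.
move=> /separable_sepk[r [v [w e]]] u.
pose f i : 'cV[C]_(m * n) := \col_z (v i (mxtens_unindex z).1 * w i (mxtens_unindex z).2).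
have -> : sigma = \sum_i f i *m (f i) ^t*.
  apply/matrixP => z z'; case: (mxtens_indexP z) => x y; case: (mxtens_indexP z') => x' y'.
  rewrite e summxE; apply: eq_bigr => i _.
  by rewrite [RHS]mxE big_ord1 !mxE !mxtens_indexK.
rewrite mulmx_sumr mulmx_suml summxE sumr_ge0 // => i _.
have -> : u ^t* *m (f i *m (f i) ^t*) *m u = (u ^t* *m f i) *m (u ^t* *m f i) ^t*.
  by rewrite mulmxtC trmxCK !mulmxA.
exact: mulmxtC_diag_ge0.
Qed.

(** A zero vector is given weight c = 0 and an arbitrary basis vector as direction, which exists
    because n is positive. *)
Lemma unit_direction n (v : 'I_n -> C) : (0 < n)%N ->
  exists u : 'cV[C]_n, exists c : R, [/\ 0 <= c, \sum_x v x * (v x)^* = c%:C,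
    state (u *m u ^t*) & forall x x', v x * (v x')^* = c%:C * (u x 0 * (u x' 0)^*)].
Proof.
move=> n0; pose N := \sum_x v x * (v x)^*.
have N0 : 0 <= N by rewrite sumr_ge0 // => x _; rewrite mul_conjC_ge0.
have NE : N = (complex.Re N)%:C by rewrite RRe_real // ger0_real.
have st (u : 'cV[C]_n) : \sum_x u x 0 * (u x 0)^* = 1 -> state (u *m u ^t*).
  move=> u1; split=> [w|].
    have -> : w ^t* *m (u *m u ^t*) *m w = (w ^t* *m u) *m (w ^t* *m u) ^t*.
      by rewrite mulmxtC trmxCK !mulmxA.
    exact: mulmxtC_diag_ge0.
  rewrite -u1; apply: eq_bigr => x _; rewrite mxE big_ord1 !mxE //.
have [N00|Nn0] := eqVneq N 0.
  pose x0 : 'I_n := Ordinal n0.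
  exists (delta_mx x0 0), 0; split=> //.
    apply: st; rewrite (bigD1 x0) //= big1 => [|x nx]; last first.
      by rewrite !mxE (negPf nx) mul0r.
    by rewrite !mxE !eqxx mul1r addr0 rmorph1.
  move=> x x'; rewrite mul0r.
  have /eqP := N00; rewrite psumr_eq0 => [/allP h|y _]; last exact: mul_conjC_ge0.
  by have := h x (mem_index_enum _); rewrite mul_conjC_eq0 => /eqP->; rewrite mul0r.
pose q := (sqrtC N)^-1.
have qq : q * q^* = N^-1.
  rewrite -normCK normfV ger0_norm ?sqrtC_ge0 // exprVn sqrtCK //.
exists (\col_x (q * v x)), (complex.Re N); rewrite -NE; split=> //.
- by rewrite -ler0c -NE.
- apply: st; rewrite -(mulVf Nn0) -qq mulr_sumr; apply: eq_bigr => x _.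
  by rewrite !mxE rmorphM mulrACA.
- by move=> x x'; rewrite !mxE rmorphM mulrACA qq mulVKf.
Qed.

(** Each product vector is normalised and its squared norm becomes the probability; the trace
    condition makes these sum to 1. *)
Lemma sepk_separable m n (sigma : 'M[C]_(m * n)) : (0 < m)%N -> (0 < n)%N ->
  sepk (fun x y x' y' => sigma (mxtens_index (x, y)) (mxtens_index (x', y'))) ->
  \tr sigma = 1 -> @separable R m n sigma.
Proof.
move=> m0 n0 [r [v [w e]]] tr1.
have [fv hv] := choice (fun i => unit_direction (v i) m0).
have [cv {}hv] := choice hv.
have [fw hw] := choice (fun i => unit_direction (w i) n0).
have [cw {}hw] := choice hw.
have eE : sigma = \sum_i (cv i * cw i)%:C *: ((fv i *m (fv i) ^t*) *t (fw i *m (fw i) ^t*)).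
  apply/matrixP => z z'; case: (mxtens_indexP z) => x y; case: (mxtens_indexP z') => x' y'.
  rewrite e summxE; apply: eq_bigr => i _.
  have [_ _ _ ev] := hv i; have [_ _ _ ew] := hw i.
  rewrite rmorphM mulrACA ev ew mxE tensmxE !mxE !big_ord1 !mxE rmorphM /=.
  by rewrite mulrACA.
exists r, (fun i => cv i * cw i), (fun i => fv i *m (fv i) ^t*),
  (fun i => fw i *m (fw i) ^t*); split=> //.
- by move=> i; have [? _ _ _] := hv i; have [? _ _ _] := hw i; rewrite mulr_ge0.
- apply: (@complexI R); rewrite rmorph_sum rmorph1 -tr1 eE linear_sum /=.
  apply: eq_bigr => i _; rewrite linearZ /= tensmx_tr.
  have [_ _ [_ ->] _] := hv i; have [_ _ [_ ->] _] := hw i.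
  by rewrite !mulr1.
- by move=> i; have [_ _ ? _] := hv i; have [_ _ ? _] := hw i.
Qed.

Lemma separable_tr m n (sigma : 'M[C]_(m * n)) : @separable R m n sigma -> \tr sigma = 1.
Proof.
move=> [r [p [al [be [_ p1 st ->]]]]]; rewrite linear_sum -(rmorph1 (real_complex R)) /=.
rewrite -p1 rmorph_sum; apply: eq_bigr => i _; rewrite linearZ /= tensmx_tr.
by have [[_ ->] [_ ->]] := st i; rewrite !mulr1.
Qed.

(** The expectation of the swap in a product vector v (x) w is the squared modulus of the inner
    product of v and w. *)
Lemma tr_swapmx_ge0 d (sigma : 'M[C]_(d * d)) :
  @separable R d d sigma -> 0 <= \tr (swapmx C d *m sigma).
Proof.
move=> /separable_sepk[r [v [w e]]].
have -> : \tr (swapmx C d *m sigma)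
    = \sum_i (\sum_x v i x * (w i x)^*) * (\sum_x v i x * (w i x)^*)^*.
  rewrite /mxtrace sum_mxtens.
  transitivity (\sum_x \sum_y \sum_i (v i y * (w i y)^*) * (v i x * (w i x)^*)^*).
    apply: eq_bigr => x _; apply: eq_bigr => y _; rewrite mxE sum_mxtens.
    rewrite (bigD1 y) //= (bigD1 x) //= [X in _ + X + _]big1 => [|p npx]; last first.
      by rewrite swapmxE eq_sym (negPf npx) mul0r.
    rewrite [X in _ + X]big1 => [|p npy]; last first.
      by rewrite big1 // => q _; rewrite swapmxE andbC eq_sym (negPf npy) mul0r.
    rewrite swapmxE !eqxx mul1r !addr0 e; apply: eq_bigr => i _.
    by rewrite !rmorphM /= conjCK; ring.
  rewrite exchange_big; under eq_bigr do rewrite exchange_big.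
  rewrite exchange_big; apply: eq_bigr => i _; rewrite mulr_suml.
  by apply: eq_bigr => y _; rewrite rmorph_sum mulr_sumr.
by apply: sumr_ge0 => i _; rewrite mul_conjC_ge0.
Qed.

End Werner.

(** * Comparing one copy with two *)

Section EntanglementBounds.
Variable R : realType.
Local Notation C := R[i].

(** The divergence, in bits, of the Werner weights from the uniform law on two labels. *)
Definition werner_rate (eta : R) : R :=
  \sum_a werner_prob eta a * (log2 (werner_prob eta a) + 1).

Lemma log2_le_of_ln (x y : R) : ln x <= y -> log2 x <= y / ln 2.
Proof. by move=> h; rewrite /log2 ler_pM2r // invr_gt0 ln2_gt0. Qed.

Lemma log2_2 : log2 2 = 1 :> R.
Proof. by rewrite /log2 divff // gt_eqF ?ln2_gt0. Qed.

Lemma log2M (x y : R) : 0 < x -> 0 < y -> log2 (x * y) = log2 x + log2 y.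
Proof. by move=> x0 y0; rewrite /log2 lnM ?posrE // mulrDl. Qed.

Lemma sum_log2_le (I : finType) (p r : I -> R) :
  (forall i, 0 <= p i) -> (forall i, 0 < p i -> 0 < r i) ->
  \sum_i p i * log2 (r i) <= (\sum_i p i * (r i - 1)) / ln 2.
Proof.
move=> p0 pr; rewrite mulr_suml; apply: ler_sum => i _.
have [->|pn0] := eqVneq (p i) 0; first by rewrite !mul0r.
have pp : 0 < p i by rewrite lt_neqAle eq_sym pn0 p0.
by rewrite -mulrA ler_wpM2l ?p0 // log2_le_of_ln // ln_le_subr1 ?pr.
Qed.

(** If the swap has expectation f >= 0 in sigma, the labels have law (1 + f)/2, (1 - f)/2. Replacing
    it by the uniform law lowers the divergence by at least -eta f / ln 2, which is non-negative
    since eta <= 0. *)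
Lemma rel_entropy_ent_werner_ge eta d : (1 < d)%N -> -1 <= eta -> eta <= 0 ->
  ((werner_rate eta)%:E <= @rel_entropy_ent R d d (werner eta d))%E.
Proof.
move=> d1 h1 h2; apply: le_ereal_inf_tmp => _ [sigma sep <-].
rewrite werner_mixture //.
have p0 a := werner_prob_ge0 a h1 h2.
have [->|[qpos]] := rel_entropy_mixture_ge (@projmx_mul C d) (@projmx_sum C d)
  (@projmx_herm C d) (@projmx_trC R d) (fun a => proj_dim_gt0 R a d1) p0
  (separable_psd sep); first by rewrite leey.
apply: le_trans; rewrite lee_fin.
pose f := complex.Re (\tr (swapmx C d *m sigma)).
have f0 : 0 <= f.
  by have := tr_swapmx_ge0 sep; rewrite lecE => /andP[].
have qE a : complex.Re (\tr (projmx C d a *m sigma)) = (1 + (-1) ^+ a * f) / 2.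
  rewrite /projmx -scalemxAl mulmxDl mul1mx -scalemxAl linearZ /= linearD /= linearZ /=.
  rewrite (separable_tr sep).
  have -> : (2^-1 : C) = (2^-1)%:C by rewrite fmorphV rmorph_nat.
  rewrite Re_realM raddfD /= -(rmorph_sign (real_complex R)) Re_realM /= mulrC //.
rewrite -subr_ge0 -sumrB.
pose r a := 1 + (-1) ^+ a * f.
have r0 a : 0 < werner_prob eta a -> 0 < r a.
  by move=> /qpos; rewrite qE pmulr_lgt0 // invr_gt0 ltr0n.
have e1 : \sum_a werner_prob eta a * (r a - 1) = eta * f.
  by rewrite big_bool /r /werner_prob /= expr0 expr1; field.
have := sum_log2_le p0 r0; rewrite e1.
have e0 : eta * f / ln 2 <= 0.
  by rewrite mulr_le0_ge0 ?mulr_le0_ge0 // invr_ge0 ltW ?ln2_gt0.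
move=> /le_trans/(_ e0); rewrite -oppr_ge0 -sumrN.
move=> h; apply: (le_trans h); rewrite le_eqVlt; apply/orP; left; apply/eqP.
apply: eq_bigr => a _; rewrite qE -/(r a) -mulrBr -mulrN.
have [->|pn0] := eqVneq (werner_prob eta a) 0; first by rewrite !mul0r.
have pp : 0 < werner_prob eta a by rewrite lt_neqAle eq_sym pn0 p0.
rewrite (log2_div (r0 a pp) (ltr0n R 2)) log2_2; congr (_ * _); ring.
Qed.

(** From ln (1 + x) >= x / (1 + x) = x - x^2 / (1 + x), where 1 + x is at least 1/2. *)
Lemma ln_1D_ge (x : R) : - 2^-1 <= x -> x <= 2^-1 -> x - 2 * x ^+ 2 <= ln (1 + x).
Proof.
move=> h1 h2; have x0 : 0 < 1 + x by lra.
have := ln_le_subr1 (_ : 0 < (1 + x)^-1); rewrite invr_gt0 => /(_ x0).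
rewrite lnV ?posrE // => h.
suff : (1 + x)^-1 - 1 <= - (x - 2 * x ^+ 2) by lra.
rewrite lerBlDr -(ler_pM2l x0) divff ?gt_eqF //; nra.
Qed.

(** Four times the rate of change of the weight of s along the segment [pair_point]; the terms are
    the swap expectations 1/d, 1/d and 1, with the signs of s. *)
Definition pair_gain d (s : bool * bool) : R :=
  ((-1) ^+ s.1 + (-1) ^+ s.2) / d%:R + (-1) ^+ s.1 * (-1) ^+ s.2.

(* Expectations of the pair projectors in the mixture with weights 1 - t and t of
   |00><00| (x) |11><11| and of the product of maximally entangled states on A1 A2
   and on B1 B2. *)
Definition pair_point d t (s : bool * bool) : R := (1 + t * pair_gain d s) / 4.

Lemma pair_kernel_mixture d (q : bool * bool -> R) x y x' y' : (1 < d)%N ->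
  pair_kernel (mixture (pairmx C d) (pair_dim R d) q) x y x' y'
  = \sum_a \sum_b (q (a, b))%:C
    * (choi C a x.1 y.1 x'.1 y'.1 * choi C b x.2 y.2 x'.2 y'.2).
Proof.
move=> d1; case: x y x' y' => [i m] [j n] [i' m'] [j' n'].
rewrite /pair_kernel /mixture summxE pair_big /=; apply: eq_bigr => -[a b] _ /=.
rewrite scalemxE pairmxE !projmxE /choi rmorphM -mulrA; congr (_ * _).
have dn (e : bool) : (d%:R + (-1) ^+ e : C) != 0.
  have := gt_eqF (proj_dim_gt0 R e d1); rewrite /proj_dim => h.
  apply/negP => /eqP z; move: h; rewrite (_ : d%:R + _ = 0) ?mulr0 ?mul0r ?eqxx //.
  by apply: (@complexI R); rewrite rmorphD /= rmorph_nat rmorph_sign rmorph0.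
have d0 : (d%:R : C) != 0 by rewrite pnatr_eq0 -lt0n ltnW.
rewrite /pair_dim /proj_dim fmorphV !(rmorphM, rmorphD) /= !fmorphV !rmorph_nat !rmorph_sign.
by field; rewrite ?dn ?d0.
Qed.

Lemma separable_pair_point d t : (1 < d)%N -> 0 <= t -> t <= 1 ->
  @separable R (d * d) (d * d)
    (mixture (pairmx C d) (pair_dim R d) (pair_point d t)).
Proof.
move=> d1 t0 t1; have d0 : (0 < d)%N by rewrite ltnW.
have dn0 : (d%:R : C) != 0 by rewrite pnatr_eq0 -lt0n.
apply: sepk_separable; rewrite ?muln_gt0 ?d0 //; last first.
  rewrite /mixture linear_sum /=.
  under eq_bigr do rewrite linearZ /= pairmx_trC -rmorphM /= divfK ?gt_eqF ?pair_dim_gt0 //.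
  rewrite -rmorph_sum -(rmorph1 (real_complex R)) /=; congr (_%:C).
  rewrite -(pair_big xpredT xpredT (fun a b => pair_point d t (a, b))) /= !big_bool.
  by rewrite /pair_point /pair_gain /=; field; rewrite pnatr_eq0 -lt0n.
pose e0 : 'I_d := Ordinal d0; pose e1 : 'I_d := Ordinal d1.
have s1 := sepk_prod (fun x : 'I_d * 'I_d => (x == (e0, e0))%:R : C)
  (fun y : 'I_d * 'I_d => (y == (e1, e1))%:R : C).
have s2 := sepk_prod (fun x : 'I_d * 'I_d => (x.1 == x.2)%:R : C)
  (fun y : 'I_d * 'I_d => (y.1 == y.2)%:R : C).
have c1 : 0 <= (1 - t)%:C :> C by rewrite ler0c subr_ge0.
(* The two unnormalised maximally entangled vectors together have squared norm d^2. *)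
have c2 : 0 <= (t / d%:R ^+ 2)%:C :> C by rewrite ler0c divr_ge0 ?exprn_ge0 ?ler0n.
have := sepk_pair_twirl d1 (sepkD (sepkZ c1 s1) (sepkZ c2 s2)).
move=> /(sepk_comp (@mxtens_unindex d d) (@mxtens_unindex d d)).
move/sepk_ext; apply=> z1 z2 z1' z2'.
case: (mxtens_indexP z1) => i m; case: (mxtens_indexP z2) => j n.
case: (mxtens_indexP z1') => i' m'; case: (mxtens_indexP z2') => j' n'.
rewrite !mxtens_indexK.
have := pair_kernel_mixture (pair_point d t) (i, m) (j, n) (i', m') (j', n') d1.
rewrite /pair_kernel => ->; apply: eq_bigr => a _; apply: eq_bigr => b _; congr (_ * _).
rewrite pair_weight_lin pair_weight_orthogonal // pair_weight_max_ent /pair_point /pair_gain.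
rewrite !(rmorphM, rmorphD, rmorphB) /= !fmorphV !(rmorphM, rmorphD) /=.
rewrite !rmorph_sign ?fmorphV ?rmorphXn /= !rmorph_nat rmorph1.
by field.
Qed.

Lemma pair_gain_bound d s : (2 < d)%N -> -2 <= pair_gain d s <= 2.
Proof.
move=> d2; have d3 : 3 <= d%:R :> R by rewrite (ler_nat R 3).
have i0 : 0 <= (d%:R^-1 : R) by rewrite invr_ge0; lra.
have i1 : (d%:R^-1 : R) <= 3^-1 by rewrite lef_pV2 ?posrE //; lra.
rewrite /pair_gain; move: (d%:R^-1) i0 i1 => z z0 z1.
by case: s => [] [] []; rewrite /= ?expr0 ?expr1; apply/andP; split; lra.
Qed.

(** The divergence is 2 [werner_rate] minus the mean of log2 (1 + t * gain), and the mean gain is G.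
    By [ln_1D_ge] and |gain| <= 2, the mean of ln (1 + t * gain) is at least t G - 8 t^2. *)
Lemma pair_rel_ent_lt eta d : (2 < d)%N -> -1 <= eta -> eta < - (2 / d%:R) ->
  exists t, [/\ 0 <= t, t <= 1, forall s, 0 < pair_point d t s &
    rel_ent (pair_prob eta) (pair_point d t) < 2 * werner_rate eta].
Proof.
move=> d2 h1 h2; have d3 : 3 <= d%:R :> R by rewrite (ler_nat R 3).
have i0 : 0 < (2 / d%:R : R) by rewrite divr_gt0 //; lra.
have eta0 : eta < 0 by lra.
pose G := eta * (eta + 2 / d%:R).
have G0 : 0 < G by rewrite /G nmulr_rgt0 //; lra.
have G1 : G <= 1 by rewrite /G; nra.
(* The maximiser of t G - 8 t^2, with value G^2 / 32. *)
pose t := G / 16; exists t.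
have t0 : 0 < t by rewrite /t; lra.
have t1 : t <= 1 / 16 by rewrite /t; lra.
have tg s : - 2^-1 <= t * pair_gain d s <= 2^-1.
  have /andP[g1 g2] := pair_gain_bound s d2.
  by apply/andP; split; nra.
have q0 s : 0 < pair_point d t s.
  by have /andP[g1 g2] := tg s; rewrite /pair_point; lra.
have p0 a : 0 <= werner_prob eta a by apply: werner_prob_ge0 => //; exact: ltW.
split=> //; [exact: ltW|by lra|].
have sumP : \sum_s pair_prob eta s = 1.
  rewrite -(pair_big xpredT xpredT (fun a b => pair_prob eta (a, b))) /= !big_bool.
  by rewrite /pair_prob /werner_prob /= expr0 expr1; field.
have sumG : \sum_s pair_prob eta s * pair_gain d s = G.
  rewrite -(pair_big xpredT xpredT
    (fun a b => pair_prob eta (a, b) * pair_gain d (a, b))) /= !big_bool.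
  rewrite /pair_prob /werner_prob /pair_gain /G /= expr0 expr1; field.
  by rewrite gt_eqF //; lra.
have relE : rel_ent (pair_prob eta) (pair_point d t)
    = 2 * werner_rate eta - \sum_s pair_prob eta s * log2 (1 + t * pair_gain d s).
  have -> : rel_ent (pair_prob eta) (pair_point d t) = \sum_s pair_prob eta s *
      (log2 (werner_prob eta s.1) + 1 + (log2 (werner_prob eta s.2) + 1)
       - log2 (1 + t * pair_gain d s)).
    apply: eq_bigr => s _; rewrite /pair_prob.
    have [->|n1] := eqVneq (werner_prob eta s.1) 0; first by rewrite !mul0r.
    have [->|n2] := eqVneq (werner_prob eta s.2) 0; first by rewrite mulr0 !mul0r.
    have P1 : 0 < werner_prob eta s.1 by rewrite lt_neqAle eq_sym n1 p0.
    have P2 : 0 < werner_prob eta s.2 by rewrite lt_neqAle eq_sym n2 p0.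
    have x0 : 0 < 1 + t * pair_gain d s by have /andP[g1 g2] := tg s; lra.
    rewrite log2M // /pair_point log2_div //.
    have -> : log2 4 = 2 :> R by rewrite (_ : 4 = 2 * 2) ?log2M ?log2_2 //; ring.
    by congr (_ * _); ring.
  under eq_bigr do rewrite mulrBr; rewrite sumrB; congr (_ - _).
  rewrite -(pair_big xpredT xpredT (fun a b => pair_prob eta (a, b) *
     (log2 (werner_prob eta a) + 1 + (log2 (werner_prob eta b) + 1)))) /=.
  rewrite /werner_rate !big_bool /pair_prob /=.
  rewrite /werner_prob /= expr0 expr1.
  by move: (log2 _) (log2 _) => x y; field.
rewrite relE ltrBlDr ltrDl.
suff : 0 < \sum_s pair_prob eta s * ln (1 + t * pair_gain d s).
  rewrite /log2; under [X in _ -> 0 < X]eq_bigr do rewrite mulrA.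
  by rewrite -mulr_suml => h; rewrite divr_gt0 ?ln2_gt0.
have low : \sum_s (pair_prob eta s * pair_gain d s * t - pair_prob eta s * (8 * t ^+ 2))
    <= \sum_s pair_prob eta s * ln (1 + t * pair_gain d s).
  apply: ler_sum => s _; rewrite -mulrA -mulrBr ler_wpM2l //.
    by rewrite /pair_prob mulr_ge0.
  have /andP[g1 g2] := tg s; apply: le_trans (ln_1D_ge g1 g2).
  have /andP[g3 g4] := pair_gain_bound s d2.
  rewrite (mulrC (pair_gain d s)) lerD2l lerN2 exprMn.
  have : pair_gain d s ^+ 2 <= 4 by nra.
  have : 0 <= t ^+ 2 by exact: sqr_ge0.
  nra.
apply: lt_le_trans low; rewrite sumrB -!mulr_suml sumP sumG mul1r /t; nra.
Qed.

Lemma rel_entropy_ent2_lt eta d : (2 < d)%N -> -1 <= eta -> eta < - (2 / d%:R) ->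
  (@rel_entropy_ent2 R d d (werner eta d) < @rel_entropy_ent R d d (werner eta d))%E.
Proof.
move=> d2 h1 h2; have d1 : (1 < d)%N by exact: ltnW.
have eta0 : eta <= 0.
  by apply: le_trans (ltW h2) _; rewrite oppr_le0 divr_ge0 ?ler0n.
apply: lt_le_trans (rel_entropy_ent_werner_ge d1 h1 eta0).
have [t [t0 t1 q0 lt]] := pair_rel_ent_lt d2 h1 h2.
have p0 s : 0 <= pair_prob eta s by rewrite mulr_ge0 ?werner_prob_ge0.
have le : (@rel_entropy_ent R (d * d) (d * d) (mid_swap (werner eta d *t werner eta d))
    <= (rel_ent (pair_prob eta) (pair_point d t))%:E)%E.
  rewrite werner_pair_mixture // -(rel_entropy_mixture (@pairmx_mul C d)
    (@pairmx_sum C d) (@pairmx_herm C d) (@pairmx_trC R d)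
    (fun s => pair_dim_gt0 R s d1) p0 q0).
  by apply: ereal_inf_lbound; exists (mixture (pairmx C d) (pair_dim R d)
    (pair_point d t)) => //; exact: separable_pair_point.
rewrite /rel_entropy_ent2; apply: le_lt_trans (lee_wpmul2l _ le) _.
  by rewrite lee_fin invr_ge0.
by rewrite -EFinM lte_fin; lra.
Qed.
End EntanglementBounds.

(** * Adaptive protocols *)

Section Locc.
Variable R : realType.
Local Notation C := R[i].

(** All that is used of an LOCC map. Separability is required with memories I and J attached,
    because half-used resources wait there while the map acts. *)
Record locc_like a b a' b' (L : 'M[C]_(a * b) -> 'M[C]_(a' * b')) : Prop := LoccLike {
  locc_linear : forall c X Y, L (c *: X + Y) = c *: L X + L Y;
  locc_tr : forall X, \tr (L X) = \tr X;
  locc_psd : forall X, psdk X -> psdk (L X);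
  locc_sep : forall (I J : Type) (X : I -> J -> I -> J -> 'M[C]_(a * b)),
    sepk (block_kernel X) -> sepk (block_kernel (fun i j i' j' => L (X i j i' j'))) }.

Lemma block_kernel_sum (I J K : Type) a b (s : seq K)
    (X : K -> I -> J -> I -> J -> 'M[C]_(a * b)) :
  (forall k, sepk (block_kernel (X k))) ->
  sepk (block_kernel (fun i j i' j' => \sum_(k <- s) X k i j i' j')).
Proof.
move=> sX; apply: sepk_ext (sepk_sum s (fun k (_ : xpredT k) => sX k)) _ => x y x' y'.
by rewrite /block_kernel summxE.
Qed.

Lemma LOCC_like a b a' b' (L : 'M[C]_(a * b) -> 'M[C]_(a' * b')) :
  LOCC L -> locc_like L.
Proof.
elim=> {a b a' b' L}
  [a b|a b a' b' r c K L K1 _ IH|a b a' b' r c K L K1 _ IH]; first by split.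
- split=> [z X Y|X|X pX|I J X sX].
  + rewrite scaler_sumr -big_split; apply: eq_bigr => x _.
    by rewrite mulmxDr mulmxDl -scalemxAr -scalemxAl (locc_linear (IH x)).
  + rewrite linear_sum /= -[RHS](tr_kraus _ (kraus_left_complete b K1)).
    by apply: eq_bigr => x _; rewrite (locc_tr (IH x)).
  + by apply: psdk_sum => x; apply: (locc_psd (IH x)); apply: psdk_conj.
  + apply: block_kernel_sum => x; apply: (locc_sep (IH x)).
    apply: sepk_ext (sepk_mapA (fun (p : I * 'I_(c x)) s => (p.1, s))
      (fun p s => K x p.2 s) sX) _ => p q p' q'.
    by rewrite {1}/block_kernel kraus_leftE.
- split=> [z X Y|X|X pX|I J X sX].
  + rewrite scaler_sumr -big_split; apply: eq_bigr => x _.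
    by rewrite mulmxDr mulmxDl -scalemxAr -scalemxAl (locc_linear (IH x)).
  + rewrite linear_sum /= -[RHS](tr_kraus _ (kraus_right_complete a K1)).
    by apply: eq_bigr => x _; rewrite (locc_tr (IH x)).
  + by apply: psdk_sum => x; apply: (locc_psd (IH x)); apply: psdk_conj.
  + apply: block_kernel_sum => x; apply: (locc_sep (IH x)).
    apply: sepk_ext (sepk_mapB (fun (p : J * 'I_(c x)) s => (p.1, s))
      (fun p s => K x p.2 s) sX) _ => p q p' q'.
    by rewrite {1}/block_kernel kraus_rightE.
Qed.

Lemma locc_sum a b a' b' (L : 'M[C]_(a * b) -> 'M[C]_(a' * b')) (I : Type) (s : seq I)
  (c : I -> C) (X : I -> 'M[C]_(a * b)) : locc_like L ->
  L (\sum_(i <- s) c i *: X i) = \sum_(i <- s) c i *: L (X i).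
Proof.
move=> lL; have L0 : L 0 = 0.
  have := locc_linear lL 1 0 0; rewrite !scale1r addr0 => /(congr1 (fun Z => Z - L 0)).
  by rewrite subrr addrK.
elim: s => [|i s ih]; first by rewrite !big_nil.
by rewrite !big_cons (locc_linear lL) ih.
Qed.
End Locc.

(** * Transmission as contraction with a Choi state *)

Section Transmit.
Variable R : realType.
Local Notation C := R[i].
Variable d : nat.
Hypothesis d1 : (1 < d)%N.

Lemma transmitE (E : 'M[C]_d -> 'M[C]_d) a b (rho : 'M[C]_((a * d) * b)) i p j i' q j' :
  transmit E rho (mxtens_index (i, mxtens_index (p, j)))
    (mxtens_index (i', mxtens_index (q, j')))
  = E (\matrix_(s, t) rho (mxtens_index (mxtens_index (i, s), j))
                        (mxtens_index (mxtens_index (i', t), j'))) p q.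
Proof. by rewrite mxE !mxtens_indexK. Qed.

Lemma transmit_choiE (e : bool) a b (rho : 'M[C]_((a * d) * b)) i p j i' q j' :
  transmit (choi_channel e) rho (mxtens_index (i, mxtens_index (p, j)))
    (mxtens_index (i', mxtens_index (q, j')))
  = d%:R * \sum_s \sum_t rho (mxtens_index (mxtens_index (i, s), j))
      (mxtens_index (mxtens_index (i', t), j')) * choi C e s p t q.
Proof.
rewrite transmitE mxE; congr (_ * _); apply: eq_bigr => s _; apply: eq_bigr => t _.
by rewrite mxE.
Qed.

Lemma transmit_choi_sum e a b (I : Type) (s : seq I) (c : I -> C)
    (X : I -> 'M[C]_((a * d) * b)) :
  transmit (choi_channel e) (\sum_(k <- s) c k *: X k)
  = \sum_(k <- s) c k *: transmit (choi_channel e) (X k).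
Proof.
apply/matrixP => z z'; case: (mxtens_indexP z) => i z2; case: (mxtens_indexP z') => i' z2'.
case: (mxtens_indexP z2) => p j; case: (mxtens_indexP z2') => q j'.
rewrite transmit_choiE summxE.
under [RHS]eq_bigr do rewrite mxE transmit_choiE mulrCA.
rewrite -mulr_sumr; congr (_ * _).
under [RHS]eq_bigr do rewrite mulr_sumr.
rewrite [RHS]exchange_big; apply: eq_bigr => u _.
under [RHS]eq_bigr do rewrite mulr_sumr.
rewrite [RHS]exchange_big; apply: eq_bigr => v _.
rewrite summxE mulr_suml; apply: eq_bigr => k _.
by rewrite mxE -mulrA.
Qed.

Lemma transmit_choi_tr e a b (rho : 'M[C]_((a * d) * b)) :
  \tr (transmit (choi_channel e) rho) = \tr rho.
Proof.
rewrite /mxtrace sum_mxtens [RHS]sum_mxtens [RHS]sum_mxtens; apply: eq_bigr => i _.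
rewrite sum_mxtens exchange_big [RHS]exchange_big; apply: eq_bigr => j _ /=.
under eq_bigr do rewrite transmitE.
rewrite -/(\tr _) (choi_channel_tr d1); apply: eq_bigr => s _; by rewrite mxE.
Qed.

(** The output is d times the contraction of rho (x) [choi e] along the transmitted system, and both
    factors are positive. *)
Lemma transmit_choi_psd e a b (rho : 'M[C]_((a * d) * b)) :
  psdk rho -> psdk (transmit (choi_channel e) rho).
Proof.
move=> pr.
pose f (z : 'I_(a * (d * b))) (s : 'I_d) : 'I_((a * d) * b) * ('I_d * 'I_d) :=
  let: (i, pj) := mxtens_unindex z in let: (p, j) := mxtens_unindex pj in
  (mxtens_index (mxtens_index (i, s), j), (s, p)).
have := sepk_mapA f (fun _ _ => 1) (sepk_tens pr (sepk_choi C e d1)).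
move=> /(sepkZ (ler0n C d)) /(sepk_comp id (fun u : unit => (u, u))).
move/sepk_ext; apply => z _ z' _.
case: (mxtens_indexP z) => i z2; case: (mxtens_indexP z') => i' z2'.
case: (mxtens_indexP z2) => p j; case: (mxtens_indexP z2') => q j'.
rewrite transmit_choiE; congr (_ * _); apply: eq_bigr => s _; apply: eq_bigr => t _.
by rewrite /f !mxtens_indexK /= rmorph1 !mul1r.
Qed.

Lemma holevo_werner_choi eta (X : 'M[C]_d) :
  holevo_werner eta X = \sum_a (werner_prob eta a)%:C *: choi_channel a X.
Proof.
have h1 : 1 < d%:R :> R by rewrite ltr1n.
have n1 : d%:R - 1 != 0 :> R by rewrite gt_eqF // subr_gt0.
have n2 : d%:R + 1 != 0 :> R by rewrite gt_eqF //; lra.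
have n3 : d%:R ^+ 2 - 1 != 0 :> R by rewrite subr_sqr_1 mulf_neq0.
pose lin (x y : R) : 'M[C]_d := x%:C *: (\tr X)%:M + y%:C *: X^T.
have linZ c x y : c%:C *: lin x y = lin (c * x) (c * y).
  by rewrite /lin scalerDr !scalerA -!rmorphM.
have linD x y x' y' : lin x y + lin x' y' = lin (x + x') (y + y').
  by rewrite /lin scale_addACA -!(rmorphD (real_complex R)).
have cl a : choi_channel a X = lin (d%:R + (-1) ^+ a)^-1 ((d%:R + (-1) ^+ a)^-1 * (-1) ^+ a).
  rewrite (choi_channelE d1) /lin scalerDr scalerA rmorphM /= fmorphV rmorphD /=.
  by rewrite rmorph_nat rmorph_sign.
rewrite /holevo_werner -/(lin _ _) linZ big_bool /= !cl !linZ linD.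
by congr lin; rewrite /werner_prob /= expr0 expr1; field; rewrite ?n1 ?n2 ?n3.
Qed.

Lemma transmit_holevo_werner eta a b (rho : 'M[C]_((a * d) * b)) :
  transmit (@holevo_werner R eta d) rho
  = \sum_e (werner_prob eta e)%:C *: transmit (choi_channel e) rho.
Proof.
apply/matrixP => z z'; case: (mxtens_indexP z) => i z2; case: (mxtens_indexP z') => i' z2'.
case: (mxtens_indexP z2) => p j; case: (mxtens_indexP z2') => q j'.
rewrite transmitE holevo_werner_choi !summxE; apply: eq_bigr => e _.
by rewrite mxE [RHS]mxE transmitE.
Qed.

(* Teleportation through a shared resource, post-selected on the outcome that needs no
   correction.  Here [q] weights two uses of the channel: after the first one, the halves
   of the resource reserved for the second one stay in the memories. *)
Variable q : bool -> bool -> R.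
Hypothesis q_sep : sepk (fun x y x' y' : 'I_d * 'I_d => \sum_a \sum_b (q a b)%:C
  * (choi C a x.1 y.1 x'.1 y'.1 * choi C b x.2 y.2 x'.2 y'.2)).

Lemma sepk_first_use a b (tau : 'M[C]_((a * d) * b)) : sepk (mx_kernel tau) ->
  sepk (block_kernel (fun i j i' j' : 'I_d => \sum_e \sum_f
    ((q e f)%:C * choi C f i j i' j') *: transmit (choi_channel e) tau)).
Proof.
move=> st.
(* Alice's summation index s is both the system sent and her half of the first resource pair; her
   half of the second, x.1, stays free. On Bob's side [g] makes his half of the first pair the
   channel output. *)
pose f (x : 'I_d * 'I_a) (s : 'I_d) := (mxtens_index (x.2, s), (s, x.1)).
pose g (y : 'I_d * 'I_(d * b)) :=
  let: (j, z) := y in let: (p, w) := mxtens_unindex z in (w, (p, j)).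
have := sepk_mapA f (fun _ _ => 1) (sepk_tens st q_sep).
move=> /(sepkZ (ler0n C d)) /(sepk_comp id g).
move/sepk_ext; apply => -[i x] [j z] [i' x'] [j' z'].
case: (mxtens_indexP z) => p y; case: (mxtens_indexP z') => p' y'.
rewrite /g !mxtens_indexK /block_kernel /f /= sum2_mxE.
transitivity (\sum_e \sum_f (q e f)%:C * choi C f i j i' j' * (d%:R *
    \sum_s \sum_t tau (mxtens_index (mxtens_index (x, s), y))
      (mxtens_index (mxtens_index (x', t), y')) * choi C e s p t p')).
  by apply: eq_bigr => e _; apply: eq_bigr => e' _; rewrite transmit_choiE.
rewrite sum2_scale_exchange; congr (_ * _).
apply: eq_bigr => s _; apply: eq_bigr => t _.
rewrite rmorph1 !mul1r mulr_sumr; apply: eq_bigr => e _; rewrite mulr_sumr.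
by apply: eq_bigr => e' _; rewrite /mx_kernel; ring.
Qed.

Lemma sepk_second_use a b (I : Type) (r : seq I) (c : I -> bool -> R)
    (F : I -> 'M[C]_((a * d) * b)) :
  sepk (block_kernel (fun i j i' j' : 'I_d => \sum_(s <- r) \sum_f
     ((c s f)%:C * choi C f i j i' j') *: F s)) ->
  sepk (mx_kernel (\sum_f \sum_(s <- r) (c s f)%:C *: transmit (choi_channel f) (F s))).
Proof.
move=> sO.
(* Alice's memory is now contracted with the system sent, and Bob's memory becomes the channel
   output. *)
pose f (x : 'I_a) (s : 'I_d) := (s, mxtens_index (x, s)).
have := sepk_mapA f (fun _ _ => 1) sO.
move=> /(sepkZ (ler0n C d)) /(sepk_comp id (@mxtens_unindex d b)).
move/sepk_ext; apply => x z x' z'.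
case: (mxtens_indexP z) => p y; case: (mxtens_indexP z') => p' y'.
rewrite !mxtens_indexK /mx_kernel sum2_mxE.
transitivity (\sum_e \sum_(u <- r) (c u e)%:C * (d%:R *
    \sum_s \sum_t F u (mxtens_index (mxtens_index (x, s), y))
      (mxtens_index (mxtens_index (x', t), y')) * choi C e s p t p')).
  by apply: eq_bigr => e _; apply: eq_bigr => u _; rewrite transmit_choiE.
rewrite sum2_scale_exchange; congr (_ * _).
apply: eq_bigr => s _; apply: eq_bigr => t _.
rewrite rmorph1 !mul1r /block_kernel /= sum2_mxE exchange_big; apply: eq_bigr => u _.
by apply: eq_bigr => e _; ring.
Qed.
End Transmit.

(** * Laws on words of labels *)

Section Words.

Fixpoint words (n : nat) : seq (seq bool) :=
  if n is m.+1 then [seq e :: s | e <- index_enum bool, s <- words m] else [:: [::]].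

Lemma sum_wordsS (V : nmodType) n (f : seq bool -> V) :
  \sum_(s <- words n.+1) f s = \sum_(e : bool) \sum_(s <- words n) f (e :: s).
Proof. by rewrite /= big_allpairs_dep. Qed.

Lemma size_words n s : s \in words n -> size s = n.
Proof.
elim: n s => [|n ih] s /=; first by rewrite inE => /eqP->.
by move=> /allpairsP[[e t] [_ /= /ih <- ->]].
Qed.

Variable R : realType.
Variable p : bool -> R.
Variable q : bool -> bool -> R.

(* The head of a word is the label of the most recent use. *)
Definition word_prob (s : seq bool) : R := \prod_(e <- s) p e.

(** The head being the latest use, the pair f, e has e as its first use, whence [q e f]. Odd lengths
    get the default 0; after an odd number of uses the law is evaluated on words completed by the
    pending label. *)
Fixpoint pair_word_prob (s : seq bool) : R :=
  match s with
  | f :: e :: s' => pair_word_prob s' * q e f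
  | [::] => 1
  | _ => 0
  end.

End Words.

Section Decomposition.
Variable R : realType.
Local Notation C := R[i].
Variable d : nat.
Hypothesis d1 : (1 < d)%N.
Variable eta : R.
Variable q : bool -> bool -> R.
Hypothesis q_sep : sepk (fun x y x' y' : 'I_d * 'I_d => \sum_a \sum_b (q a b)%:C
  * (choi C a x.1 y.1 x'.1 y'.1 * choi C b x.2 y.2 x'.2 y'.2)).

(** One family F serves both the product law and the pair law. After an odd number of uses the
    invariant keeps the label f of the next use summed over, with its untouched resource pair in the
    memories, since q may correlate f with the label just consumed. *)
Lemma adaptive_output_mixture n a b (rho : 'M[C]_(a * b)) :
  adaptive_output (@holevo_werner R eta d) n rho ->
  exists F : seq bool -> 'M[C]_(a * b),
  [/\ forall s, size s = n -> psdk (F s) /\ \tr (F s) = 1,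
      rho = \sum_(s <- words n) (word_prob (werner_prob eta) s)%:C *: F s,
      ~~ odd n -> sepk (mx_kernel
        (\sum_(s <- words n) (pair_word_prob q s)%:C *: F s)) &
      odd n -> sepk (block_kernel (fun i j i' j' : 'I_d =>
        \sum_(s <- words n) \sum_f
          ((pair_word_prob q (f :: s))%:C * choi C f i j i' j') *: F s))].
Proof.
elim=> {n a b rho} [a b L /LOCC_like lL|n a b a' b' rho L _ [F [Fst Frho Fe Fo]] /LOCC_like lL].
  have one11 (x y x' y' : 'I_1) : (1%:M : 'M[C]_(1 * 1)) (mxtens_index (x, y))
      (mxtens_index (x', y')) = 1.
    by rewrite mxE mxtens_index_eq !ord1 eqxx.
  exists (fun _ => L 1%:M); split=> //.
  - move=> s _; split; last by rewrite (locc_tr lL) mxtrace1.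
    apply: (locc_psd lL); apply: sepk_ext (sepk_prod (fun _ => 1) (fun _ => 1)) _.
    move=> z _ z' _; case: (mxtens_indexP z) => x y; case: (mxtens_indexP z') => x' y'.
    by rewrite one11 rmorphM rmorph1 !mulr1.
  - by rewrite /= big_seq1 /word_prob big_nil scale1r.
  - move=> _; rewrite /= big_seq1 scale1r.
    have : sepk (block_kernel (fun _ _ _ _ : unit => 1%:M : 'M[C]_(1 * 1))).
      apply: sepk_ext (sepk_prod (fun _ => 1) (fun _ => 1)) _ => x y x' y'.
      by rewrite /block_kernel one11 rmorphM rmorph1 !mulr1.
    move=> /(locc_sep lL) /(sepk_comp (pair tt) (pair tt)).
    by move/sepk_ext; apply.
(* The latest use is replaced by the channel with the single label e; the default 0 concerns only
   the empty word, which is not of length n + 1. *)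
exists (fun s => if s is e :: s' then L (transmit (choi_channel e) (F s')) else 0); split.
- case=> [//|e s] [/Fst[ps ts]]; split.
    by apply: (locc_psd lL); apply: transmit_choi_psd.
  by rewrite (locc_tr lL) transmit_choi_tr.
- rewrite sum_wordsS (transmit_holevo_werner d1) locc_sum //; apply: eq_bigr => e _.
  rewrite Frho transmit_choi_sum locc_sum // scaler_sumr; apply: eq_bigr => s _.
  by rewrite scalerA -rmorphM /word_prob big_cons.
- rewrite /= negbK => /Fo sO; rewrite sum_wordsS.
  have := sepk_second_use sO.
  have -> : \sum_e \sum_(s <- words n) (pair_word_prob q (e :: s))%:C
      *: L (transmit (choi_channel e) (F s))
     = L (\sum_e (1 : C) *: \sum_(s <- words n) (pair_word_prob q (e :: s))%:C
         *: transmit (choi_channel e) (F s)).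
    rewrite locc_sum //; apply: eq_bigr => e _.
    by rewrite scale1r locc_sum.
  under [X in L X]eq_bigr do rewrite scale1r.
  move=> sT.
  have : sepk (block_kernel (fun _ _ _ _ : unit => \sum_e \sum_(s <- words n)
     (pair_word_prob q (e :: s))%:C *: transmit (choi_channel e) (F s))).
    by apply: sepk_ext (sepk_comp snd snd sT) _ => x y x' y'.
  move=> /(locc_sep lL) /(sepk_comp (pair tt) (pair tt)).
  by move/sepk_ext; apply.
- rewrite /= => /Fe sT.
  have := locc_sep lL (sepk_first_use q_sep sT).
  move/sepk_ext; apply => x y x' y'.
  rewrite /block_kernel; congr (fun_of_matrix _ _ _).
  rewrite sum_wordsS exchange_big.
  transitivity (\sum_(s <- words n) \sum_e \sum_f
    ((pair_word_prob q s * q e f)%:C * choi C f x.1 y.1 x'.1 y'.1)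
      *: L (transmit (choi_channel e) (F s))); first by [].
  rewrite exchange_big.
  transitivity (\sum_e \sum_(s <- words n) \sum_f
    ((q e f)%:C * choi C f x.1 y.1 x'.1 y'.1)
     *: ((pair_word_prob q s)%:C *: L (transmit (choi_channel e) (F s)))).
    apply: eq_bigr => e _; apply: eq_bigr => s _; apply: eq_bigr => f _.
    by rewrite scalerA rmorphM; congr (_ *: _); ring.
  transitivity (L (\sum_e (1 : C) *: \sum_f ((q e f)%:C * choi C f x.1 y.1 x'.1 y'.1)
     *: \sum_(s <- words n) (pair_word_prob q s)%:C *: transmit (choi_channel e) (F s))).
    rewrite locc_sum //; apply: eq_bigr => e _; rewrite scale1r locc_sum //.
    rewrite exchange_big; apply: eq_bigr => f _.
    by rewrite (locc_sum _ _ _ lL) scaler_sumr.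
  congr (L _); apply: eq_bigr => e _; rewrite scale1r; apply: eq_bigr => f _.
  by rewrite transmit_choi_sum.
Qed.

End Decomposition.

(** * Key rates *)

Section Bound.
Variable R : realType.
Local Notation C := R[i].

Lemma Re_tr_proj_ge n (P X : 'M[C]_n) : P ^t* = P -> P *m P = P ->
  - trace_norm X <= complex.Re (\tr (P *m X)).
Proof.
move=> hP PP; have [-> h] := tr_proj_spectral X hP PP.
rewrite Re_sum /trace_norm -sumrN; apply: ler_sum => i _.
move: (h i); set z := fun_of_matrix _ 0 0; set y := spectral_diag _ _ _ => zy.
have y0 : 0 <= y by apply: le_trans zy; rewrite exprn_ge0.
have yE : y = (complex.Re y)%:C by rewrite RRe_real // ger0_real.
rewrite lerNl; apply: le_trans (ler_norm _) _; rewrite normrN.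
rewrite -(ger0_norm (normr_ge0 (complex.Re z))) -sqrtr_sqr ler_sqrt -?ler0c -?yE //.
rewrite -lecR -yE rmorphXn /=; apply: le_trans zy.
by rewrite lerXn2r ?nnegrE ?normc_ge_Re // ler0c.
Qed.

(** The chord of ln between 1 and K lies below the graph: the tangent bound at M, averaged over the
    points K and 1 with weights t and 1 - t. *)
Lemma ln_le_convex (t K : R) : 0 <= t -> t <= 1 -> 1 <= K ->
  t * ln K <= ln (1 + t * (K - 1)).
Proof.
move=> t0 t1 K1; pose M := 1 + t * (K - 1).
have M0 : 0 < M by rewrite /M; nra.
have K0 : 0 < K by lra.
have h1 := ln_le_subr1 (divr_gt0 K0 M0).
have h2 := ln_le_subr1 (divr_gt0 ltr01 M0).
rewrite !ln_div ?posrE // in h1 h2; rewrite ln1 in h2.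
have e : t * (K / M - 1) + (1 - t) * (1 / M - 1) = 0.
  by rewrite /M; field; rewrite gt_eqF.
rewrite -/M; nra.
Qed.

(* The inequality [ln y <= y / 2 - 1 + ln 2] at [y = Q (1 + t (K - 1)) / P]. *)
Lemma test_pointwise (P Q t K : R) : 0 <= P -> 0 <= Q -> (0 < P -> 0 < Q) ->
  0 <= t -> t <= 1 -> 1 <= K ->
  P * t * ln K + P * (ln Q - ln P) <= Q * (1 + t * (K - 1)) / 2 - P + P * ln 2.
Proof.
move=> P0 Q0 PQ t0 t1 K1; pose M := 1 + t * (K - 1).
have M0 : 0 < M by rewrite /M; nra.
have [->|nP] := eqVneq P 0.
  by rewrite !mul0r addr0 subr0 addr0 divr_ge0 // mulr_ge0 // ltW.
have Pp : 0 < P by rewrite lt_neqAle eq_sym nP P0.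
have Qp := PQ Pp.
have h : 0 < Q * M / P / 2 by rewrite !divr_gt0 // mulr_gt0.
have := ln_le_subr1 h.
rewrite !ln_div ?lnM ?posrE ?divr_gt0 ?mulr_gt0 // => h1.
have h2 := ln_le_convex t0 t1 K1.
have h3 : t * ln K + (ln Q - ln P) <= Q * M / P / 2 - 1 + ln 2 by rewrite -/M in h2; lra.
have := ler_wpM2l (ltW Pp) h3; rewrite mulrDr mulrA => /le_trans; apply.
have -> : P * (Q * M / P / 2 - 1 + ln 2) = Q * M / 2 - P + P * ln 2 by field.
exact: lexx.
Qed.

(** In the sum of [test_pointwise] with K = k, the total of Q (1 + t (k - 1)) is at most 2. Its half
    is thus compensated by the total -1 of -P, and only ln 2 is lost. *)
Lemma binary_test_bound (I : eqType) (s : seq I) (P Q t : I -> R) (k : nat) (eps : R) :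
  (0 < k)%N -> (forall i, i \in s -> 0 <= P i) -> (forall i, i \in s -> 0 <= Q i) ->
  (forall i, i \in s -> 0 < P i -> 0 < Q i) ->
  (forall i, i \in s -> 0 <= t i <= 1) ->
  \sum_(i <- s) P i = 1 -> \sum_(i <- s) Q i = 1 ->
  1 - eps <= \sum_(i <- s) P i * t i -> \sum_(i <- s) Q i * t i <= k%:R^-1 ->
  (1 - eps) * ln k%:R <= \sum_(i <- s) P i * (ln (P i) - ln (Q i)) + ln 2.
Proof.
move=> k0 P0 Q0 PQ t01 P1 Q1 Pt Qt.
have K1 : 1 <= k%:R :> R by rewrite ler1n.
have L0 : 0 <= ln k%:R :> R by rewrite ln_ge0.
have : \sum_(i <- s) (P i * t i * ln k%:R + P i * (ln (Q i) - ln (P i)))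
   <= \sum_(i <- s) (Q i * (1 + t i * (k%:R - 1)) / 2 - P i + P i * ln 2).
  rewrite big_seq [X in _ <= X]big_seq; apply: ler_sum => i si.
  by have /andP[? ?] := t01 i si; apply: test_pointwise; auto.
rewrite big_split /= -mulr_suml big_split sumrB /= -!mulr_suml P1.
have -> : \sum_(i <- s) Q i * (1 + t i * (k%:R - 1))
    = 1 + (\sum_(i <- s) Q i * t i) * (k%:R - 1).
  rewrite -[X in _ = X + _]Q1 mulr_suml -big_split; apply: eq_bigr => i _ /=; ring.
have -> : \sum_(i <- s) P i * (ln (Q i) - ln (P i))
    = - \sum_(i <- s) P i * (ln (P i) - ln (Q i)).
  by rewrite -sumrN; apply: eq_bigr => i _; ring.
have : (\sum_(i <- s) Q i * t i) * (k%:R - 1) <= 1.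
  apply: le_trans (ler_wpM2r _ Qt) _; first by rewrite subr_ge0.
  rewrite mulrBr mulVf ?mulr1; last by rewrite pnatr_eq0 -lt0n.
  by rewrite gerBl invr_ge0.
have := ler_wpM2r L0 Pt; lra.
Qed.

Section WordDivergence.
Variables (p : bool -> R) (q : bool -> bool -> R).
Hypothesis p_ge0 : forall e, 0 <= p e.
Hypothesis p_sum : \sum_e p e = 1.
Hypothesis q_ge0 : forall e f, 0 <= q e f.
Hypothesis q_sum : \sum_e \sum_f q e f = 1.
Hypothesis pq : forall e f, 0 < p e * p f -> 0 < q e f.

Lemma word_prob_cons e s : word_prob p (e :: s) = p e * word_prob p s.
Proof. by rewrite /word_prob big_cons. Qed.

Lemma word_prob_ge0 s : 0 <= word_prob p s.
Proof. by rewrite /word_prob prodr_ge0. Qed.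

Lemma sum_word_prob n : \sum_(s <- words n) word_prob p s = 1.
Proof.
elim: n => [|n ih]; first by rewrite /= big_seq1 /word_prob big_nil.
rewrite sum_wordsS -p_sum; apply: eq_bigr => e _.
by under eq_bigr do rewrite word_prob_cons; rewrite -mulr_sumr ih mulr1.
Qed.

Lemma sum_wordsSS (f : seq bool -> R) n :
  \sum_(s <- words n.+2) f s = \sum_g \sum_e \sum_(s <- words n) f [:: g, e & s].
Proof. by rewrite sum_wordsS; apply: eq_bigr => g _; rewrite sum_wordsS. Qed.

Lemma words_evenP m (Pr : seq bool -> Prop) : Pr [::] ->
  (forall g e s, Pr s -> Pr [:: g, e & s]) -> forall s, s \in words m.*2 -> Pr s.
Proof.
move=> P0 PS; elim: m => [|m ih] s; first by rewrite inE => /eqP->.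
rewrite doubleS /= => /allpairsP[[g t] [_ /= /allpairsP[[e u] [_ /= su ->]] ->]].
exact/PS/ih.
Qed.

Lemma pair_word_prob_ge0 m s : s \in words m.*2 -> 0 <= pair_word_prob q s.
Proof. by move: s; apply: words_evenP => [|g e s h] /=; rewrite ?ler01 ?mulr_ge0. Qed.

Lemma pair_word_prob_gt0 m s : s \in words m.*2 -> 0 < word_prob p s ->
  0 < pair_word_prob q s.
Proof.
move: s; apply: words_evenP => [|g e s h] //=.
rewrite !word_prob_cons mulrA => h1.
have w0 : 0 < word_prob p s.
  rewrite lt_neqAle word_prob_ge0 andbT; apply/negP => /eqP z.
  by rewrite -z mulr0 ltxx in h1.
by rewrite mulr_gt0 ?h // pq // mulrC -(pmulr_lgt0 _ w0).
Qed.

Lemma sum_pair_word_prob m : \sum_(s <- words m.*2) pair_word_prob q s = 1.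
Proof.
elim: m => [|m ih]; first by rewrite /= big_seq1.
rewrite doubleS sum_wordsSS -q_sum exchange_big; apply: eq_bigr => e _.
by apply: eq_bigr => g _; rewrite /= -mulr_suml ih mul1r.
Qed.

(** Additivity of the divergence over m independent pairs. Words of probability 0 are set aside
    first, as the logarithm of a product splits only for positive factors. *)
Lemma sum_word_divergence m :
  \sum_(s <- words m.*2) word_prob p s * (ln (word_prob p s) - ln (pair_word_prob q s))
  = m%:R * \sum_e \sum_f p e * p f * (ln (p e * p f) - ln (q e f)).
Proof.
elim: m => [|m ih].
  by rewrite /= big_seq1 /word_prob big_nil ln1 subrr mulr0 mul0r.
rewrite doubleS sum_wordsSS exchange_big.
transitivity (\sum_e \sum_f (p e * p f * (ln (p e * p f) - ln (q e f)) + p e * p f *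
   \sum_(s <- words m.*2) word_prob p s * (ln (word_prob p s) - ln (pair_word_prob q s)))).
  apply: eq_bigr => e _; apply: eq_bigr => f _.
  rewrite -[X in X + _]mulr1 -(sum_word_prob m.*2) !mulr_sumr -big_split /=.
  rewrite big_seq [RHS]big_seq; apply: eq_bigr => s sm.
  rewrite !word_prob_cons.
  have [z|nz] := eqVneq (p f * (p e * word_prob p s)) 0.
    rewrite z mul0r; have : p e * p f * word_prob p s = 0 by rewrite -z; ring.
    move=> /eqP; rewrite mulf_eq0 => /orP[/eqP->|/eqP->]; first by rewrite !mul0r addr0.
    by rewrite mulr0 mul0r mulr0 addr0.
  move: nz; rewrite !mulf_eq0 !negb_or => /and3P[f0 e0 s0].
  have pf : 0 < p f by rewrite lt_neqAle eq_sym f0 p_ge0.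
  have pe : 0 < p e by rewrite lt_neqAle eq_sym e0 p_ge0.
  have ps : 0 < word_prob p s by rewrite lt_neqAle eq_sym s0 word_prob_ge0.
  have Qs := pair_word_prob_gt0 sm ps.
  have qef : 0 < q e f by rewrite pq // mulr_gt0.
  rewrite !lnM ?posrE ?mulr_gt0 //; ring.
rewrite ih -natr1.
under eq_bigr do rewrite big_split /= -mulr_suml -mulr_sumr p_sum mulr1.
by rewrite big_split /= -mulr_suml p_sum; ring.
Qed.

End WordDivergence.
End Bound.

(** * The key bound from a fixed separable state *)

Section Key.
Variable R : realType.
Local Notation C := R[i].

Lemma max_ent_vecE k (i j : 'I_k) : max_ent_vec R k (mxtens_index (i, j)) 0
  = ((Num.sqrt k%:R)^-1)%:C * (i == j)%:R.
Proof.
rewrite mxE summxE; congr (_ * _); rewrite (bigD1 i) //= big1 => [|l nl]; last first.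
  by rewrite mxE mxtens_index_eq eq_sym (negPf nl).
by rewrite mxE mxtens_index_eq !eqxx andbT addr0 eq_sym.
Qed.

Lemma max_ent_coef_sq k : ((Num.sqrt k%:R)^-1)%:C * Num.conj ((Num.sqrt k%:R)^-1)%:C
  = k%:R^-1 :> C.
Proof.
rewrite conj_real -rmorphM /= -expr2 exprVn sqr_sqrtr ?ler0n //.
by rewrite fmorphV rmorph_nat.
Qed.

Lemma psdmx_psdk n (X : 'M[C]_n) : psdmx X -> psdk X.
Proof.
move=> /psd_factor[v e].
apply: sepk_ext (sepk_sum (index_enum 'I_n) (fun i _ => sepk_prod (v i) (fun _ : unit => 1))) _.
by move=> z _ z' _; rewrite e; apply: eq_bigr => i _; rewrite !mulr1.
Qed.

Section Resource.
Variables (d : nat) (eta : R) (sigma : 'M[C]_((d * d) * (d * d))).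
Hypothesis d1 : (1 < d)%N.
Hypothesis eta_ge : -1 <= eta.
Hypothesis eta_le : eta <= 0.
Hypothesis sigma_sep : @separable R (d * d) (d * d) sigma.

Definition resource_prob (s : bool * bool) : R := complex.Re (\tr (pairmx C d s *m sigma)).

Lemma resource_probE s : \tr (pairmx C d s *m sigma) = (resource_prob s)%:C.
Proof.
rewrite /resource_prob RRe_real // ger0_real //; apply: psdk_tr_proj.
- exact: pairmx_herm.
- by rewrite pairmx_mul eqxx scale1r.
- exact/psdmx_psdk/separable_psd.
Qed.

Lemma resource_prob_ge0 s : 0 <= resource_prob s.
Proof.
rewrite -ler0c -resource_probE; apply: psdk_tr_proj.
- exact: pairmx_herm.
- by rewrite pairmx_mul eqxx scale1r.
- exact/psdmx_psdk/separable_psd.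
Qed.

Lemma resource_prob_sum : \sum_e \sum_f resource_prob (e, f) = 1.
Proof.
rewrite pair_big /=; apply: (@complexI R); rewrite rmorph_sum rmorph1 /=.
rewrite -(separable_tr sigma_sep) -[in RHS](mul1mx sigma) -pairmx_sum mulmx_suml linear_sum.
by apply: eq_bigr => -[e f] _; rewrite /= -resource_probE.
Qed.

Lemma resource_twirl_sep :
  sepk (fun x y x' y' : 'I_d * 'I_d => \sum_a \sum_b (resource_prob (a, b))%:C
    * (choi C a x.1 y.1 x'.1 y'.1 * choi C b x.2 y.2 x'.2 y'.2)).
Proof.
have := sepk_comp (@mxtens_index d d) (@mxtens_index d d) (separable_sepk sigma_sep).
move=> /(sepk_pair_twirl d1)/sepk_ext; apply=> x y x' y'.
apply: eq_bigr => a _; apply: eq_bigr => b _; congr (_ * _).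
by rewrite -resource_probE tr_pairmx.
Qed.

(** The test P is built from the twisting of the target private state. The values T w = Tr(P F w)
    form a randomised test between the product law, where it accepts with probability at least 1 -
    eps, and the pair law, where separability caps it at 1/k. The final 1 is log2 2. *)
Lemma distills_key_bound m eps k :
  (forall s, 0 < pair_prob eta s -> 0 < resource_prob s) ->
  distills_key (@holevo_werner R eta d) m.*2 eps k ->
  (1 - eps) * log2 k%:R <= m%:R * rel_ent (pair_prob eta) resource_prob + 1.
Proof.
move=> pq [s [t [rho [gamma [out [k0 [tau [V [[_ tau1] uV gammaE]]]] close]]]]].
have c0E := max_ent_coef_sq k.
pose P := key_proj (max_ent_vec R k) V.
have hP : P ^t* = P by exact: key_proj_herm.
have PP : P *m P = P by exact: (key_proj_idem c0E k0 (@max_ent_vecE k) uV).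
have Pgamma : \tr (P *m gamma) = 1.
  by rewrite gammaE; exact: (key_proj_private c0E k0 (@max_ent_vecE k) uV).
have [F [Fst rhoE Fsep _]] := adaptive_output_mixture d1 resource_twirl_sep out.
pose T w := complex.Re (\tr (P *m F w)).
(* The private state is accepted with probability 1, and replacing it by rho costs at most the trace
   norm of the difference. *)
have Pr : 1 - eps <= complex.Re (\tr (P *m rho)).
  have := Re_tr_proj_ge (rho - gamma) hP PP.
  rewrite mulmxBr mxtraceB ReB Pgamma /= => h; lra.
pose p := werner_prob eta.
pose q e f := resource_prob (e, f).
have p0 e : 0 <= p e by exact: werner_prob_ge0.
have p1 : \sum_e p e = 1.
  by rewrite big_bool /p /werner_prob /= expr0 expr1; field.
have q0 e f : 0 <= q e f by exact: resource_prob_ge0.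
have pq' e f : 0 < p e * p f -> 0 < q e f by exact: (pq (e, f)).
have T01 w : w \in words m.*2 -> 0 <= T w <= 1.
  move=> /size_words/Fst[pF tF].
  have ge0 (Q : 'M[C]_((k * s) * (k * t))) : Q ^t* = Q -> Q *m Q = Q ->
      0 <= complex.Re (\tr (Q *m F w)).
    by move=> hQ QQ; have := psdk_tr_proj hQ QQ pF; rewrite lecE => /andP[].
  rewrite /T ge0 //=.
  have : 0 <= complex.Re (\tr ((1%:M - P) *m F w)).
    apply: ge0; first by rewrite linearB /= map_mxB trmx1 map_mx1 hP.
    by rewrite mulmxBl mul1mx mulmxBr mulmx1 PP subrr subr0.
  by rewrite mulmxBl mul1mx mxtraceB ReB tF /= subr_ge0.
have PT : 1 - eps <= \sum_(w <- words m.*2) word_prob p w * T w.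
  apply: le_trans Pr _; rewrite rhoE mulmx_sumr [\tr _]linear_sum Re_sum.
  by apply: ler_sum => w _; rewrite -scalemxAr linearZ /= Re_realM.
have QT : \sum_(w <- words m.*2) pair_word_prob q w * T w <= k%:R^-1.
  have := tr_key_proj_le c0E (@max_ent_vecE k) uV (Fsep _).
  rewrite odd_double => /(_ isT); rewrite -/P mulmx_sumr !linear_sum /= => h.
  rewrite -lecR rmorph_sum; apply: le_trans (_ : _ <= k%:R^-1 * 1) _; last first.
    by rewrite mulr1 fmorphV rmorph_nat.
  have e1 : \sum_(w <- words m.*2) \tr ((pair_word_prob q w)%:C *: F w) = 1.
    rewrite -(rmorph1 (real_complex R)) /= -(sum_pair_word_prob resource_prob_sum m).
    rewrite rmorph_sum big_seq [RHS]big_seq; apply: eq_bigr => w /size_words/Fst[_ tF].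
    by rewrite linearZ /= tF mulr1.
  rewrite -[X in _ <= _ * X]e1; refine (le_trans _ h); rewrite big_seq [X in _ <= X]big_seq.
  apply: ler_sum => w /size_words/Fst[pF _]; rewrite -scalemxAr linearZ /= rmorphM /=.
  by rewrite /T RRe_real // ger0_real // psdk_tr_proj.
have := binary_test_bound k0 (fun w _ => word_prob_ge0 p0 w) (pair_word_prob_ge0 q0 (m := m))
  (pair_word_prob_gt0 p0 pq' (m := m)) T01 (sum_word_prob p1 _)
  (sum_pair_word_prob resource_prob_sum m) PT QT.
rewrite (sum_word_divergence p0 p1 pq').
have l2 := ln2_gt0 R.
have -> : \sum_e \sum_f p e * p f * (ln (p e * p f) - ln (q e f))
    = rel_ent (pair_prob eta) resource_prob * ln 2.
  rewrite pair_big /= /rel_ent mulr_suml; apply: eq_bigr => -[e f] _ /=.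
  by rewrite /log2 -mulrBl -[RHS]mulrA divfK ?gt_eqF.
move=> h; rewrite -(ler_pM2r l2) /log2 -mulrA divfK ?gt_eqF //.
by apply: le_trans h _; rewrite mulrDl mul1r mulrA.
Qed.
End Resource.
End Key.

(** * Asymptotic rates *)

Section Capacity.
Variable R : realType.
Local Notation C := R[i].

(** Bounds at even n suffice, because a limit over all n is also the limit along the even
    subsequence; starting from m + 1 avoids n = 0. *)
Lemma rate_limit_le (f : R^nat) (l : \bar R) (c : R) :
  (f n)%:E @[n --> \oo] --> l ->
  (forall m, f m.+1.*2 <= c + (m.+1)%:R^-1) -> (l <= c%:E)%E.
Proof.
move=> fl fc; apply/lee_addgt0Pr => e e0; rewrite -EFinD.
have sub : (f m.+1.*2)%:E @[m --> \oo] --> l.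
  apply: (cvg_comp (fun m : nat => m.+1.*2) (fun n => (f n)%:E) _ fl).
  move=> A [N _ hN]; exists N => // m /= Nm; apply: hN => /=.
  by rewrite (leq_trans Nm) // -addnn addSn ltnW // ltnS leq_addr.
apply: (cvge_le _ sub).
have [N hN] : exists N : nat, e^-1 < N%:R :> R.
  by exists (Num.truncn e^-1).+1; apply: truncnS_gt.
exists N => // m /= Nm; rewrite lee_fin; apply: le_trans (fc m) _; rewrite lerD2l.
rewrite invf_ple ?posrE ?ltr0n //; apply: le_trans (ltW hN) _.
by rewrite ler_nat ltnW.
Qed.

Lemma distills_key_mono d e (E : 'M[C]_d -> 'M[C]_e) n (eps eps' : R) k : eps <= eps' ->
  distills_key E n eps k -> distills_key E n eps' k.
Proof.
move=> ee [s [t [rho [gamma [h1 h2 h3]]]]]; exists s, t, rho, gamma; split=> //.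
exact: le_trans ee.
Qed.

Lemma eps_key_capacity_mono d e (E : 'M[C]_d -> 'M[C]_e) (eps eps' : R) : eps <= eps' ->
  (eps_key_capacity E eps <= eps_key_capacity E eps')%E.
Proof.
move=> ee; apply: ereal_sup_le => l [k [h1 h2]]; exists k; split=> // n n0.
exact: distills_key_mono ee (h1 n n0).
Qed.

(** Gibbs' inequality, from ln y <= y - 1 at y = q i / p i; the labels with p i = 0 only contribute
    to the slack. *)
Lemma rel_ent_ge0 (I : finType) (p q : I -> R) : (forall i, 0 <= p i) ->
  (forall i, 0 < p i -> 0 < q i) -> \sum_i p i = 1 -> (forall i, 0 <= q i) ->
  \sum_i q i = 1 -> 0 <= rel_ent p q.
Proof.
move=> p0 pq p1 q0 q1.
have := @sum_log2_le R I p (fun i => q i / p i) p0.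
have h i : 0 < p i -> 0 < q i / p i by move=> pi0; rewrite divr_gt0 // pq.
move=> /(_ h) le1.
have le2 : \sum_i p i * (q i / p i - 1) <= 0.
  apply: le_trans (_ : \sum_i (q i - p i) <= _); last by rewrite sumrB p1 q1 subrr.
  apply: ler_sum => i _; have [->|n0] := eqVneq (p i) 0.
    by rewrite mul0r subr0 q0.
  by rewrite mulrBr mulr1 mulrCA divff // mulr1.
have : \sum_i p i * log2 (q i / p i) <= 0.
  apply: le_trans le1 _; rewrite mulr_le0_ge0 // invr_ge0 ltW ?ln2_gt0 //.
rewrite -oppr_ge0 -sumrN /rel_ent => /le_trans; apply; apply: ler_sum => i _.
have [->|n0] := eqVneq (p i) 0; first by rewrite !mul0r oppr0.
have pp : 0 < p i by rewrite lt_neqAle eq_sym n0 p0.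
by rewrite log2_div ?pq // -mulrN opprB.
Qed.

Section HW.
Variables (d : nat) (eta : R).
Hypothesis d1 : (1 < d)%N.
Hypothesis eta_ge : -1 <= eta.
Hypothesis eta_le : eta <= 0.
Local Notation W2 := (mid_swap (werner eta d *t werner eta d)).
Local Notation ER2 := (@rel_entropy_ent R (d * d) (d * d) W2).

(** For each protocol the bound is applied with a nearly optimal sigma. Over 2 m uses the additive 1
    costs 1 / (2 m (1 - eps)), at most 1/m because eps <= 1/2. *)
Lemma eps_key_capacity_le (eps x : R) : 0 < eps -> eps <= 2^-1 -> ER2 = x%:E ->
  (eps_key_capacity (@holevo_werner R eta d) eps <= (x / (2 * (1 - eps)))%:E)%E.
Proof.
move=> e0 e1 xE; apply: ge_ereal_sup => l [k [hk hl]].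
have c0 : 0 < 2 * (1 - eps) by lra.
have p0 s : 0 <= pair_prob eta s by rewrite mulr_ge0 ?werner_prob_ge0.
apply/lee_addgt0Pr => delta delta0; rewrite -EFinD.
(* This slack becomes exactly delta on division by 2 (1 - eps). *)
have : (ER2 < (x + delta * (2 * (1 - eps)))%:E)%E.
  by rewrite xE lte_fin ltrDl mulr_gt0.
move=> /ereal_inf_lt[_ [sigma sep <-]].
have := rel_entropy_mixture_ge (@pairmx_mul C d) (@pairmx_sum C d)
  (@pairmx_herm C d) (@pairmx_trC R d) (fun s => pair_dim_gt0 R s d1) p0 (separable_psd sep).
rewrite -werner_pair_mixture // => -[->|[qpos le1]]; first by rewrite ltNge leey.
move=> /(le_lt_trans le1); rewrite lte_fin => lt1.
have bound m : (1 - eps) * log2 (k m.+1.*2)%:R <= m.+1%:R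
    * rel_ent (pair_prob eta) (resource_prob sigma) + 1.
  by apply: distills_key_bound => //; apply: hk; rewrite doubleS.
apply: (rate_limit_le hl) => m.
have M0 : 0 < m.+1%:R :> R by rewrite ltr0n.
have M2 : m.+1.*2%:R = 2 * m.+1%:R :> R by rewrite -mul2n natrM.
rewrite M2 ler_pdivrMr ?mulr_gt0 //.
have e2 : 0 < 1 - eps by lra.
have i0 : 0 < (1 - eps)^-1 by rewrite invr_gt0.
have := ler_wpM2l (ltW i0) (bound m); rewrite mulKf ?gt_eqF // => /le_trans; apply.
have i2 : (1 - eps)^-1 <= 2.
  by rewrite -[X in _ <= X]invrK lef_pV2 ?posrE ?invr_gt0 //; lra.
have eR : (x / (2 * (1 - eps)) + delta + m.+1%:R^-1) * (2 * m.+1%:R)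
    = (1 - eps)^-1 * (m.+1%:R * (x + delta * (2 * (1 - eps)))) + 2.
  by field; rewrite ?gt_eqF.
rewrite eR mulrDr mulr1 lerD // ler_wpM2l ?(ltW i0) // ler_wpM2l ?(ltW M0) //.
exact: ltW.
Qed.

Lemma rel_entropy_ent_pair_ge0 : (0 <= ER2)%E.
Proof.
apply: le_ereal_inf_tmp => _ [sigma sep <-].
have p0 s : 0 <= pair_prob eta s by rewrite mulr_ge0 ?werner_prob_ge0.
rewrite werner_pair_mixture //.
have [->|[qpos]] := rel_entropy_mixture_ge (@pairmx_mul C d) (@pairmx_sum C d)
  (@pairmx_herm C d) (@pairmx_trC R d) (fun s => pair_dim_gt0 R s d1) p0
  (separable_psd sep); first by rewrite leey.
apply: le_trans; rewrite lee_fin; apply: rel_ent_ge0 => //.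
- rewrite -(pair_big xpredT xpredT (fun a b => pair_prob eta (a, b))) /= !big_bool.
  by rewrite /pair_prob /werner_prob /= expr0 expr1; field.
- by move=> s; exact: (resource_prob_ge0 sep).
- by rewrite -(resource_prob_sum sep) pair_big; apply: eq_bigr => -[].
Qed.

(** The limit at 0 exists because the capacity is monotone in eps, and x / (2 (1 - eps)) is within
    delta of x / 2 for small eps. *)
Lemma key_capacity_le (x : R) : ER2 = x%:E ->
  (key_capacity (@holevo_werner R eta d) <= (x / 2)%:E)%E.
Proof.
move=> xE; have x0 : 0 <= x by rewrite -lee_fin -xE rel_entropy_ent_pair_ge0.
apply/lee_addgt0Pr => delta delta0; rewrite -EFinD /key_capacity.
apply: lime_le.
  apply: nondecreasing_at_right_is_cvge; near=> e => a b _ _.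
  exact: eps_key_capacity_mono.
near=> eps.
have e0 : 0 < eps by near: eps; exact: nbhs_right_gt.
have e1 : eps <= 2^-1 by near: eps; apply: nbhs_right_le; rewrite invr_gt0.
(* Together with eps <= 1/2 this gives eps x <= delta <= 2 delta (1 - eps); x + 1 rather than x
   covers x = 0. *)
have e2 : eps <= delta / (x + 1) by near: eps; apply: nbhs_right_le; rewrite divr_gt0 //; lra.
apply: le_trans (eps_key_capacity_le e0 e1 xE) _; rewrite lee_fin.
have c0 : 0 < 2 * (1 - eps) by lra.
rewrite ler_pdivrMr //.
have : eps * (x + 1) <= delta by rewrite -ler_pdivlMr //; lra.
nra.
Unshelve. all: by end_near.
Qed.
End HW.
End Capacity.

Theorem mainTheorem3 (R : realType) (d : nat) (eta : R)
    (hd : (2 <= d)%N) (heta1 : -1 <= eta) (heta2 : eta < - (2 / d%:R)) :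
  (key_capacity (@holevo_werner R eta d)
     <= @rel_entropy_ent2 R d d (werner eta d))%E /\
  (@rel_entropy_ent2 R d d (werner eta d)
     < @rel_entropy_ent R d d (werner eta d))%E.
Proof.
(* For d = 2 the hypotheses would read -1 <= eta < -1. *)
have d2 : (2 < d)%N.
  rewrite ltn_neqAle hd andbT; apply/negP => /eqP d2.
  by move: heta2; rewrite -d2 divff ?pnatr_eq0 // ltNge heta1.
have eta0 : eta <= 0.
  by apply: le_trans (ltW heta2) _; rewrite oppr_le0 divr_ge0 ?ler0n.
have strict := rel_entropy_ent2_lt d2 heta1 heta2; split=> //.
have ge0 := rel_entropy_ent_pair_ge0 hd heta1 eta0.
move: strict; rewrite /rel_entropy_ent2.
have := @key_capacity_le R d eta hd heta1 eta0.
(* The value -oo is excluded by non-negativity, and for +oo the bound on the capacity is trivial. *)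
move: ge0; case: (rel_entropy_ent _) => [x||//] _ cap _.
  by rewrite -EFinM mulrC cap.
by rewrite mulry gtr0_sg ?invr_gt0 // mul1e leey.
Qed.
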